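(* Let $a>0$, $x>0$, $0<\theta,\psi<1$, let $k\geq 1$ be an odd integer, and let $\nu\in\mathbb{C}$ with $\Re(\nu)>0$. Then \begin{align*} &\left(\frac{a^2x}{4}\right)^{\frac{\nu}{2}+k+1}\sum_{n=1}^{\infty} n^{\nu/2}K_{\nu}(a\sqrt{nx})\sum_{d\mid n}d^k\cos(2\pi d\theta)\cos\left(\frac{2\pi n\psi}{d}\right)\\ &=\frac{(-1)^{\frac{k-1}{2}}a^{2k+2}k!}{2^{2k+4}(2\pi)^{k+1}}\Gamma(\nu)\bigl\{\zeta(k+1,\theta)+\zeta(k+1,1-\theta)\bigr\}x^{k+1}\\ &\quad+\frac{(-1)^{\frac{k+1}{2}}}{8}(2\pi)^{k+1}\Gamma(\nu+k+1)\sum_{n,m\geq 0}\left\{\frac{(n+\psi)^k}{\left(\frac{16\pi^2}{a^2}\frac{(m+\theta)(n+\psi)}{x}+1\right)^{\nu+k+1}}+\frac{(n+1-\psi)^k}{\left(\frac{16\pi^2}{a^2}\frac{(m+\theta)(n+1-\psi)}{x}+1\right)^{\nu+k+1}}\right.\\ &\qquad\left.+\frac{(n+\psi)^k}{\left(\frac{16\pi^2}{a^2}\frac{(m+1-\theta)(n+\psi)}{x}+1\right)^{\nu+k+1}}+\frac{(n+1-\psi)^k}{\left(\frac{16\pi^2}{a^2}\frac{(m+1-\theta)(n+1-\psi)}{x}+1\right)^{\nu+k+1}}\right\}. \end{align*}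
   Context: $K_\nu$ denotes the modified Bessel function of the second kind of order $\nu$. $\zeta(s,\alpha)=\sum_{n=0}^\infty (n+\alpha)^{-s}$ ($\Re s>1$) is the Hurwitz zeta function. The double sum runs over all pairs of non-negative integers $m,n$. *)

(* Defs.v *)
From Stdlib Require Import Reals.
From Coquelicot Require Export Coquelicot.
Open Scope R_scope.

Definition cpow (b : R) (s : C) : C :=
  (exp (fst s * ln b) * cos (snd s * ln b), exp (fst s * ln b) * sin (snd s * ln b)).

Definition cexp (z : C) : C :=
  (exp (fst z) * cos (snd z), exp (fst z) * sin (snd z)).

Definition cint0inf (f : R -> C) : C :=
  @RInt_gen C_R_CompleteNormedModule f (at_right 0) (Rbar_locally p_infty).

Definition cGamma (s : C) : C :=
  cint0inf (fun t => Cmult (cpow t (Cminus s (RtoC 1))) (RtoC (exp (- t)))).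

(* Modified Bessel function of the second kind, for real z > 0 and complex nu:
   K_nu(z) = int_0^oo exp(-z cosh t) cosh(nu t) dt   (DLMF 10.32.9) *)
Definition besselK (nu : C) (z : R) : C :=
  cint0inf (fun t => Cmult (RtoC (exp (- z * cosh t)))
     (Cmult (RtoC (1/2)) (Cplus (cexp (Cmult nu (RtoC t)))
                                (cexp (Cmult (Copp nu) (RtoC t)))))).

Definition hurwitz_zeta (s alpha : R) : R :=
  Series (fun n => Rpower (INR n + alpha) (- s)).

Definition CSeries (a : nat -> C) : C :=
  (Series (fun n => fst (a n)), Series (fun n => snd (a n))).

Definition divisor_sum (n : nat) (f : nat -> R) : R :=
  sum_f_R0 (fun i => if Nat.eqb (n mod (S i)) 0 then f (S i) else 0) (n - 1).

(* Main.v *)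
(** With [y = a^2 x / 4], the formula
    [2 (n y)^(nu/2) K_nu(a sqrt(n x)) = int_0^oo u^(nu-1) exp(-u - n y/u) du] turns the series of Bessel functions,
    multiplied by [2 y^(nu/2)], into the integral over [u > 0] of [u^(nu-1) e^(-u) S(y/u)], where
    [S(w) = sum_(d,e >= 1) d^k cos(2 pi d theta) cos(2 pi e psi) e^(-d e w)].

    The function [S] is transformed by applying the Lipschitz formula
    [sum_(j in Z) e^(2 pi i j x) (b + 2 pi i j)^(-k-1) = sum_(n >= 0) (n + x)^k e^(-b (n + x)) / k!] twice: at [x = 0] it
    turns the sum over [d] into one over the shifted integers [m + theta]; after exchanging the sums over [e] and [m],
    at [x = psi] it turns the sum over [e] into one over [n + psi].  The term [e = 0] gives the Hurwitz zeta values.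
    For [k = 1] the double sum over [(e, m)] does not converge absolutely; the exchange is justified by summation by
    parts, which is possible because [psi] is not an integer.

    Integrating the transformed [S] term by term produces Gamma integrals.  Partial sums of both expansions of [S] are
    within [eps_N * (power of u)] of [S(y/u)], so the integrals of the two kinds of partial sums have the same limit. *)
Require Import Defs.
From Stdlib Require Import Reals Factorial Lra Lia Psatz ZArith.
From Coquelicot Require Import Coquelicot.
Open Scope R_scope.

(** * Real series *)

(** Convergence of the Bessel series is part of the claim and comes out together with its value. No
    theorem on exchanging a limit with an improper integral is invoked: each tail is bounded by a
    null sequence times a power of [u], and that power is integrated against a majorant [Dom] with
    an explicit antiderivative. The exponents are tuned for this. The tail of the divisor-sum
    expansion costs [(y/u)^(-(k+3))], harmless at [u = 0] and beaten by [e^(-u)] at infinity. The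
    tail of the transformed expansion costs [u^(-(k+1+d))] with [d = Re nu / 2]; the factor
    [u^(k+1)] produced by the transformation leaves [u^(-d)], still integrable at 0 against
    [u^(Re nu - 1)]. Oddness of [k] enters twice: [i^(k+1)] is real, so the two lattice variables
    can be exchanged at the cost of a real factor, and the real part of [(s + 2 pi i al)^(-k-1)] is
    even in [s], so the second difference at [e = 0] obeys the same bound as the others. The
    transformation needs real parts only and is stated for real series; complex values return with
    [nu]. *)

Lemma ex_series_le_R (u v : nat -> R) : (forall n, Rabs (u n) <= v n) -> ex_series v -> ex_series u.
Proof. exact (@ex_series_le R_AbsRing R_CompleteNormedModule u v). Qed.

Lemma ex_series_scal_R c (u : nat -> R) : ex_series u -> ex_series (fun n => c * u n).
Proof. exact (ex_series_scal (K := R_AbsRing) (V := R_NormedModule) c u). Qed.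

Lemma ex_series_plus_R (u v : nat -> R) : ex_series u -> ex_series v -> ex_series (fun n => u n + v n).
Proof. exact (ex_series_plus (K := R_AbsRing) (V := R_NormedModule) u v). Qed.

Lemma ex_derive_continuous_R (f : R -> R) t : ex_derive f t -> continuous f t.
Proof. exact (ex_derive_continuous (K := R_AbsRing) (V := R_NormedModule) f t). Qed.

Lemma continuous_mult_R (f g : R -> R) t : continuous f t -> continuous g t -> continuous (fun t => f t * g t) t.
Proof. exact (continuous_mult (K := R_AbsRing) f g t). Qed.

Lemma is_lim_seq_scal_0 c (u : nat -> R) : is_lim_seq u 0 -> is_lim_seq (fun n => c * u n) 0.
Proof. intros H. rewrite <- (Rmult_0_r c). exact (is_lim_seq_scal_l _ c 0 H). Qed.

Lemma is_lim_seq_plus_0 (u v : nat -> R) :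
  is_lim_seq u 0 -> is_lim_seq v 0 -> is_lim_seq (fun n => u n + v n) 0.
Proof. intros Hu Hv. rewrite <- (Rplus_0_r 0). apply is_lim_seq_plus'; assumption. Qed.

Lemma is_lim_seq_squeeze_0 (u w : nat -> R) :
  (forall n, 0 <= u n <= w n) -> is_lim_seq w 0 -> is_lim_seq u 0.
Proof. intros H Hw. apply is_lim_seq_le_le with (fun _ => 0) w; [exact H|apply is_lim_seq_const|exact Hw]. Qed.

Lemma ball_R_intro (x e y : R) : Rabs (y - x) < e -> ball (M := R_UniformSpace) x e y.
Proof. exact (fun H => H). Qed.

Lemma ball_R_elim (x e y : R) : ball (M := R_UniformSpace) x e y -> Rabs (y - x) < e.
Proof. exact (fun H => H). Qed.

Lemma ex_series_bounded (u : nat -> R) (M : R) :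
  (forall n, 0 <= u n) -> (forall n, sum_n u n <= M) -> ex_series u.
Proof.
  intros Hu HM.
  destruct (ex_finite_lim_seq_incr (sum_n u) M) as [l Hl].
  - intros n. rewrite sum_Sn. unfold plus; simpl. specialize (Hu (S n)). lra.
  - exact HM.
  - exists l. exact Hl.
Qed.

(** This replaces the integral comparison for [t^(-1-d)]. It follows from
    [ln (t+1) - ln t >= 1/(t+1)] and [exp v >= 1 + v], the latter at [v = d (ln (t+1) - ln t)]. *)
Lemma Rpower_telescope (t d : R) : 0 < t -> 0 < d ->
  d * Rpower (t + 1) (- (1 + d)) <= Rpower t (- d) - Rpower (t + 1) (- d).
Proof.
  intros Ht Hd.
  assert (Hln : / (t + 1) <= ln (t + 1) - ln t).
  { assert (H : ln (t / (t + 1)) <= t / (t + 1) - 1).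
    { assert (Hq : 0 < t / (t + 1)) by (apply Rdiv_lt_0_compat; lra).
      generalize (exp_ineq1_le (ln (t / (t + 1)))). rewrite exp_ln by exact Hq. lra. }
    rewrite ln_div in H by lra.
    replace (t / (t + 1) - 1) with (- / (t + 1)) in H by (field; lra). lra. }
  assert (E1 : Rpower (t + 1) (- (1 + d)) = Rpower (t + 1) (- d) * / (t + 1)).
  { replace (- (1 + d)) with (- d + - (1)) by ring.
    rewrite Rpower_plus, (Rpower_Ropp _ 1), Rpower_1 by lra. reflexivity. }
  assert (E2 : Rpower t (- d) = Rpower (t + 1) (- d) * exp (d * (ln (t + 1) - ln t))).
  { unfold Rpower. rewrite <- exp_plus. f_equal. ring. }
  rewrite E1, E2.
  assert (Hp : 0 < Rpower (t + 1) (- d)) by (unfold Rpower; apply exp_pos).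
  generalize (exp_ineq1_le (d * (ln (t + 1) - ln t))). intros He.
  assert (d * / (t + 1) <= d * (ln (t + 1) - ln t)) by (apply Rmult_le_compat_l; lra).
  nra.
Qed.

(** Telescoping with [d = s - 1] bounds the term of index [n + 1] by a difference of values at [n]
    and [n + 1]; the term of index 0 is therefore split off first. *)
Lemma ex_series_Rpower (al s : R) : 0 < al -> 1 < s ->
  ex_series (fun n => Rpower (INR n + al) (- s)).
Proof.
  intros Hal Hs. apply ex_series_incr_1.
  set (d := s - 1). assert (Hd : 0 < d) by (unfold d; lra).
  apply (ex_series_bounded _ (/ d * Rpower al (- d))).
  - intros n. unfold Rpower. left; apply exp_pos.
  - intros n.
    assert (H : sum_n (fun k => Rpower (INR (S k) + al) (- s)) n
        <= / d * (Rpower al (- d) - Rpower (INR (S n) + al) (- d))).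
    { assert (T : forall n, Rpower (INR (S n) + al) (- s) <=
         / d * (Rpower (INR n + al) (- d) - Rpower (INR (S n) + al) (- d))).
      { intros m. assert (0 < INR m + al) by (generalize (pos_INR m); lra).
        generalize (Rpower_telescope (INR m + al) d H Hd).
        replace (INR m + al + 1) with (INR (S m) + al) by (rewrite S_INR; ring).
        replace (- (1 + d)) with (- s) by (unfold d; ring).
        intros T. apply Rmult_le_reg_l with d; [exact Hd|].
        rewrite <- Rmult_assoc, Rinv_r, Rmult_1_l by lra. exact T. }
      induction n as [|n IH].
      - rewrite sum_O. generalize (T 0%nat). simpl INR. rewrite Rplus_0_l. auto.
      - rewrite sum_Sn. unfold plus; simpl plus. 
        generalize (T (S n)). intros T'. unfold Hierarchy.plus; simpl.
        simpl in IH, T'. lra. }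
    assert (0 < Rpower (INR (S n) + al) (- d)) by (unfold Rpower; apply exp_pos).
    assert (0 < / d) by (apply Rinv_0_lt_compat; lra). nra.
Qed.

(** The function [x^A e^(-x)] is largest at [x = A]. All later estimates trade an exponential for a
    power through this bound, with [A] chosen to suit the series at hand. *)
Lemma Rpower_exp_le (A x : R) : 0 < A -> 0 < x ->
  exp (- x) <= exp (A * ln A - A) * Rpower x (- A).
Proof.
  intros HA Hx. unfold Rpower. rewrite <- exp_plus.
  assert (H : A * ln x - x <= A * ln A - A).
  { assert (Hq : 0 < x / A) by (apply Rdiv_lt_0_compat; lra).
    generalize (exp_ineq1_le (ln (x / A))). rewrite exp_ln by exact Hq.
    rewrite ln_div by lra. intros H.
    assert (A * (1 + (ln x - ln A)) <= A * (x / A)) by (apply Rmult_le_compat_l; lra).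
    replace (A * (x / A)) with x in H0 by (field; lra). lra. }
  destruct (Req_dec (- x) (A * ln A - A + - A * ln x)) as [->|Hne]; [lra|].
  left; apply exp_increasing. lra.
Qed.

Lemma Series_tail_le (u v : nat -> R) (N : nat) :
  (forall n, Rabs (u n) <= v n) -> ex_series v ->
  Rabs (Series u - sum_n u N) <= Series v - sum_n v N.
Proof.
  intros H Hv.
  assert (Hu : ex_series u) by (apply (ex_series_le_R u v); auto).
  rewrite (Series_incr_n u (S N)), (Series_incr_n v (S N)) by (auto; lia).
  simpl pred. rewrite <- !sum_n_Reals.
  replace (_ + _ - _) with (Series (fun k => u (S N + k)%nat)) by ring.
  replace (_ + _ - _) with (Series (fun k => v (S N + k)%nat)) by ring.
  apply ex_series_incr_n with (n := S N) in Hv.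
  eapply Rle_trans; [apply Series_Rabs|].
  - apply (ex_series_le_R _ (fun k => v (S N + k)%nat)); auto.
    intros n. rewrite Rabs_Rabsolu. apply H.
  - apply Series_le; auto. intros n; split; [apply Rabs_pos|apply H].
Qed.

Lemma Series_abs_le (u v : nat -> R) :
  (forall n, Rabs (u n) <= v n) -> ex_series v -> Rabs (Series u) <= Series v.
Proof.
  intros H Hv. eapply Rle_trans; [apply Series_Rabs|].
  - apply (ex_series_le_R _ v); auto.
    intros n. rewrite Rabs_Rabsolu. apply H.
  - apply Series_le; auto. intros n; split; [apply Rabs_pos|apply H].
Qed.

Lemma sum_n_abs_le (u v : nat -> R) N :
  (forall n, Rabs (u n) <= v n) -> Rabs (sum_n u N) <= sum_n v N.
Proof.
  intros H. induction N as [|N IH].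
  - rewrite !sum_O. apply H.
  - rewrite !sum_Sn. unfold plus; simpl. eapply Rle_trans; [apply Rabs_triang|].
    specialize (H (S N)). lra.
Qed.

Lemma sum_n_le_Series (v : nat -> R) N :
  (forall n, 0 <= v n) -> ex_series v -> sum_n v N <= Series v.
Proof.
  intros H Hv. generalize (Series_tail_le v v N). intros T.
  assert (Rabs (Series v - sum_n v N) <= Series v - sum_n v N).
  { apply T; auto. intros n. rewrite Rabs_pos_eq; auto. lra. }
  generalize (Rabs_pos (Series v - sum_n v N)). lra.
Qed.

Lemma is_lim_sum_Series (v : nat -> R) : ex_series v -> is_lim_seq (sum_n v) (Series v).
Proof. intros H. exact (Series_correct v H). Qed.

Lemma sum_n_Rmult_l (c : R) (u : nat -> R) N : sum_n (fun n => c * u n) N = c * sum_n u N.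
Proof. exact (sum_n_mult_l (K := R_Ring) c u N). Qed.

Lemma sum_n_Rmult_r (c : R) (u : nat -> R) N : sum_n (fun n => u n * c) N = sum_n u N * c.
Proof. exact (sum_n_mult_r (K := R_Ring) c u N). Qed.

(** * Double series dominated by a product of two convergent series *)

Lemma dominated_ex_inner (a : nat -> nat -> R) (A B : nat -> R) m :
  (forall m n, Rabs (a m n) <= A m * B n) -> ex_series B -> ex_series (a m).
Proof.
  intros Ha HB.
  apply (ex_series_le_R _ (fun n => A m * B n)).
  - intros n. apply Ha.
  - apply ex_series_scal_R. exact HB.
Qed.

Lemma dominated_inner_le (a : nat -> nat -> R) (A B : nat -> R) m :
  (forall m n, Rabs (a m n) <= A m * B n) -> ex_series B ->
  Rabs (Series (a m)) <= A m * Series B.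
Proof.
  intros Ha HB.
  rewrite <- Series_scal_l. apply Series_abs_le; [apply Ha|].
  apply ex_series_scal_R. exact HB.
Qed.

Lemma dominated_ex_outer (a : nat -> nat -> R) (A B : nat -> R) :
  (forall m n, Rabs (a m n) <= A m * B n) -> ex_series A -> ex_series B ->
  ex_series (fun m => Series (a m)).
Proof.
  intros Ha HA HB.
  apply (ex_series_le_R _ (fun m => A m * Series B)).
  - intros m. apply dominated_inner_le; assumption.
  - apply ex_series_scal_r. exact HA.
Qed.

(** The bound is the mass of the majorant [A m * B n] outside the square. The outside splits into
    the rows beyond [M], taken whole, and the ends beyond [N] of the first rows. Keeping the bound
    explicit lets it serve uniformly in a parameter later. *)
Lemma dominated_square_le (a : nat -> nat -> R) (A B : nat -> R) M N :
  (forall m n, Rabs (a m n) <= A m * B n) -> ex_series A -> ex_series B ->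
  Rabs (Series (fun m => Series (a m)) - sum_n (fun m => sum_n (a m) N) M)
  <= Series A * Series B - sum_n A M * sum_n B N.
Proof.
  intros Ha HA HB.
  replace (Series (fun m => Series (a m)) - sum_n (fun m => sum_n (a m) N) M) with
    ((Series (fun m => Series (a m)) - sum_n (fun m => Series (a m)) M)
     + sum_n (fun m => Series (a m) - sum_n (a m) N) M).
  2:{ rewrite <- (Rplus_0_r (_ - sum_n (fun m => sum_n (a m) N) M)).
      assert (E : sum_n (fun m => Series (a m) - sum_n (a m) N) M
         = sum_n (fun m => Series (a m)) M - sum_n (fun m => sum_n (a m) N) M).
      { induction M as [|M IH]; [rewrite !sum_O; reflexivity|].
        rewrite !sum_Sn, IH. unfold plus; simpl. ring. }
      rewrite E. ring. }
  eapply Rle_trans; [apply Rabs_triang|].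
  assert (H1 : Rabs (Series (fun m => Series (a m)) - sum_n (fun m => Series (a m)) M)
     <= Series A * Series B - sum_n A M * Series B).
  { rewrite <- Series_scal_r, <- sum_n_Rmult_r. apply Series_tail_le.
    - intros m. apply dominated_inner_le; assumption.
    - apply ex_series_scal_r. exact HA. }
  assert (H2 : Rabs (sum_n (fun m => Series (a m) - sum_n (a m) N) M)
     <= sum_n A M * (Series B - sum_n B N)).
  { rewrite <- sum_n_Rmult_r. apply sum_n_abs_le. intros m.
    eapply Rle_trans; [apply Series_tail_le with (v := fun n => A m * B n)|].
    - apply Ha.
    - apply ex_series_scal_R. exact HB.
    - rewrite Series_scal_l, sum_n_Rmult_l. lra. }
  lra.
Qed.

Lemma dominated_square_gap_lim (A B : nat -> R) : ex_series A -> ex_series B ->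
  is_lim_seq (fun N => Series A * Series B - sum_n A N * sum_n B N) 0.
Proof.
  intros HA HB.
  replace (Finite 0) with (Finite (Series A * Series B - Series A * Series B)) by (f_equal; ring).
  apply is_lim_seq_minus'; [apply is_lim_seq_const|].
  apply is_lim_seq_mult'; apply is_lim_sum_Series; assumption.
Qed.

Lemma dominated_square_lim (a : nat -> nat -> R) (A B : nat -> R) :
  (forall m n, Rabs (a m n) <= A m * B n) -> ex_series A -> ex_series B ->
  is_lim_seq (fun N => sum_n (fun m => sum_n (a m) N) N) (Series (fun m => Series (a m))).
Proof.
  intros Ha HA HB.
  apply is_lim_seq_le_le with
   (u := fun N => Series (fun m => Series (a m)) - (Series A * Series B - sum_n A N * sum_n B N))
   (w := fun N => Series (fun m => Series (a m)) + (Series A * Series B - sum_n A N * sum_n B N)).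
  - intros N. assert (H := dominated_square_le a A B N N Ha HA HB).
    apply Rabs_le_between in H. lra.
  - rewrite <- (Rminus_0_r (Series (fun m => Series (a m)))) at 1.
    apply is_lim_seq_minus'; [apply is_lim_seq_const|apply dominated_square_gap_lim; assumption].
  - rewrite <- (Rplus_0_r (Series (fun m => Series (a m)))) at 1.
    apply is_lim_seq_plus'; [apply is_lim_seq_const|apply dominated_square_gap_lim; assumption].
Qed.


(** Both iterated sums are limits of the same finite square sums, for which exchanging the order is
    trivial. *)
Lemma dominated_switch (a : nat -> nat -> R) (A B : nat -> R) :
  (forall m n, Rabs (a m n) <= A m * B n) -> ex_series A -> ex_series B ->
  Series (fun m => Series (fun n => a m n)) = Series (fun n => Series (fun m => a m n)).
Proof.
  intros Ha HA HB.
  assert (L1 := dominated_square_lim a A B Ha HA HB).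
  assert (L2 : is_lim_seq (fun N => sum_n (fun n => sum_n (fun m => a m n) N) N)
                (Series (fun n => Series (fun m => a m n)))).
  { apply (dominated_square_lim (fun n m => a m n) B A); auto.
    intros m n. rewrite Rmult_comm. apply Ha. }
  apply is_lim_seq_unique in L1. apply is_lim_seq_unique in L2.
  assert (E : Finite (Series (fun m => Series (a m))) = Finite (Series (fun n => Series (fun m => a m n)))).
  { rewrite <- L1, <- L2. apply Lim_seq_ext. intros N. apply sum_n_switch. }
  injection E. auto.
Qed.

(** The index [j] stands for the integer [j + 1], so the upper limit [d * S L - 1] means the
    integers from 1 to [d (L + 1)]. They are cut into blocks ending at a multiple of [d], and only
    that last element contributes. *)
Lemma sum_n_multiples (d : nat) (g : nat -> R) (L : nat) : (0 < d)%nat ->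
  sum_n (fun j => if Nat.eqb (S j mod d) 0 then g (S j / d)%nat else 0) (d * S L - 1)
  = sum_n (fun l => g (S l)) L.
Proof.
  intros Hd.
  assert (Hblock : forall q r, (r < d)%nat ->
     sum_n_m (fun j => if Nat.eqb (j mod d) 0 then g (j / d)%nat else 0) (S (d * q)) (d * q + r) = 0).
  { intros q r Hr.
    transitivity (sum_n_m (fun _ : nat => @zero R_AbelianMonoid) (S (d * q)) (d * q + r));
      [|exact (@sum_n_m_const_zero R_AbelianMonoid _ _)].
    apply sum_n_m_ext_loc. intros j Hj.
    assert (E : (j mod d = j - d * q)%nat).
    { symmetry. apply Nat.mod_unique with q; lia. }
    rewrite E. destruct (Nat.eqb_spec (j - d * q) 0); [lia|reflexivity]. }
  set (F := fun j => if Nat.eqb (j mod d) 0 then g (j / d)%nat else 0).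
  assert (Hmult : forall q, F (d * q)%nat = g q).
  { intros q. unfold F. rewrite Nat.mul_comm, Nat.Div0.mod_mul, Nat.eqb_refl.
    rewrite Nat.div_mul by lia. reflexivity. }
  assert (Hstep : forall q, sum_n_m F (S (d * q)) (d * S q) = g (S q)).
  { intros q. replace (d * S q)%nat with (S (d * q + (d - 1))) at 1 by lia.
    rewrite sum_n_Sm by lia. unfold plus; simpl. unfold F at 1. rewrite Hblock by lia.
    replace (S (d * q + (d - 1))) with (d * S q)%nat by lia. rewrite Hmult. ring. }
  unfold sum_n. rewrite (sum_n_m_S F), (sum_n_m_S g).
  replace (S (d * S L - 1)) with (d * S L)%nat by lia.
  induction L as [|L IH].
  - rewrite sum_n_n. rewrite <- (Hstep 0%nat). rewrite Nat.mul_0_r. reflexivity.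
  - rewrite (sum_n_m_Chasles F 1 (d * S L) (d * S (S L))) by lia.
    rewrite IH, Hstep, (sum_n_Sm g 1 (S L)) by lia. reflexivity.
Qed.

(** The partial sums of the thinned series are a subsequence of those of the padded one, which
    yields convergence and value at once. *)
Lemma Series_multiples (d : nat) (g : nat -> R) : (0 < d)%nat ->
  ex_series (fun j => if Nat.eqb (S j mod d) 0 then g (S j / d)%nat else 0) ->
  ex_series (fun l => g (S l)) /\
  Series (fun j => if Nat.eqb (S j mod d) 0 then g (S j / d)%nat else 0)
  = Series (fun l => g (S l)).
Proof.
  intros Hd Hex.
  assert (L := is_lim_sum_Series _ Hex).
  apply is_lim_seq_subseq with (phi := fun l => (d * S l - 1)%nat) in L.
  2:{ apply eventually_subseq. intros n. nia. }
  assert (L' : is_lim_seq (sum_n (fun l => g (S l)))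
     (Series (fun j => if Nat.eqb (S j mod d) 0 then g (S j / d)%nat else 0))).
  { eapply is_lim_seq_ext; [|exact L]. intros l. simpl. apply sum_n_multiples. exact Hd. }
  split.
  - exists (Series (fun j => if Nat.eqb (S j mod d) 0 then g (S j / d)%nat else 0)). exact L'.
  - symmetry. apply is_series_unique. exact L'.
Qed.

(** * Uniqueness of Fourier coefficients *)

Definition fourier_null (h : R -> R) : Prop := forall j : Z,
  is_RInt (fun t => h t * cos (2 * PI * IZR j * t)) 0 1 0 /\
  is_RInt (fun t => h t * sin (2 * PI * IZR j * t)) 0 1 0.

Lemma is_RInt_comb_null (f g : R -> R) (a b c d : R) :
  is_RInt f a b 0 -> is_RInt g a b 0 -> is_RInt (fun t => c * f t + d * g t) a b 0.
Proof.
  intros Hf Hg.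
  replace 0 with (c * 0 + d * 0) by ring.
  apply (is_RInt_plus (V := R_NormedModule)); apply (is_RInt_scal (V := R_NormedModule)); assumption.
Qed.

(** By the addition formulas, multiplying by a trigonometric polynomial of degree one only mixes the
    coefficients at [j - 1], [j] and [j + 1]. Iterated, it makes [h] orthogonal to every power of
    the peaked kernel used next. *)
Lemma fourier_null_mult (h : R -> R) (A B C : R) : fourier_null h ->
  fourier_null (fun t => h t * (A + B * cos (2 * PI * t) + C * sin (2 * PI * t))).
Proof.
  intros H j.
  destruct (H j) as [Hc Hs]. destruct (H (j + 1)%Z) as [Hc1 Hs1].
  destruct (H (j - 1)%Z) as [Hc2 Hs2].
  assert (E1 : forall t, cos (2 * PI * IZR (j + 1) * t)
     = cos (2 * PI * IZR j * t) * cos (2 * PI * t) - sin (2 * PI * IZR j * t) * sin (2 * PI * t)).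
  { intros t. rewrite <- cos_plus. f_equal. rewrite plus_IZR. ring. }
  assert (E2 : forall t, sin (2 * PI * IZR (j + 1) * t)
     = sin (2 * PI * IZR j * t) * cos (2 * PI * t) + cos (2 * PI * IZR j * t) * sin (2 * PI * t)).
  { intros t. rewrite <- sin_plus. f_equal. rewrite plus_IZR. ring. }
  assert (E3 : forall t, cos (2 * PI * IZR (j - 1) * t)
     = cos (2 * PI * IZR j * t) * cos (2 * PI * t) + sin (2 * PI * IZR j * t) * sin (2 * PI * t)).
  { intros t. rewrite <- cos_minus. f_equal. rewrite minus_IZR. ring. }
  assert (E4 : forall t, sin (2 * PI * IZR (j - 1) * t)
     = sin (2 * PI * IZR j * t) * cos (2 * PI * t) - cos (2 * PI * IZR j * t) * sin (2 * PI * t)).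
  { intros t. rewrite <- sin_minus. f_equal. rewrite minus_IZR. ring. }
  split.
  - assert (T := is_RInt_comb_null _ _ _ _ 1 1 (is_RInt_comb_null _ _ _ _ A (B / 2) Hc Hc1)
       (is_RInt_comb_null _ _ _ _ 1 1 (is_RInt_comb_null _ _ _ _ (B / 2) (C / 2) Hc2 Hs1)
         (is_RInt_comb_null _ _ _ _ (- (C / 2)) 0 Hs2 Hc))).
    eapply is_RInt_ext; [|exact T]. intros t _. simpl.
    rewrite E1, E2, E3, E4. field.
  - assert (T := is_RInt_comb_null _ _ _ _ 1 1 (is_RInt_comb_null _ _ _ _ A (B / 2) Hs Hs1)
       (is_RInt_comb_null _ _ _ _ 1 1 (is_RInt_comb_null _ _ _ _ (B / 2) (C / 2) Hs2 Hc2)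
         (is_RInt_comb_null _ _ _ _ (- (C / 2)) 0 Hc1 Hc))).
    eapply is_RInt_ext; [|exact T]. intros t _. simpl.
    rewrite E1, E2, E3, E4. field.
Qed.

Lemma cos_2PI_abs u : cos (2 * PI * u) = cos (2 * PI * Rabs u).
Proof.
  unfold Rabs; destruct (Rcase_abs u); [|reflexivity].
  rewrite <- cos_neg. f_equal. ring.
Qed.

Lemma cos_2PI_far d u : 0 < d <= 1 / 4 -> d <= u <= 1 - d ->
  cos (2 * PI * u) <= cos (2 * PI * d).
Proof.
  intros Hd Hu. assert (HP := PI_RGT_0).
  destruct (Rle_dec u (1 / 2)).
  - apply cos_decr_1; nra.
  - replace (2 * PI * u) with (- (2 * PI * (1 - u)) + 2 * INR 1 * PI) by (simpl; ring).
    rewrite cos_period, cos_neg. apply cos_decr_1; nra.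
Qed.

(** The classical peak argument. The kernel [T t = 1 + cos (2 pi (t - x0)) - cos (2 pi d)] exceeds 1
    near [x0] and has absolute value at most 1 farther than [d] away. The integral of [h * T^N]
    vanishes for every [N], yet the part near [x0], where [h] is positive, grows geometrically. *)
Lemma fourier_kernel_contra (h : R -> R) (x0 : R) :
  (forall x, 0 <= x <= 1 -> continuous h x) -> fourier_null h -> 0 < x0 < 1 -> 0 < h x0 -> False.
Proof.
  intros Hc Hn Hx0 Hpos.
  assert (HP := PI_RGT_0).
  assert (Hcx : continuous h x0) by (apply Hc; lra).
  assert (Hhalf : 0 < h x0 / 2) by lra.
  destruct (proj1 (filterlim_locally h (h x0)) Hcx (mkposreal _ Hhalf)) as [d0 Hd0].
  set (d := Rmin (Rmin (d0 / 2) (x0 / 2)) (Rmin ((1 - x0) / 2) (1 / 4))).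
  assert (Hd : 0 < d /\ d < d0 /\ d < x0 /\ d < 1 - x0 /\ d <= 1 / 4).
  { assert (H0 := cond_pos d0). unfold d, Rmin; repeat destruct Rle_dec; lra. }
  destruct Hd as (Hd1 & Hd2 & Hd3 & Hd4 & Hd5).
  assert (Hnear : forall t, Rabs (t - x0) <= d -> h x0 / 2 <= h t).
  { intros t Ht. assert (B : ball x0 d0 t) by (apply ball_R_intro; lra).
    specialize (Hd0 t B). apply ball_R_elim in Hd0; simpl in Hd0.
    apply Rabs_def2 in Hd0. lra. }
  set (T := fun t => (1 - cos (2 * PI * d)) + cos (2 * PI * x0) * cos (2 * PI * t) + sin (2 * PI * x0) * sin (2 * PI * t)).
  assert (HT : forall t, T t = 1 + cos (2 * PI * Rabs (t - x0)) - cos (2 * PI * d)).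
  { intros t. rewrite <- cos_2PI_abs. unfold T.
    replace (2 * PI * (t - x0)) with (2 * PI * t - 2 * PI * x0) by ring. rewrite cos_minus. ring. }
  assert (HN : forall N, fourier_null (fun t => h t * T t ^ N)).
  { induction N as [|N IH].
    - intros j; destruct (Hn j) as [H1 H2]; split;
      [eapply is_RInt_ext; [|exact H1]|eapply is_RInt_ext; [|exact H2]]; intros t _; simpl; ring.
    - intros j. destruct (fourier_null_mult _ (1 - cos (2 * PI * d)) (cos (2 * PI * x0)) (sin (2 * PI * x0)) IH j) as [H1 H2].
      split; [eapply is_RInt_ext; [|exact H1]|eapply is_RInt_ext; [|exact H2]]; intros t _; simpl; unfold T; ring. }
  (* [q] is the value of [T] at distance [d / 2], hence a lower bound strictly above 1 on the inner
     half of the neighbourhood. *)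
  set (q := 1 + cos (2 * PI * (d / 2)) - cos (2 * PI * d)).
  assert (Hq : 1 < q).
  { assert (cos (2 * PI * d) < cos (2 * PI * (d / 2))) by (apply cos_decreasing_1; nra). unfold q; lra. }
  assert (Hin : forall t, Rabs (t - x0) <= d / 2 -> q <= T t).
  { intros t Ht. rewrite HT. unfold q.
    assert (cos (2 * PI * (d / 2)) <= cos (2 * PI * Rabs (t - x0))).
    { apply cos_decr_1; generalize (Rabs_pos (t - x0)); nra. } lra. }
  assert (Hmid : forall t, Rabs (t - x0) <= d -> 1 <= T t).
  { intros t Ht. rewrite HT.
    assert (cos (2 * PI * d) <= cos (2 * PI * Rabs (t - x0))).
    { apply cos_decr_1; generalize (Rabs_pos (t - x0)); nra. } lra. }
  assert (Hout : forall t, 0 <= t <= 1 -> d <= Rabs (t - x0) -> Rabs (T t) <= 1).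
  { intros t Ht1 Ht2. rewrite HT.
    assert (cos (2 * PI * Rabs (t - x0)) <= cos (2 * PI * d)).
    { apply cos_2PI_far; [lra|]. split; [exact Ht2|]. apply Rabs_le. lra. }
    generalize (COS_bound (2 * PI * Rabs (t - x0))) (COS_bound (2 * PI * d)). intros.
    assert (0 <= cos (2 * PI * d)) by (apply cos_ge_0; nra).
    apply Rabs_le. lra. }
  set (I := RInt (fun t => Rabs (h t)) 0 1 : R).
  assert (Hcabs : forall x, 0 <= x <= 1 -> continuous (fun t => Rabs (h t)) x).
  { intros x Hx. apply continuous_comp; [apply Hc; exact Hx|]. apply continuous_Rabs. }
  assert (HcT : forall N x, 0 <= x <= 1 -> continuous (fun t => h t * T t ^ N) x).
  { intros N x Hx. apply continuous_mult_R; [apply Hc; exact Hx|].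
    apply ex_derive_continuous_R. unfold T. auto_derive; auto. }
  assert (Hexx : forall f : R -> R, (forall x, 0 <= x <= 1 -> continuous f x) -> forall a b, 0 <= a -> a <= b -> b <= 1 -> ex_RInt f a b).
  { intros f Hf a b Ha Hab Hb. apply (ex_RInt_continuous (V := R_CompleteNormedModule)). intros z Hz.
    rewrite Rmin_left, Rmax_right in Hz by lra. apply Hf. lra. }
  assert (Hgrow : forall N, d * (h x0 / 2) * q ^ N <= I).
  { intros N.
    set (f := fun t => h t * T t ^ N + Rabs (h t)).
    assert (Hfc : forall x, 0 <= x <= 1 -> continuous f x).
    { intros x Hx. apply (continuous_plus (V := R_NormedModule)); [apply HcT|apply Hcabs]; exact Hx. }
    assert (Hf0 : forall t, 0 <= t <= 1 -> 0 <= f t).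
    { intros t Ht. unfold f. destruct (Rle_dec (Rabs (t - x0)) d) as [Hl|Hl].
      - assert (0 <= h t) by (specialize (Hnear t Hl); lra).
        assert (0 <= T t ^ N) by (apply pow_le; specialize (Hmid t Hl); lra).
        generalize (Rabs_pos (h t)). nra.
      - assert (HTl : Rabs (T t) <= 1) by (apply Hout; lra).
        assert (Rabs (h t * T t ^ N) <= Rabs (h t)).
        { rewrite Rabs_mult, <- RPow_abs.
          assert (Rabs (T t) ^ N <= 1) by (rewrite <- (pow1 N); apply pow_incr; split; [apply Rabs_pos|exact HTl]).
          generalize (Rabs_pos (h t)). nra. }
        apply Rabs_le_between in H. lra. }
    assert (Hfi : RInt f 0 1 = I).
    { apply is_RInt_unique. unfold f.
      replace I with (0 + I) by ring.
      apply (is_RInt_plus (V := R_NormedModule)).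
      - destruct (HN N 0%Z) as [H1 _]. eapply is_RInt_ext; [|exact H1].
        intros t _. simpl. replace (2 * PI * 0 * t) with 0 by ring. rewrite cos_0. ring.
      - apply (RInt_correct (V := R_CompleteNormedModule)). apply Hexx; try lra; auto. }
    rewrite <- Hfi.
    rewrite <- (RInt_Chasles (V := R_CompleteNormedModule) f 0 (x0 - d / 2) 1) by (apply Hexx; auto; lra).
    rewrite <- (RInt_Chasles (V := R_CompleteNormedModule) f (x0 - d / 2) (x0 + d / 2) 1) by (apply Hexx; auto; lra).
    unfold plus; simpl.
    assert (0 <= RInt f 0 (x0 - d / 2)) by (apply RInt_ge_0; [lra|apply Hexx; auto; lra|intros; apply Hf0; lra]).
    assert (0 <= RInt f (x0 + d / 2) 1) by (apply RInt_ge_0; [lra|apply Hexx; auto; lra|intros; apply Hf0; lra]).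
    assert (d * (h x0 / 2) * q ^ N <= RInt f (x0 - d / 2) (x0 + d / 2)).
    { replace (d * (h x0 / 2) * q ^ N) with (RInt (fun _ => h x0 / 2 * q ^ N) (x0 - d / 2) (x0 + d / 2)).
      2:{ rewrite RInt_const. unfold scal; simpl; unfold mult; simpl. field. }
      apply RInt_le; [lra|apply ex_RInt_const|apply Hexx; auto; lra|].
      intros t Ht. unfold f.
      assert (Ha : Rabs (t - x0) <= d / 2) by (apply Rabs_le; lra).
      assert (h x0 / 2 <= h t) by (apply Hnear; lra).
      assert (q ^ N <= T t ^ N) by (apply pow_incr; specialize (Hin t Ha); lra).
      assert (0 < q ^ N) by (apply pow_lt; lra).
      generalize (Rabs_pos (h t)). nra. }
    lra. }
  destruct (Pow_x_infinity q) with (b := (I + 1) / (d * (h x0 / 2))) as [N HNq].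
  { rewrite Rabs_pos_eq; lra. }
  specialize (HNq N (le_n N)). specialize (Hgrow N).
  assert (0 < q ^ N) by (apply pow_lt; lra).
  rewrite Rabs_pos_eq in HNq by lra.
  assert (Hdh : 0 < d * (h x0 / 2)) by nra.
  apply Rge_le in HNq. apply (Rmult_le_compat_l (d * (h x0 / 2))) in HNq; [|lra].
  replace (d * (h x0 / 2) * ((I + 1) / (d * (h x0 / 2)))) with (I + 1) in HNq by (field; lra).
  lra.
Qed.

(** Inside the interval the previous lemma applies to [h] or to [- h]. The endpoints follow by
    continuity. *)
Lemma fourier_uniqueness (h : R -> R) :
  (forall x, 0 <= x <= 1 -> continuous h x) -> fourier_null h ->
  forall x, 0 <= x <= 1 -> h x = 0.
Proof.
  intros Hc Hn.
  assert (Hint : forall x, 0 < x < 1 -> h x = 0).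
  { intros x Hx. destruct (Rtotal_order (h x) 0) as [Hl|[He|Hg]]; [|exact He|].
    - exfalso. apply (fourier_kernel_contra (fun t => - h t) x); auto; [| |lra].
      + intros y Hy. apply (continuous_opp (V := R_NormedModule)). auto.
      + intros j. destruct (Hn j) as [H1 H2].
        split; [assert (T := is_RInt_comb_null _ _ _ _ (-1) 0 H1 H1)|assert (T := is_RInt_comb_null _ _ _ _ (-1) 0 H2 H2)];
        (eapply is_RInt_ext; [|exact T]); intros t _; simpl; ring.
    - exfalso. apply (fourier_kernel_contra h x); auto. }
  intros x Hx. destruct (Req_dec (h x) 0) as [|Hne]; [assumption|exfalso].
  assert (Hpos : 0 < Rabs (h x)) by (apply Rabs_pos_lt; exact Hne).
  destruct (proj1 (filterlim_locally h (h x)) (Hc x Hx) (mkposreal _ Hpos)) as [e He].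
  (* [y] is an interior point close to [x], reached by moving towards the middle of the interval. *)
  set (y := if Rle_dec x (1 / 2) then x + Rmin (e / 2) (1 / 4) else x - Rmin (e / 2) (1 / 4)).
  assert (Hy : 0 < y < 1 /\ Rabs (y - x) < e).
  { assert (H0 := cond_pos e). unfold y, Rmin; destruct (Rle_dec x (1 / 2)); destruct Rle_dec;
    (split; [lra|]); apply Rabs_def1; lra. }
  destruct Hy as [Hy1 Hy2].
  assert (B := He y Hy2). rewrite (Hint y Hy1) in B.
  apply ball_R_elim in B; simpl in B.
  rewrite Rminus_0_l, Rabs_Ropp in B. lra.
Qed.

(** The majorant must hold on an open interval around [x], because [continuous] is two-sided even
    when [x] is an endpoint of [[0, 1]]. *)
Lemma continuous_dominated_series (f : nat -> R -> R) (A : nat -> R) (a b x : R) :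
  (forall n t, a < t < b -> Rabs (f n t) <= A n) -> ex_series A ->
  (forall n, continuous (f n) x) -> a < x < b ->
  continuous (fun t => Series (fun n => f n t)) x.
Proof.
  intros Hf HA Hc Hx. apply filterlim_locally. intros eps.
  assert (He : 0 < eps / 3) by (assert (H := cond_pos eps); lra).
  destruct (proj1 (filterlim_locally _ _) (is_lim_sum_Series A HA) (mkposreal _ He)) as [N HN].
  specialize (HN N (le_n N)). apply ball_R_elim in HN; simpl in HN. apply Rabs_def2 in HN.
  assert (Hs : continuous (fun t => sum_n (fun n => f n t) N) x).
  { clear HN. induction N as [|N IH].
    - eapply continuous_ext; [|apply (Hc 0%nat)]. intros t. rewrite sum_O. reflexivity.
    - eapply continuous_ext; [|apply (continuous_plus (V := R_NormedModule) _ _ _ IH (Hc (S N)))].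
      intros t. rewrite sum_Sn. reflexivity. }
  assert (Hab : 0 < Rmin (x - a) (b - x)) by (unfold Rmin; destruct Rle_dec; lra).
  generalize (proj1 (filterlim_locally _ _) Hs (mkposreal _ He)). intros H1.
  assert (H2 : locally x (fun t => a < t < b)).
  { exists (mkposreal _ Hab). intros y Hy. apply ball_R_elim in Hy; simpl in Hy.
    unfold Rmin in Hy; destruct Rle_dec; apply Rabs_def2 in Hy; lra. }
  generalize (filter_and _ _ H1 H2). apply filter_imp. intros t [Ht1 Ht2].
  apply ball_R_intro. apply ball_R_elim in Ht1; simpl in Ht1.
  assert (T1 := Series_tail_le (fun n => f n t) A N (fun n => Hf n t Ht2) HA).
  assert (T2 := Series_tail_le (fun n => f n x) A N (fun n => Hf n x Hx) HA).
  apply Rabs_le_between in T1. apply Rabs_le_between in T2. apply Rabs_def2 in Ht1.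
  apply Rabs_def1; lra.
Qed.

(** Termwise integration by uniform convergence: the integral of the remainder is at most the tail
    of [A], so the integral must equal the sum of the termwise integrals. *)
Lemma is_RInt_dominated_series (f : nat -> R -> R) (A I : nat -> R) (q : R -> R) (l : R) :
  (forall n t, 0 <= t <= 1 -> Rabs (f n t) <= A n) -> ex_series A ->
  (forall t, 0 <= t <= 1 -> continuous (fun t => Series (fun n => f n t)) t) ->
  (forall t, continuous q t) -> (forall t, Rabs (q t) <= 1) ->
  (forall n, is_RInt (fun t => f n t * q t) 0 1 (I n)) -> is_series I l ->
  is_RInt (fun t => Series (fun n => f n t) * q t) 0 1 l.
Proof.
  intros Hf HA Hc Hq Hq1 HI Hl.
  assert (Hex : ex_RInt (fun t => Series (fun n => f n t) * q t) 0 1).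
  { apply (ex_RInt_continuous (V := R_CompleteNormedModule)). intros z Hz.
    rewrite Rmin_left, Rmax_right in Hz by lra.
    apply continuous_mult_R; auto. }
  destruct Hex as [v Hv].
  assert (Hsum : forall N, is_RInt (fun t => sum_n (fun n => f n t) N * q t) 0 1 (sum_n I N)).
  { induction N as [|N IH].
    - rewrite sum_O. eapply is_RInt_ext; [|apply HI]. intros t _. simpl. rewrite sum_O. reflexivity.
    - rewrite sum_Sn. eapply is_RInt_ext; [|apply (is_RInt_plus (V := R_NormedModule) _ _ _ _ _ _ IH (HI (S N)))].
      intros t _. simpl. rewrite sum_Sn. unfold plus; simpl. ring. }
  assert (Hb : forall N, Rabs (v - sum_n I N) <= Series A - sum_n A N).
  { intros N.
    assert (D := is_RInt_minus (V := R_NormedModule) _ _ _ _ _ _ Hv (Hsum N)).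
    assert (G : is_RInt (fun _ : R => Series A - sum_n A N) 0 1 ((1 - 0) * (Series A - sum_n A N)))
      by apply (is_RInt_const (V := R_NormedModule)).
    replace (Series A - sum_n A N) with ((1 - 0) * (Series A - sum_n A N)) by ring.
    refine (norm_RInt_le (V := R_NormedModule) _ _ 0 1 _ _ _ _ D G); [lra|].
    intros t Ht. unfold norm, minus, plus, opp; simpl. unfold abs; simpl.
    replace (Series (fun n => f n t) * q t + - (sum_n (fun n => f n t) N * q t))
      with ((Series (fun n => f n t) - sum_n (fun n => f n t) N) * q t) by ring.
    rewrite Rabs_mult.
    assert (T := Series_tail_le (fun n => f n t) A N (fun n => Hf n t Ht) HA).
    generalize (Hq1 t) (Rabs_pos (q t)) (Rabs_pos (Series (fun n => f n t) - sum_n (fun n => f n t) N)). nra. }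
  assert (L0 : is_lim_seq (fun N => Series A - sum_n A N) 0).
  { replace (Finite 0) with (Finite (Series A - Series A)) by (f_equal; ring).
    apply is_lim_seq_minus'; [apply is_lim_seq_const|apply is_lim_sum_Series; exact HA]. }
  assert (L1 : is_lim_seq (fun N => v - sum_n I N) (v - l)).
  { apply is_lim_seq_minus'; [apply is_lim_seq_const|exact Hl]. }
  assert (L2 : is_lim_seq (fun N => v - sum_n I N) 0).
  { apply is_lim_seq_abs_0. apply is_lim_seq_squeeze_0 with (w := fun N => Series A - sum_n A N); auto.
    - intros N; split; [apply Rabs_pos|apply Hb]. }
  apply is_lim_seq_unique in L1. apply is_lim_seq_unique in L2.
  rewrite L1 in L2. injection L2. intros E. replace l with v by lra. exact Hv.
Qed.

(** * Complex exponentials and complex-valued integrals *)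

Definition cis (r : R) : C := (cos r, sin r).

Lemma cis_plus r s : cis (r + s) = Cmult (cis r) (cis s).
Proof. unfold cis, Cmult; simpl. rewrite cos_plus, sin_plus. f_equal; ring. Qed.

Lemma cis_0 : cis 0 = RtoC 1.
Proof. unfold cis, RtoC. rewrite cos_0, sin_0. reflexivity. Qed.

Lemma cis_2PI_nat (n : nat) : cis (2 * PI * INR n) = RtoC 1.
Proof.
  unfold cis, RtoC. replace (2 * PI * INR n) with (0 + 2 * INR n * PI) by ring.
  rewrite cos_period, sin_period, cos_0, sin_0. reflexivity.
Qed.

Lemma cis_2PI_Z (j : Z) : cis (2 * PI * IZR j) = RtoC 1.
Proof.
  destruct (Z_le_dec 0 j).
  - rewrite <- (Z2Nat.id j) by lia. rewrite <- INR_IZR_INZ. apply cis_2PI_nat.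
  - assert (E : cis (2 * PI * IZR (- j)) = RtoC 1).
    { rewrite <- (Z2Nat.id (- j)) by lia. rewrite <- INR_IZR_INZ. apply cis_2PI_nat. }
    unfold cis, RtoC in *. injection E; intros E1 E2.
    replace (2 * PI * IZR j) with (- (2 * PI * IZR (- j))) by (rewrite opp_IZR; ring).
    rewrite cos_neg, sin_neg, E1, E2. f_equal. ring.
Qed.

Lemma Cmod_cis r : Cmod (cis r) = 1.
Proof.
  unfold Cmod, cis; simpl. rewrite !Rmult_1_r.
  replace (cos r * cos r + sin r * sin r) with 1; [apply sqrt_1|].
  generalize (sin2_cos2 r). unfold Rsqr. lra.
Qed.

Lemma cexp_cis z : cexp z = Cmult (RtoC (exp (fst z))) (cis (snd z)).
Proof. unfold cexp, cis, Cmult, RtoC; simpl. f_equal; ring. Qed.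

Lemma cexp_plus z w : cexp (Cplus z w) = Cmult (cexp z) (cexp w).
Proof.
  rewrite !cexp_cis. unfold Cplus; simpl fst; simpl snd. rewrite exp_plus, cis_plus, RtoC_mult. ring.
Qed.

Lemma Cmod_cexp z : Cmod (cexp z) = exp (fst z).
Proof.
  rewrite cexp_cis, Cmod_mult, Cmod_cis, Cmod_R, Rabs_pos_eq; [ring|left; apply exp_pos].
Qed.

Lemma Rabs_fst_le_Cmod z : Rabs (fst z) <= Cmod z.
Proof. eapply Rle_trans; [apply Rmax_l|apply Rmax_Cmod]. Qed.

Lemma Rabs_snd_le_Cmod z : Rabs (snd z) <= Cmod z.
Proof. eapply Rle_trans; [apply Rmax_r|apply Rmax_Cmod]. Qed.

(** Differentiation is taken componentwise so that the real derivative and integral lemmas apply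
    directly to each part. *)
Definition cderiv (F f : R -> C) : Prop := forall t,
  is_derive (fun t => fst (F t)) t (fst (f t)) /\ is_derive (fun t => snd (F t)) t (snd (f t)).

Lemma is_derive_eq (f : R -> R) t l l' : is_derive f t l -> l = l' -> is_derive f t l'.
Proof. intros H <-. exact H. Qed.

Lemma is_derive_Rmult (f g : R -> R) (t a b : R) :
  is_derive f t a -> is_derive g t b -> is_derive (fun t => f t * g t) t (a * g t + f t * b).
Proof. intros Hf Hg. exact (is_derive_mult (K := R_AbsRing) f g t a b Hf Hg Rmult_comm). Qed.

Lemma cderiv_mult F f G g : cderiv F f -> cderiv G g ->
  cderiv (fun t => Cmult (F t) (G t)) (fun t => Cplus (Cmult (f t) (G t)) (Cmult (F t) (g t))).
Proof.
  intros HF HG t. destruct (HF t) as [F1 F2]. destruct (HG t) as [G1 G2]. split; simpl.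
  - eapply is_derive_eq.
    + exact (is_derive_minus (V := R_NormedModule) _ _ _ _ _
        (is_derive_Rmult _ _ _ _ _ F1 G1) (is_derive_Rmult _ _ _ _ _ F2 G2)).
    + unfold minus, plus, opp; simpl. ring.
  - eapply is_derive_eq.
    + exact (is_derive_plus (V := R_NormedModule) _ _ _ _ _
        (is_derive_Rmult _ _ _ _ _ F1 G2) (is_derive_Rmult _ _ _ _ _ F2 G1)).
    + unfold plus; simpl. ring.
Qed.

Lemma cderiv_plus F f G g : cderiv F f -> cderiv G g ->
  cderiv (fun t => Cplus (F t) (G t)) (fun t => Cplus (f t) (g t)).
Proof.
  intros HF HG t. destruct (HF t) as [F1 F2]. destruct (HG t) as [G1 G2]. split; simpl.
  - apply (is_derive_plus (V := R_NormedModule) (fun t => fst (F t)) (fun t => fst (G t))); assumption.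
  - apply (is_derive_plus (V := R_NormedModule) (fun t => snd (F t)) (fun t => snd (G t))); assumption.
Qed.

Lemma cderiv_const c : cderiv (fun _ => c) (fun _ => RtoC 0).
Proof. intros t; split; simpl; apply (is_derive_const (V := R_NormedModule)). Qed.

Lemma cderiv_real (f df : R -> R) : (forall t, is_derive f t (df t)) ->
  cderiv (fun t => RtoC (f t)) (fun t => RtoC (df t)).
Proof. intros H t; split; simpl; [apply H|apply (is_derive_const (V := R_NormedModule))]. Qed.

Lemma cderiv_ext F f g : cderiv F f -> (forall t, f t = g t) -> cderiv F g.
Proof. intros H E t. rewrite <- E. apply H. Qed.

Lemma cderiv_ext_fun F G f : cderiv F f -> (forall t, F t = G t) -> cderiv G f.
Proof.
  intros H E t. destruct (H t) as [H1 H2]. split.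
  - eapply is_derive_ext; [|exact H1]. intros; simpl; rewrite E; reflexivity.
  - eapply is_derive_ext; [|exact H2]. intros; simpl; rewrite E; reflexivity.
Qed.

Lemma cderiv_shift F f c : cderiv F f -> cderiv (fun t => F (c + t)) (fun t => f (c + t)).
Proof.
  intros H t. destruct (H (c + t)) as [H1 H2].
  assert (Hs : is_derive (fun t => c + t) t 1) by (auto_derive; auto).
  split.
  - eapply is_derive_eq; [apply (is_derive_comp (fun t => fst (F t)) (fun t => c + t)); eassumption|].
    unfold scal; simpl; unfold mult; simpl. ring.
  - eapply is_derive_eq; [apply (is_derive_comp (fun t => snd (F t)) (fun t => c + t)); eassumption|].
    unfold scal; simpl; unfold mult; simpl. ring.
Qed.

Lemma cderiv_cexp z : cderiv (fun t => cexp (Cmult z (RtoC t))) (fun t => Cmult z (cexp (Cmult z (RtoC t)))).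
Proof.
  assert (E : forall t, cexp (Cmult z (RtoC t))
      = (exp (fst z * t) * cos (snd z * t), exp (fst z * t) * sin (snd z * t))).
  { intros t. unfold cexp, Cmult, RtoC; simpl.
    rewrite !Rmult_0_r, Rplus_0_l, Rminus_0_r. reflexivity. }
  eapply cderiv_ext_fun; [|intros t; symmetry; apply E].
  intros t. rewrite E. destruct z as [a b]. unfold Cmult; simpl.
  split; auto_derive; auto; ring.
Qed.

Notation is_RInt_complex := (is_RInt (V := C_R_NormedModule)).

Lemma is_RInt_C (f : R -> C) a b (l : C) :
  is_RInt (fun t => fst (f t)) a b (fst l) -> is_RInt (fun t => snd (f t)) a b (snd l) ->
  is_RInt_complex f a b l.
Proof.
  intros H1 H2. destruct l as [l1 l2].
  apply (is_RInt_fct_extend_pair (U := R_NormedModule) (V := R_NormedModule)); assumption.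
Qed.

Lemma is_RInt_C_inv (f : R -> C) a b (l : C) :
  is_RInt_complex f a b l ->
  is_RInt (fun t => fst (f t)) a b (fst l) /\ is_RInt (fun t => snd (f t)) a b (snd l).
Proof.
  intros H. split.
  - apply (is_RInt_fct_extend_fst (U := R_NormedModule) (V := R_NormedModule)); assumption.
  - apply (is_RInt_fct_extend_snd (U := R_NormedModule) (V := R_NormedModule)); assumption.
Qed.

Lemma is_RInt_cderiv F f df a b : cderiv F f -> cderiv f df ->
  is_RInt_complex f a b (Cminus (F b) (F a)).
Proof.
  intros HF Hf. apply is_RInt_C; simpl.
  - apply (is_RInt_derive (V := R_CompleteNormedModule) (fun t => fst (F t))).
    + intros; apply HF.
    + intros x _; apply ex_derive_continuous_R.
      exists (fst (df x)). exact (proj1 (Hf x)).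
  - apply (is_RInt_derive (V := R_CompleteNormedModule) (fun t => snd (F t))).
    + intros; apply HF.
    + intros x _; apply ex_derive_continuous_R.
      exists (snd (df x)). exact (proj2 (Hf x)).
Qed.

Lemma is_RInt_C_plus f g a b l m :
  is_RInt_complex f a b l -> is_RInt_complex g a b m ->
  is_RInt_complex (fun t => Cplus (f t) (g t)) a b (Cplus l m).
Proof. intros H1 H2. exact (is_RInt_plus (V := C_R_NormedModule) f g a b l m H1 H2). Qed.

Lemma is_RInt_C_scal c f a b l :
  is_RInt_complex f a b l ->
  is_RInt_complex (fun t => Cmult c (f t)) a b (Cmult c l).
Proof.
  intros H. apply is_RInt_C_inv in H. destruct H as [H1 H2]. apply is_RInt_C; simpl.
  - apply (is_RInt_minus (V := R_NormedModule)); apply (is_RInt_scal (V := R_NormedModule)); assumption.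
  - apply (is_RInt_plus (V := R_NormedModule)); apply (is_RInt_scal (V := R_NormedModule)); assumption.
Qed.

Lemma is_RInt_cis (j : Z) :
  is_RInt_complex (fun t => cis (2 * PI * IZR j * t)) 0 1
    (if Z.eq_dec j 0 then RtoC 1 else RtoC 0).
Proof.
  destruct (Z.eq_dec j 0) as [->|Hj].
  - apply is_RInt_C; simpl.
    + eapply is_RInt_ext with (f := fun _ => 1).
      * intros t _. simpl. rewrite Rmult_0_r, Rmult_0_l, cos_0. reflexivity.
      * assert (T : is_RInt (fun _ : R => 1) 0 1 ((1 - 0) * 1))
          by exact (is_RInt_const (V := R_NormedModule) 0 1 1).
        replace ((1 - 0) * 1) with 1 in T by ring. exact T.
    + eapply is_RInt_ext with (f := fun _ => 0).
      * intros t _. simpl. rewrite Rmult_0_r, Rmult_0_l, sin_0. reflexivity.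
      * assert (T : is_RInt (fun _ : R => 0) 0 1 ((1 - 0) * 0))
          by exact (is_RInt_const (V := R_NormedModule) 0 1 0).
        replace ((1 - 0) * 0) with 0 in T by ring. exact T.
  - set (z := (0, 2 * PI * IZR j) : C).
    assert (Hz : z <> RtoC 0).
    { unfold z. intros E. injection E. intros E1. assert (HP := PI_RGT_0).
      assert (IZR j <> 0) by (apply eq_IZR_contrapositive; exact Hj). nra. }
    assert (E : forall t, cexp (Cmult z (RtoC t)) = cis (2 * PI * IZR j * t)).
    { intros t. unfold z, cexp, cis, Cmult, RtoC; simpl.
      replace (0 * t - 2 * PI * IZR j * 0) with 0 by ring. rewrite exp_0.
      replace (0 * 0 + 2 * PI * IZR j * t) with (2 * PI * IZR j * t) by ring. f_equal; ring. }
    assert (T := is_RInt_C_scal (Cinv z) _ _ _ _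
      (is_RInt_cderiv _ _ _ 0 1 (cderiv_cexp z)
        (cderiv_mult _ _ _ _ (cderiv_const z) (cderiv_cexp z)))).
    cbv beta in T. rewrite !E in T. rewrite Rmult_1_r, Rmult_0_r, cis_0, cis_2PI_Z in T.
    replace (RtoC 0) with (Cmult (Cinv z) (Cminus (RtoC 1) (RtoC 1))) by ring.
    eapply is_RInt_ext; [|exact T]. intros t _. simpl. rewrite E.
    rewrite Cmult_assoc, Cinv_l by exact Hz. ring.
Qed.

(** Repeated integration by parts of [t^k e^(-g t) / k!]. With the factor [1/k!] the derivative of
    [t^(k+1)/(k+1)!] is [t^k/k!], so the recursion carries no numerical coefficient. *)
Fixpoint pow_exp_primitive (g : C) (k : nat) (t : R) : C :=
  match k with
  | O => Copp (Cdiv (cexp (Cmult (Copp g) (RtoC t))) g)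
  | S k' => Cdiv (Cminus (pow_exp_primitive g k' t)
       (Cmult (RtoC (t ^ k / INR (fact k))) (cexp (Cmult (Copp g) (RtoC t))))) g
  end.

Definition pow_exp (g : C) (k : nat) (t : R) : C :=
  Cmult (RtoC (t ^ k / INR (fact k))) (cexp (Cmult (Copp g) (RtoC t))).

Lemma is_derive_pow_fact k t :
  is_derive (fun t => t ^ S k / INR (fact (S k))) t (t ^ k / INR (fact k)).
Proof.
  assert (Hc : INR (fact (S k)) = INR (S k) * INR (fact k)) by (rewrite <- mult_INR; reflexivity).
  assert (H1 := INR_fact_neq_0 k). assert (H2 : INR (S k) <> 0) by (apply not_0_INR; lia).
  rewrite Hc. set (n := S k) in *. auto_derive; auto.
  unfold n in *. change (Nat.pred (S k)) with k. field. auto.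
Qed.

Lemma cderiv_pow_exp g k : exists df, cderiv (pow_exp g k) df.
Proof.
  destruct k as [|k]; eexists; apply cderiv_mult.
  - apply (cderiv_real _ (fun _ => 0)). intros t. simpl. apply (is_derive_const (V := R_NormedModule)).
  - apply cderiv_cexp.
  - apply cderiv_real, is_derive_pow_fact.
  - apply cderiv_cexp.
Qed.

Lemma cderiv_pow_exp_primitive g k : g <> RtoC 0 ->
  cderiv (pow_exp_primitive g k) (pow_exp g k).
Proof.
  intros Hg. induction k as [|k IH].
  - eapply cderiv_ext_fun with (F := fun t => Cmult (Copp (Cinv g)) (cexp (Cmult (Copp g) (RtoC t)))).
    + eapply cderiv_ext; [apply cderiv_mult; [apply cderiv_const|apply cderiv_cexp]|].
      intros t. unfold pow_exp. simpl.
      replace (1 / 1) with 1 by field. field. exact Hg.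
    + intros t. simpl. unfold Cdiv. ring.
  - eapply cderiv_ext_fun with (F := fun t => Cmult (Cinv g) (Cplus (pow_exp_primitive g k t)
        (Cmult (RtoC (-1)) (Cmult (RtoC (t ^ S k / INR (fact (S k)))) (cexp (Cmult (Copp g) (RtoC t))))))).
    + eapply cderiv_ext.
      * apply cderiv_mult; [apply cderiv_const|]. apply cderiv_plus; [exact IH|].
        apply cderiv_mult; [apply cderiv_const|]. apply cderiv_mult; [apply cderiv_real, is_derive_pow_fact|apply cderiv_cexp].
      * intros t. unfold pow_exp. set (e := cexp _). replace (RtoC (-1)) with (Copp (RtoC 1)) by (rewrite <- RtoC_opp; reflexivity). field. exact Hg.
    + intros t. cbn [pow_exp_primitive]. unfold Cdiv.
      replace (RtoC (-1)) with (Copp (RtoC 1)) by (rewrite <- RtoC_opp; reflexivity). ring.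
Qed.

(** Up to sign this is the Laplace transform [1/g^(k+1)], since the primitive vanishes at infinity
    when [Re g > 0]. It is how the coefficients of the Lipschitz formula arise. *)
Lemma pow_exp_primitive_0 g k : g <> RtoC 0 ->
  pow_exp_primitive g k 0 = Copp (Cinv (Cpow g (S k))).
Proof.
  intros Hg. induction k as [|k IH].
  - simpl. rewrite Cmult_0_r. replace (cexp (RtoC 0)) with (RtoC 1).
    + field. exact Hg.
    + unfold cexp, RtoC; simpl. rewrite exp_0, cos_0, sin_0. f_equal; ring.
  - cbn [pow_exp_primitive]. rewrite IH.
    replace (0 ^ S k / INR (fact (S k))) with 0 by (simpl; unfold Rdiv; ring).
    rewrite (Cpow_S g (S k)). field. split; [apply Cpow_nz; exact Hg|exact Hg].
Qed.

(** The exponent [A = k + 2] absorbs [t^k] and leaves the summable [t^(-2)]. *)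
Lemma pow_exp_decay (r : R) (k : nat) : 0 < r ->
  exists K, 0 < K /\ forall t, 1 <= t -> t ^ k * exp (- (r * t)) <= K * Rpower t (- 2).
Proof.
  intros Hr. set (A := INR (k + 2)).
  assert (HA : 0 < A) by (apply lt_0_INR; lia).
  exists (exp (A * ln A - A) * Rpower r (- A)). split.
  - apply Rmult_lt_0_compat; unfold Rpower; apply exp_pos.
  - intros t Ht. assert (H := Rpower_exp_le A (r * t) HA ltac:(nra)).
    assert (Hk : 0 < t ^ k) by (apply pow_lt; lra).
    apply Rle_trans with (t ^ k * (exp (A * ln A - A) * Rpower (r * t) (- A))).
    + apply Rmult_le_compat_l; [lra|exact H].
    + right. rewrite <- (Rpower_mult_distr r t) by lra.
      replace (Rpower t (- A)) with (Rpower t (- INR k) * Rpower t (- 2)).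
      2:{ rewrite <- Rpower_plus. f_equal. unfold A. rewrite plus_INR. simpl. ring. }
      rewrite (Rpower_Ropp t (INR k)), (Rpower_pow k t) by lra. field. lra.
Qed.

(** * The Lipschitz formula *)

(* [ring] does not recognize an equation typed in a Coquelicot structure over [R] or [C]. *)
Ltac R_eq := match goal with |- @eq _ ?a ?b => change (@eq R a b) end.
Ltac C_eq := match goal with |- @eq _ ?a ?b => change (@eq C a b) end.

Lemma div_le (a b c : R) : 0 < c -> a <= b * c -> a / c <= b.
Proof.
  intros Hc H. apply Rmult_le_reg_r with c; [exact Hc|].
  replace (a / c * c) with a by (field; lra). exact H.
Qed.

Lemma le_div (a b c : R) : 0 < c -> a * c <= b -> a <= b / c.
Proof.
  intros Hc H. apply Rmult_le_reg_r with c; [exact Hc|].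
  replace (b / c * c) with b by (field; lra). exact H.
Qed.

(** The number [b + 2 pi i j]. In [lip_pair] below, the indices [n] and [- n - 1] are paired, so
    that a series over [nat] meets every integer exactly once. *)
Definition im_shift (b : C) (j : Z) : C := (fst b, snd b + 2 * PI * IZR j).
Definition lip_coef (b : C) (k : nat) (j : Z) : C := Cinv (Cpow (im_shift b j) (S k)).
Definition lip_pair (b : C) (k n : nat) (x : R) : C :=
  Cplus (Cmult (lip_coef b k (Z.of_nat n)) (cis (2 * PI * IZR (Z.of_nat n) * x)))
        (Cmult (lip_coef b k (- Z.of_nat n - 1)) (cis (2 * PI * IZR (- Z.of_nat n - 1) * x))).
Definition lip_term (b : C) (k n : nat) (x : R) : C :=
  Cminus (pow_exp b k (INR n + x)) (lip_pair b k n x).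

Lemma im_shift_neq_0 b j : 0 < fst b -> im_shift b j <> RtoC 0.
Proof. intros H E. injection E. lra. Qed.

(** Since [j n] is an integer, [e^(-2 pi i j x) = e^(-2 pi i j (n + x))], which is absorbed into the
    exponential by shifting [b]. *)
Lemma pow_exp_mult_cis b k n j x :
  Cmult (pow_exp b k (INR n + x)) (cis (2 * PI * IZR (- j) * x)) = pow_exp (im_shift b j) k (INR n + x).
Proof.
  unfold pow_exp. rewrite <- Cmult_assoc. f_equal.
  rewrite !cexp_cis. rewrite <- Cmult_assoc, <- cis_plus.
  f_equal.
  - f_equal. f_equal. unfold Cmult, Copp, im_shift, RtoC; simpl. ring.
  - transitivity (Cmult (cis (snd (Cmult (Copp b) (RtoC (INR n + x))) + 2 * PI * IZR (- j) * x))
        (cis (2 * PI * IZR (- (j * Z.of_nat n))))).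
    + rewrite cis_2PI_Z. ring.
    + rewrite <- cis_plus. f_equal. unfold Cmult, Copp, im_shift, RtoC; simpl.
      rewrite !opp_IZR, mult_IZR, <- INR_IZR_INZ. ring.
Qed.

(** The contribution of the [n]-th term to the Fourier coefficient of index [j]: an increment of the
    primitive minus the coefficient of whichever paired index equals [j]. *)
Definition lip_integral (b : C) (k : nat) (j : Z) (n : nat) : C :=
  Cminus (Cminus (pow_exp_primitive (im_shift b j) k (INR n + 1)) (pow_exp_primitive (im_shift b j) k (INR n + 0)))
    (Cplus (Cmult (lip_coef b k (Z.of_nat n)) (if Z.eq_dec (Z.of_nat n - j) 0 then RtoC 1 else RtoC 0))
           (Cmult (lip_coef b k (- Z.of_nat n - 1)) (if Z.eq_dec (- Z.of_nat n - 1 - j) 0 then RtoC 1 else RtoC 0))).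

Lemma is_RInt_lip b k j n : 0 < fst b ->
  is_RInt_complex (fun x => Cmult (lip_term b k n x) (cis (2 * PI * IZR (- j) * x))) 0 1
    (lip_integral b k j n).
Proof.
  intros Hb. set (g := im_shift b j).
  assert (Hg : g <> RtoC 0) by (apply im_shift_neq_0; exact Hb).
  destruct (cderiv_pow_exp g k) as [df Hdf].
  assert (H1 := is_RInt_cderiv _ _ _ 0 1 (cderiv_shift _ _ (INR n) (cderiv_pow_exp_primitive g k Hg))
                  (cderiv_shift _ _ (INR n) Hdf)).
  assert (H2 := is_RInt_C_scal (lip_coef b k (Z.of_nat n)) _ _ _ _ (is_RInt_cis (Z.of_nat n - j))).
  assert (H3 := is_RInt_C_scal (lip_coef b k (- Z.of_nat n - 1)) _ _ _ _ (is_RInt_cis (- Z.of_nat n - 1 - j))).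
  assert (H4 := is_RInt_C_plus _ _ _ _ _ _ H1
      (is_RInt_C_scal (RtoC (-1)) _ _ _ _ (is_RInt_C_plus _ _ _ _ _ _ H2 H3))).
  unfold lip_integral. fold g.
  assert (Em : RtoC (-1) = Copp (RtoC 1)) by (rewrite <- RtoC_opp; reflexivity).
  cbv beta in H4. match type of H4 with is_RInt _ _ _ ?v => 
    match goal with |- is_RInt _ _ _ ?w => replace w with v by (change (@eq C v w); rewrite Em; destruct (Z.eq_dec (Z.of_nat n - j) 0); destruct (Z.eq_dec (- Z.of_nat n - 1 - j) 0); ring) end end.
  eapply is_RInt_ext; [|exact H4]. intros x _. cbv beta.
  unfold lip_term, lip_pair, g. rewrite <- pow_exp_mult_cis.
  replace (2 * PI * IZR (Z.of_nat n - j) * x) with (2 * PI * IZR (Z.of_nat n) * x + 2 * PI * IZR (- j) * x)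
    by (rewrite minus_IZR, opp_IZR; ring).
  replace (2 * PI * IZR (- Z.of_nat n - 1 - j) * x) with (2 * PI * IZR (- Z.of_nat n - 1) * x + 2 * PI * IZR (- j) * x)
    by (rewrite (minus_IZR _ j), opp_IZR; ring).
  rewrite !cis_plus, Em. C_eq. ring.
Qed.

Lemma ex_series_Rpower_m2 al : 0 < al -> ex_series (fun n => Rpower (INR n + al) (- 2)).
Proof.
  intros H. replace (- 2) with (Ropp 2) by lra. apply ex_series_Rpower; lra.
Qed.

Lemma pow_exp_primitive_lim g k : 0 < fst g ->
  is_lim_seq (fun N => Cmod (pow_exp_primitive g k (INR N + 1))) 0.
Proof.
  intros Hg.
  assert (Hg0 : g <> RtoC 0) by (intros E; rewrite E in Hg; simpl in Hg; lra).
  assert (Hm : 0 < Cmod g) by (apply Cmod_gt_0; exact Hg0).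
  assert (HE : forall k, is_lim_seq (fun N => Cmod (pow_exp g k (INR N + 1))) 0).
  { intros i. destruct (pow_exp_decay (fst g) i Hg) as [K [HK HKt]].
    apply is_lim_seq_squeeze_0 with (w := fun N => K * Rpower (INR N + 1) (- 2)).
    - intros N. split; [apply Cmod_ge_0|]. unfold pow_exp.
      rewrite Cmod_mult, Cmod_cexp, Cmod_R.
      assert (H1 : 1 <= INR N + 1) by (generalize (pos_INR N); lra).
      assert (H0 : 0 < (INR N + 1) ^ i) by (apply pow_lt; lra).
      assert (HF : 1 <= INR (fact i)) by (apply (le_INR 1); apply lt_O_fact).
      assert (Hd : (INR N + 1) ^ i / INR (fact i) <= (INR N + 1) ^ i).
      { apply div_le; [lra|]. rewrite <- (Rmult_1_r ((INR N + 1) ^ i)) at 1. apply Rmult_le_compat_l; lra. }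
      assert (Hd0 : 0 <= (INR N + 1) ^ i / INR (fact i)) by (apply le_div; [lra|rewrite Rmult_0_l; lra]).
      rewrite Rabs_pos_eq by exact Hd0.
      replace (fst (Cmult (Copp g) (RtoC (INR N + 1)))) with (- (fst g * (INR N + 1)))
        by (unfold Cmult, Copp, RtoC; simpl; ring).
      eapply Rle_trans; [|apply HKt; exact H1].
      apply Rmult_le_compat_r; [left; apply exp_pos|exact Hd].
    - apply is_lim_seq_scal_0. apply ex_series_lim_0. apply ex_series_Rpower_m2; lra. }
  induction k as [|k IH].
  - apply is_lim_seq_ext with (u := fun N => / Cmod g * Cmod (pow_exp g 0 (INR N + 1))).
    + intros N. simpl pow_exp_primitive. unfold pow_exp, Cdiv. rewrite Cmod_opp, !Cmod_mult, Cmod_inv by exact Hg0.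
      simpl. replace (1 / 1) with 1 by field. rewrite Cmod_1. ring.
    + apply is_lim_seq_scal_0. apply HE.
  - apply is_lim_seq_squeeze_0 with (w := fun N => / Cmod g * (Cmod (pow_exp_primitive g k (INR N + 1)) + Cmod (pow_exp g (S k) (INR N + 1)))).
    + intros N. split; [apply Cmod_ge_0|]. cbn [pow_exp_primitive].
      unfold Cdiv. rewrite Cmod_mult, Cmod_inv, Rmult_comm by exact Hg0.
      apply Rmult_le_compat_l; [left; apply Rinv_0_lt_compat; exact Hm|].
      unfold Cminus. eapply Rle_trans; [apply Cmod_triangle|]. rewrite Cmod_opp. right. reflexivity.
    + apply is_lim_seq_scal_0, is_lim_seq_plus_0; [exact IH|apply HE].
Qed.

Lemma sum_n_telescope (I T : nat -> R) N : I O = T O ->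
  (forall n, I (S n) = T (S n) - T n) -> sum_n I N = T N.
Proof.
  intros H0 HS. induction N as [|N IH]; [rewrite sum_O; exact H0|].
  rewrite sum_Sn, IH, HS. unfold plus; simpl. ring.
Qed.

(** The increments of the primitive over the unit intervals telescope to an integral over the
    half-line, with limit [1/(b + 2 pi i j)^(k+1)]. On the other side this same number is subtracted
    exactly once, at the [n] whose pair contains [j]. *)
Lemma is_series_lip_integral b k j : 0 < fst b ->
  is_series (fun n => fst (lip_integral b k j n)) 0 /\ is_series (fun n => snd (lip_integral b k j n)) 0.
Proof.
  intros Hb. set (g := im_shift b j).
  assert (Hg : g <> RtoC 0) by (apply im_shift_neq_0; exact Hb).
  (* [ind N] records whether [j] has already been met, that is, whether [- N - 1 <= j <= N]. *)
  set (ind := fun N : nat => if Z_le_dec (- Z.of_nat N - 1) j then (if Z_le_dec j (Z.of_nat N) then RtoC 1 else RtoC 0) else RtoC 0).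
  set (T := fun N => Cminus (Cminus (pow_exp_primitive g k (INR N + 1)) (pow_exp_primitive g k 0)) (Cmult (lip_coef b k j) (ind N))).
  assert (Hd : forall n, Cplus (Cmult (lip_coef b k (Z.of_nat n)) (if Z.eq_dec (Z.of_nat n - j) 0 then RtoC 1 else RtoC 0))
           (Cmult (lip_coef b k (- Z.of_nat n - 1)) (if Z.eq_dec (- Z.of_nat n - 1 - j) 0 then RtoC 1 else RtoC 0))
      = Cmult (lip_coef b k j) (Cplus (if Z.eq_dec (Z.of_nat n - j) 0 then RtoC 1 else RtoC 0)
                                (if Z.eq_dec (- Z.of_nat n - 1 - j) 0 then RtoC 1 else RtoC 0))).
  { intros n. destruct (Z.eq_dec (Z.of_nat n - j) 0) as [E1|E1]; destruct (Z.eq_dec (- Z.of_nat n - 1 - j) 0) as [E2|E2];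
    try replace j with (Z.of_nat n) by lia; try replace j with (- Z.of_nat n - 1)%Z by lia; try ring.
    exfalso; lia. }
  assert (H0 : lip_integral b k j 0 = T O).
  { unfold lip_integral, T. rewrite Hd. fold g. rewrite Rplus_0_r.
    simpl INR. f_equal. f_equal. f_equal. unfold ind.
    destruct (Z.eq_dec (Z.of_nat 0 - j) 0); destruct (Z.eq_dec (- Z.of_nat 0 - 1 - j) 0);
    destruct (Z_le_dec (- Z.of_nat 0 - 1) j); destruct (Z_le_dec j (Z.of_nat 0)); try lia; ring. }
  assert (HS : forall n, lip_integral b k j (S n) = Cminus (T (S n)) (T n)).
  { intros n. unfold lip_integral, T. rewrite Hd. fold g. rewrite Rplus_0_r.
    replace (INR n + 1) with (INR (S n)) by (rewrite S_INR; ring).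
    replace (ind (S n)) with (Cplus (ind n) (Cplus (if Z.eq_dec (Z.of_nat (S n) - j) 0 then RtoC 1 else RtoC 0)
                                (if Z.eq_dec (- Z.of_nat (S n) - 1 - j) 0 then RtoC 1 else RtoC 0))); [ring|].
    unfold ind.
    destruct (Z.eq_dec (Z.of_nat (S n) - j) 0); destruct (Z.eq_dec (- Z.of_nat (S n) - 1 - j) 0);
    destruct (Z_le_dec (- Z.of_nat n - 1) j); destruct (Z_le_dec j (Z.of_nat n));
    destruct (Z_le_dec (- Z.of_nat (S n) - 1) j); destruct (Z_le_dec j (Z.of_nat (S n))); try lia; ring. }
  assert (HT : is_lim_seq (fun N => Cmod (T N)) 0).
  { eapply is_lim_seq_ext_loc; [|apply (pow_exp_primitive_lim g k); exact Hb].
    exists (Z.to_nat (Z.abs j)). intros N HN. f_equal. unfold T.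
    assert (E : ind N = RtoC 1).
    { unfold ind. destruct (Z_le_dec (- Z.of_nat N - 1) j); [|lia]. destruct (Z_le_dec j (Z.of_nat N)); [reflexivity|lia]. }
    rewrite E, pow_exp_primitive_0 by exact Hg. unfold lip_coef. fold g. ring. }
  assert (Hc : forall u : nat -> R, (forall N, Rabs (u N) <= Cmod (T N)) -> is_lim_seq u 0).
  { intros u Hu. apply is_lim_seq_abs_0. apply is_lim_seq_squeeze_0 with (w := fun N => Cmod (T N)); auto.
    - intros N; split; [apply Rabs_pos|apply Hu]. }
  split.
  - change (is_lim_seq (sum_n (fun n => fst (lip_integral b k j n))) 0).
    apply (is_lim_seq_ext (fun N => fst (T N))).
    + intros N. symmetry. apply (sum_n_telescope _ (fun N => fst (T N))); [rewrite H0; reflexivity|].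
      intros n. rewrite HS. reflexivity.
    + apply Hc. intros N. apply Rabs_fst_le_Cmod.
  - change (is_lim_seq (sum_n (fun n => snd (lip_integral b k j n))) 0).
    apply (is_lim_seq_ext (fun N => snd (T N))).
    + intros N. symmetry. apply (sum_n_telescope _ (fun N => snd (T N))); [rewrite H0; reflexivity|].
      intros n. rewrite HS. reflexivity.
    + apply Hc. intros N. apply Rabs_snd_le_Cmod.
Qed.

(** The range [-1 < t < 2] is an open neighbourhood of [[0, 1]], as needed for continuity at the
    endpoints; the factor [e^(3 Re b)] pays for replacing [n + t] by [n + 2]. *)
Lemma pow_exp_bound b k : 0 < fst b -> exists K, 0 < K /\
  forall n t, -1 < t < 2 -> Cmod (pow_exp b k (INR n + t)) <= K * Rpower (INR n + 2) (- 2).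
Proof.
  intros Hb. destruct (pow_exp_decay (fst b) k Hb) as [K [HK HKt]].
  exists (exp (3 * fst b) * K). split; [apply Rmult_lt_0_compat; [apply exp_pos|exact HK]|].
  intros n t Ht. assert (Hn := pos_INR n). unfold pow_exp. rewrite Cmod_mult, Cmod_cexp, Cmod_R.
  replace (fst (Cmult (Copp b) (RtoC (INR n + t)))) with (- (fst b * (INR n + t)))
    by (unfold Cmult, Copp, RtoC; simpl; ring).
  assert (HF : 1 <= INR (fact k)) by (apply (le_INR 1); apply lt_O_fact).
  assert (H1 : Rabs ((INR n + t) ^ k / INR (fact k)) <= (INR n + 2) ^ k).
  { unfold Rdiv. rewrite Rabs_mult, <- RPow_abs, (Rabs_pos_eq (/ _)) by (left; apply Rinv_0_lt_compat; lra).
    assert (Rabs (INR n + t) ^ k <= (INR n + 2) ^ k).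
    { apply pow_incr; split; [apply Rabs_pos|]. apply Rabs_le. lra. }
    assert (0 <= Rabs (INR n + t) ^ k) by (apply pow_le, Rabs_pos).
    apply (div_le (Rabs (INR n + t) ^ k) ((INR n + 2) ^ k) (INR (fact k))); [lra|nra]. }
  assert (H2 : exp (- (fst b * (INR n + t))) <= exp (3 * fst b) * exp (- (fst b * (INR n + 2)))).
  { rewrite <- exp_plus. destruct (Req_dec (- (fst b * (INR n + t))) (3 * fst b + - (fst b * (INR n + 2)))) as [->|]; [lra|].
    left. apply exp_increasing. nra. }
  specialize (HKt (INR n + 2) ltac:(lra)).
  apply Rle_trans with ((INR n + 2) ^ k * (exp (3 * fst b) * exp (- (fst b * (INR n + 2))))).
  - apply Rmult_le_compat; auto; [apply Rabs_pos|left; apply exp_pos].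
  - assert (0 < exp (3 * fst b)) by apply exp_pos. nra.
Qed.

Lemma Rpower_m2 t : 0 < t -> Rpower t (- 2) = / t ^ 2.
Proof. intros Ht. replace (- 2) with (Ropp 2) by lra. rewrite Rpower_Ropp. f_equal. exact (Rpower_pow 2 t Ht). Qed.

(** [Q] is chosen so that [n + 1 <= Q |b + 2 pi i j|] whenever [n <= |j|]: the imaginary part
    controls [n], up to [|Im b|], and the real part [Re b] controls the constants. As [k + 1 >= 2],
    the extra powers of [1/(n+1)] are dropped. *)
Lemma lip_coef_bound b k : 0 < fst b -> (1 <= k)%nat -> exists K, 0 < K /\
  forall n, Cmod (lip_coef b k (Z.of_nat n)) <= K * Rpower (INR n + 1) (- 2) /\
            Cmod (lip_coef b k (- Z.of_nat n - 1)) <= K * Rpower (INR n + 1) (- 2).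
Proof.
  intros Hb Hk. assert (HP := PI_RGT_0).
  set (Q := / (2 * PI) + (Rabs (snd b) / (2 * PI) + 1) / fst b).
  assert (Hi : 0 < / (2 * PI)) by (apply Rinv_0_lt_compat; lra).
  assert (Hib : 0 < / fst b) by (apply Rinv_0_lt_compat; lra).
  assert (HQ : 0 < Q).
  { unfold Q, Rdiv. assert (0 <= Rabs (snd b) * / (2 * PI)) by (apply Rmult_le_pos; [apply Rabs_pos|lra]).
    apply Rplus_lt_le_0_compat; [lra|]. apply Rmult_le_pos; lra. }
  exists (Q ^ S k). split; [apply pow_lt; exact HQ|].
  assert (Hgen : forall n (j : Z), INR n <= Rabs (IZR j) -> Cmod (lip_coef b k j) <= Q ^ S k * Rpower (INR n + 1) (- 2)).
  { intros n j Hj. assert (Hn := pos_INR n).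
    assert (H0 := im_shift_neq_0 b j Hb).
    set (z := im_shift b j) in *.
    assert (Hz1 : fst b <= Cmod z).
    { eapply Rle_trans; [apply Rle_abs|apply (Rabs_fst_le_Cmod z)]. }
    assert (Hz2 : 2 * PI * INR n <= Cmod z + Rabs (snd b)).
    { assert (H : Rabs (snd b + 2 * PI * IZR j) <= Cmod z) by exact (Rabs_snd_le_Cmod z).
      assert (H3 := Rabs_triang (snd b + 2 * PI * IZR j) (- snd b)).
      rewrite Rabs_Ropp in H3. replace (snd b + 2 * PI * IZR j + - snd b) with (2 * PI * IZR j) in H3 by ring.
      rewrite (Rabs_mult (2 * PI)), (Rabs_pos_eq (2 * PI)) in H3 by lra. nra. }
    assert (Hlow : INR n + 1 <= Q * Cmod z).
    { assert (A1 : INR n <= (Cmod z + Rabs (snd b)) / (2 * PI)) by (apply le_div; lra).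
      assert (A2 : 1 <= Cmod z / fst b) by (apply le_div; lra).
      unfold Q. replace ((/ (2 * PI) + (Rabs (snd b) / (2 * PI) + 1) / fst b) * Cmod z)
        with (Cmod z / (2 * PI) + (Rabs (snd b) / (2 * PI) + 1) * (Cmod z / fst b)) by (field; lra).
      replace ((Cmod z + Rabs (snd b)) / (2 * PI)) with (Cmod z / (2 * PI) + Rabs (snd b) / (2 * PI)) in A1 by (field; lra).
      assert (0 <= Rabs (snd b) / (2 * PI)) by (apply le_div; [lra|generalize (Rabs_pos (snd b)); lra]).
      nra. }
    unfold lip_coef. fold z. rewrite Cmod_inv, Cmod_pow by (apply Cpow_nz; exact H0).
    rewrite Rpower_m2 by lra.
    assert (Hzp : 0 < Cmod z) by lra.
    assert (Hy : / Cmod z <= Q * / (INR n + 1)).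
    { apply Rmult_le_reg_l with (Cmod z); [lra|]. rewrite Rinv_r by lra.
      replace (Cmod z * (Q * / (INR n + 1))) with ((Q * Cmod z) / (INR n + 1)) by (field; lra).
      apply le_div; lra. }
    rewrite <- pow_inv.
    apply Rle_trans with ((Q * / (INR n + 1)) ^ S k).
    - apply pow_incr. split; [left; apply Rinv_0_lt_compat; lra|exact Hy].
    - rewrite Rpow_mult_distr. apply Rmult_le_compat_l; [apply pow_le; lra|].
      rewrite <- pow_inv. destruct k as [|k]; [lia|].
      assert (Y0 : 0 < / (INR n + 1)) by (apply Rinv_0_lt_compat; lra).
      assert (Y1 : / (INR n + 1) <= 1) by (rewrite <- Rinv_1; apply Rinv_le_contravar; lra).
      replace (S (S k)) with (2 + k)%nat by lia. rewrite pow_add.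
      assert ((/ (INR n + 1)) ^ k <= 1) by (apply Rle_trans with (1 ^ k); [apply pow_incr; lra|rewrite pow1; lra]).
      assert (0 < (/ (INR n + 1)) ^ 2) by (apply pow_lt; lra).
      rewrite <- (Rmult_1_r ((/ (INR n + 1)) ^ 2)) at 2. apply Rmult_le_compat_l; lra. }
  intros n. split; apply Hgen.
  - rewrite <- INR_IZR_INZ. apply Rle_abs.
  - rewrite minus_IZR, opp_IZR, <- INR_IZR_INZ. rewrite <- Rabs_Ropp.
    eapply Rle_trans; [|apply Rle_abs]. lra.
Qed.

Lemma lip_pair_bound b k : 0 < fst b -> (1 <= k)%nat -> exists K, 0 < K /\
  forall n x, Cmod (lip_pair b k n x) <= K * Rpower (INR n + 1) (- 2).
Proof.
  intros Hb Hk. destruct (lip_coef_bound b k Hb Hk) as [K [HK H]].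
  exists (2 * K). split; [lra|]. intros n x. destruct (H n) as [H1 H2].
  unfold lip_pair. eapply Rle_trans; [apply Cmod_triangle|].
  rewrite !Cmod_mult, !Cmod_cis. lra.
Qed.

Lemma continuous_cderiv_fst F f t : cderiv F f -> continuous (fun t => fst (F t)) t.
Proof.
  intros H. apply ex_derive_continuous_R.
  exists (fst (f t)). exact (proj1 (H t)).
Qed.

Lemma cderiv_cis c : exists df, cderiv (fun t => cis (c * t)) df.
Proof.
  exists (fun t => (- c * sin (c * t), c * cos (c * t))). intros t.
  split; unfold cis; simpl; auto_derive; auto; ring.
Qed.

Lemma lip_term_continuous b k n x : continuous (fun t => fst (lip_term b k n t)) x.
Proof.
  destruct (cderiv_pow_exp b k) as [d1 H1].
  destruct (cderiv_cis (2 * PI * IZR (Z.of_nat n))) as [d2 H2].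
  destruct (cderiv_cis (2 * PI * IZR (- Z.of_nat n - 1))) as [d3 H3].
  assert (H4 := cderiv_plus _ _ _ _ (cderiv_mult _ _ _ _ (cderiv_const (lip_coef b k (Z.of_nat n))) H2)
                  (cderiv_mult _ _ _ _ (cderiv_const (lip_coef b k (- Z.of_nat n - 1))) H3)).
  assert (H5 := cderiv_plus _ _ _ _ (cderiv_shift _ _ (INR n) H1) (cderiv_mult _ _ _ _ (cderiv_const (RtoC (-1))) H4)).
  eapply continuous_cderiv_fst. eapply cderiv_ext_fun; [exact H5|].
  intros t. cbv beta. unfold lip_term, lip_pair.
  replace (RtoC (-1)) with (Copp (RtoC 1)) by (rewrite <- RtoC_opp; reflexivity). ring.
Qed.

(* Both sides, as functions of [x], have the same Fourier coefficients. *)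
Lemma lipschitz_formula (b : C) (k : nat) (x : R) : 0 < fst b -> (1 <= k)%nat -> 0 <= x <= 1 ->
  ex_series (fun n => fst (pow_exp b k (INR n + x))) /\ ex_series (fun n => fst (lip_pair b k n x)) /\
  Series (fun n => fst (pow_exp b k (INR n + x))) = Series (fun n => fst (lip_pair b k n x)).
Proof.
  intros Hb Hk Hx.
  destruct (pow_exp_bound b k Hb) as [K1 [HK1 B1]].
  destruct (lip_pair_bound b k Hb Hk) as [K2 [HK2 B2]].
  assert (S1 : ex_series (fun n => K1 * Rpower (INR n + 2) (- 2))).
  { apply ex_series_scal_R. apply ex_series_Rpower_m2; lra. }
  assert (S2 : ex_series (fun n => K2 * Rpower (INR n + 1) (- 2))).
  { apply ex_series_scal_R. apply ex_series_Rpower_m2; lra. }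
  assert (E1 : ex_series (fun n => fst (pow_exp b k (INR n + x)))).
  { apply (ex_series_le_R _ (fun n => K1 * Rpower (INR n + 2) (- 2))); [|exact S1].
    intros n. eapply Rle_trans; [apply Rabs_fst_le_Cmod|apply B1; lra]. }
  assert (E2 : ex_series (fun n => fst (lip_pair b k n x))).
  { apply (ex_series_le_R _ (fun n => K2 * Rpower (INR n + 1) (- 2))); [|exact S2].
    intros n. eapply Rle_trans; [apply Rabs_fst_le_Cmod|apply B2]. }
  split; [exact E1|]. split; [exact E2|].
  assert (Z0 : Series (fun n => fst (lip_term b k n x)) = 0).
  2:{ apply Rminus_diag_uniq. rewrite <- Series_minus by assumption. exact Z0. }
  set (A := fun n => K1 * Rpower (INR n + 2) (- 2) + K2 * Rpower (INR n + 1) (- 2)).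
  assert (SA : ex_series A) by (apply ex_series_plus_R; assumption).
  assert (BA : forall n t, -1 < t < 2 -> Rabs (fst (lip_term b k n t)) <= A n).
  { intros n t Ht. eapply Rle_trans; [apply Rabs_fst_le_Cmod|].
    unfold lip_term, Cminus. eapply Rle_trans; [apply Cmod_triangle|]. rewrite Cmod_opp.
    apply Rplus_le_compat; [apply B1; exact Ht|apply B2]. }
  assert (HC : forall t, 0 <= t <= 1 -> continuous (fun t => Series (fun n => fst (lip_term b k n t))) t).
  { intros t Ht. apply (continuous_dominated_series (fun n t => fst (lip_term b k n t)) A (-1) 2); auto; [|lra].
    intros n. apply lip_term_continuous. }
  refine (fourier_uniqueness (fun t => Series (fun n => fst (lip_term b k n t))) HC _ x Hx).
  intros j.
  (* Real coefficients of the real part are needed: half the sum of the real parts at [j] and [- j]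
     gives the cosine integral, and half the difference of the imaginary parts the sine integral. *)
  assert (P := fun n => is_RInt_C_inv _ _ _ _ (is_RInt_lip b k j n Hb)).
  assert (Q := fun n => is_RInt_C_inv _ _ _ _ (is_RInt_lip b k (- j) n Hb)).
  destruct (is_series_lip_integral b k j Hb) as [P1 P2].
  destruct (is_series_lip_integral b k (- j) Hb) as [Q1 Q2].
  assert (Hcont : forall (tr : R -> R), (forall t, ex_derive tr t) -> forall t, continuous (fun t => tr (2 * PI * IZR j * t)) t).
  { intros tr Htr t. apply ex_derive_continuous_R.
    apply (ex_derive_comp tr (fun t => 2 * PI * IZR j * t)); [apply Htr|auto_derive; auto]. }
  split.
  - apply (is_RInt_dominated_series (fun n t => fst (lip_term b k n t)) A
       (fun n => / 2 * (fst (lip_integral b k j n) + fst (lip_integral b k (- j) n)))); auto.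
    + intros n t Ht. apply BA; lra.
    + apply Hcont. intros t. auto_derive; auto.
    + intros t. apply Rabs_le, COS_bound.
    + intros n. eapply is_RInt_ext; [|apply (is_RInt_scal (V := R_NormedModule)), (is_RInt_plus (V := R_NormedModule));
        [apply (P n)|apply (Q n)]].
      intros t _. cbv beta. generalize (lip_term b k n t). intros [f1 f2].
      unfold scal, plus; simpl. unfold mult; simpl.
      rewrite Z.opp_involutive, opp_IZR.
      replace (2 * PI * - IZR j * t) with (- (2 * PI * IZR j * t)) by ring. rewrite cos_neg, sin_neg. field.
    + replace 0 with (/ 2 * (0 + 0)) by ring.
      apply (is_series_scal (K := R_AbsRing) (V := R_NormedModule) (/ 2)).
      apply (is_series_plus (K := R_AbsRing) (V := R_NormedModule)); assumption.
  - apply (is_RInt_dominated_series (fun n t => fst (lip_term b k n t)) A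
       (fun n => / 2 * (snd (lip_integral b k (- j) n) - snd (lip_integral b k j n)))); auto.
    + intros n t Ht. apply BA; lra.
    + apply Hcont. intros t. auto_derive; auto.
    + intros t. apply Rabs_le, SIN_bound.
    + intros n. eapply is_RInt_ext; [|apply (is_RInt_scal (V := R_NormedModule)), (is_RInt_minus (V := R_NormedModule));
        [apply (Q n)|apply (P n)]].
      intros t _. cbv beta. generalize (lip_term b k n t). intros [f1 f2].
      unfold scal, minus, plus, opp; simpl. unfold mult; simpl.
      rewrite Z.opp_involutive, opp_IZR.
      replace (2 * PI * - IZR j * t) with (- (2 * PI * IZR j * t)) by ring. rewrite cos_neg, sin_neg. field.
    + replace 0 with (/ 2 * (0 - 0)) by ring.
      apply (is_series_scal (K := R_AbsRing) (V := R_NormedModule) (/ 2)).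
      apply (is_series_minus (K := R_AbsRing) (V := R_NormedModule)); assumption.
Qed.

(** * Real parts of inverse powers of lattice points *)

Definition rpow (k : nat) (s al : R) : R := fst (Cinv (Cpow (s, 2 * PI * al) (S k))).

Lemma Cinv_conj z : Cinv (Cconj z) = Cconj (Cinv z).
Proof.
  unfold Cinv, Cconj; simpl.
  replace (- snd z * (- snd z * 1)) with (snd z * (snd z * 1)) by ring.
  f_equal; unfold Rdiv; ring.
Qed.

Lemma Cinv_pow_conj z n : Cinv (Cpow (Cconj z) n) = Cconj (Cinv (Cpow z n)).
Proof. rewrite <- Cpow_conj. apply Cinv_conj. Qed.

Lemma rpow_neg_r k s al : rpow k s (- al) = rpow k s al.
Proof.
  unfold rpow. replace (s, 2 * PI * - al) with (Cconj (s, 2 * PI * al)).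
  - rewrite Cinv_pow_conj. reflexivity.
  - unfold Cconj; simpl. f_equal. ring.
Qed.

Lemma Cpow_opp_even z n : Cpow (Copp z) (2 * n) = Cpow z (2 * n).
Proof.
  rewrite !Cpow_mult_r. f_equal. simpl. ring.
Qed.

(** Negating [s] sends [s + 2 pi i al] to minus its conjugate, and [k + 1] is even. *)
Lemma rpow_neg_l k s al : Nat.Odd k -> rpow k (- s) al = rpow k s al.
Proof.
  intros [h Hh]. unfold rpow. replace (- s, 2 * PI * al) with (Copp (Cconj (s, 2 * PI * al))).
  - replace (S k) with (2 * (S h))%nat by lia. rewrite Cpow_opp_even, Cinv_pow_conj. reflexivity.
  - unfold Cconj, Copp; simpl. f_equal. ring.
Qed.

Lemma Ci_pow_even h : Cpow Ci (2 * h) = RtoC ((-1) ^ h).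
Proof.
  rewrite Cpow_mult_r, RtoC_pow. f_equal. simpl. unfold Ci, Cmult, RtoC; simpl. f_equal; ring.
Qed.

(** From [s w + 2 pi i al = i (w / 2 pi) * conj (4 pi^2 al / w + 2 pi i s)], with [i^(k+1)] real. It
    moves [s] into the imaginary part, so that a sum over [s = e] at fixed [al] becomes the right
    shape for a second Lipschitz formula, with [b = 4 pi^2 al / w]. *)
Lemma rpow_transfer k w s al : Nat.Odd k -> 0 < w -> al <> 0 ->
  rpow k (s * w) al = (-1) ^ ((k + 1) / 2) * (2 * PI / w) ^ (k + 1) * rpow k (4 * PI ^ 2 * al / w) s.
Proof.
  intros [h Hh] Hw Hal. assert (HP := PI_RGT_0). unfold rpow.
  set (z := (4 * PI ^ 2 * al / w, 2 * PI * s) : C).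
  assert (Hz : z <> RtoC 0).
  { unfold z. intros E. injection E. intros _ E2.
    assert (4 * PI ^ 2 * al / w <> 0); [|contradiction].
    unfold Rdiv. apply Rmult_integral_contrapositive_currified; [|apply Rinv_neq_0_compat; lra].
    apply Rmult_integral_contrapositive_currified; [|exact Hal]. assert (0 < PI ^ 2) by (apply pow_lt; lra). lra. }
  replace (s * w, 2 * PI * al) with (Cmult Ci (Cmult (RtoC (w / (2 * PI))) (Cconj z))).
  2:{ unfold z, Ci, Cmult, RtoC, Cconj; simpl. f_equal; field; lra. }
  assert (Hcz : Cconj z <> RtoC 0).
  { intros E. apply Hz. replace z with (Cconj (Cconj z)) by (unfold Cconj; destruct z; simpl; f_equal; ring).
    rewrite E. unfold Cconj, RtoC; simpl. f_equal; ring. }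
  assert (Hwp : w / (2 * PI) <> 0).
  { apply Rgt_not_eq, Rlt_gt, Rdiv_lt_0_compat; lra. }
  rewrite !Cpow_mult_l.
  replace (S k) with (2 * (S h))%nat by lia. replace ((k + 1) / 2)%nat with (S h).
  2:{ replace (k + 1)%nat with (S h * 2)%nat by lia. rewrite Nat.div_mul; lia. }
  rewrite Ci_pow_even, <- (RtoC_pow (w / (2 * PI))).
  replace (k + 1)%nat with (2 * S h)%nat by lia. set (n := (2 * S h)%nat).
  assert (Hc : Cinv (Cmult (RtoC ((-1) ^ S h)) (Cmult (RtoC ((w / (2 * PI)) ^ n)) (Cpow (Cconj z) n)))
     = Cmult (RtoC ((-1) ^ S h * (2 * PI / w) ^ n)) (Cconj (Cinv (Cpow z n)))).
  { rewrite <- Cinv_pow_conj.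
    assert (E1 : (2 * PI / w) ^ n = / (w / (2 * PI)) ^ n) by (rewrite <- pow_inv; f_equal; field; lra).
    assert (E2 : (-1) ^ S h = / (-1) ^ S h).
    { rewrite <- pow_inv. f_equal. field. }
    assert (N1 : (-1) ^ S h <> 0) by (apply pow_nonzero; lra).
    assert (N2 : (w / (2 * PI)) ^ n <> 0) by (apply pow_nonzero; exact Hwp).
    assert (M1 : RtoC ((-1) ^ S h) <> RtoC 0) by (intros X; apply RtoC_inj in X; contradiction).
    assert (M2 : RtoC ((w / (2 * PI)) ^ n) <> RtoC 0) by (intros X; apply RtoC_inj in X; contradiction).
    assert (M3 : Cpow (Cconj z) n <> RtoC 0) by (apply Cpow_nz; exact Hcz).
    rewrite E1, RtoC_mult, (RtoC_inv ((w / (2 * PI)) ^ n)) by exact N2.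
    assert (M4 : Cinv (RtoC ((-1) ^ S h)) = RtoC ((-1) ^ S h)) by (rewrite <- RtoC_inv, <- E2 by exact N1; reflexivity).
    rewrite <- M4 at 2. field. auto. }
  rewrite Hc. generalize (Cinv (Cpow z n)). intros [c1 c2]. simpl. ring.
Qed.

(** This is the [e = 0] row of the lattice; summed over [al], it gives the Hurwitz zeta values. *)
Lemma rpow_0 k al : Nat.Odd k -> 0 < al ->
  rpow k 0 al = (-1) ^ ((k + 1) / 2) / (2 * PI) ^ (k + 1) * Rpower al (- (INR k + 1)).
Proof.
  intros [h Hh] Hal. assert (HP := PI_RGT_0). unfold rpow.
  replace (0, 2 * PI * al) with (Cmult Ci (RtoC (2 * PI * al)))
    by (unfold Ci, Cmult, RtoC; simpl; f_equal; ring).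
  rewrite Cpow_mult_l. rewrite <- RtoC_pow.
  replace (S k) with (2 * S h)%nat by lia. rewrite Ci_pow_even, <- RtoC_mult.
  replace ((k + 1) / 2)%nat with (S h).
  2:{ replace (k + 1)%nat with (S h * 2)%nat by lia. rewrite Nat.div_mul; lia. }
  assert (N1 : (-1) ^ S h <> 0) by (apply pow_nonzero; lra).
  assert (E2 : (-1) ^ S h = / (-1) ^ S h) by (rewrite <- pow_inv; f_equal; field).
  assert (N3 : (2 * PI * al) ^ (2 * S h) <> 0) by (apply pow_nonzero; nra).
  rewrite <- RtoC_inv by (apply Rmult_integral_contrapositive_currified; assumption).
  match goal with |- fst (RtoC ?v) = _ => change (fst (RtoC v)) with v end.
  rewrite Rinv_mult, <- E2.
  replace (k + 1)%nat with (2 * S h)%nat by lia.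
  replace (INR k + 1) with (INR (2 * S h)) by (rewrite <- S_INR; f_equal; lia).
  rewrite Rpower_Ropp, Rpower_pow by lra. rewrite Rpow_mult_distr, Rinv_mult. unfold Rdiv. ring.
Qed.

(** The twist [cos (2 pi n th)] is placed in the imaginary part of [b], leaving [x = 0]. The index
    [j = n] yields [n + th], and [j = - n - 1] yields [-(n + 1 - th)], whose sign is irrelevant to
    [rpow]. *)
Lemma lipschitz_at_0 k s th : (1 <= k)%nat -> 0 < s ->
  ex_series (fun n => INR n ^ k * (exp (- (s * INR n)) * cos (2 * PI * INR n * th))) /\
  Series (fun n => INR n ^ k * (exp (- (s * INR n)) * cos (2 * PI * INR n * th)))
  = INR (fact k) * Series (fun n => rpow k s (INR n + th) + rpow k s (INR n + 1 - th)).
Proof.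
  intros Hk Hs. set (b := (s, 2 * PI * th) : C).
  destruct (lipschitz_formula b k 0 Hs Hk) as (E1 & E2 & E3); [lra|].
  assert (Hf := INR_fact_neq_0 k).
  assert (X : forall n, INR n ^ k * (exp (- (s * INR n)) * cos (2 * PI * INR n * th))
      = INR (fact k) * fst (pow_exp b k (INR n + 0))).
  { intros n. rewrite Rplus_0_r. unfold pow_exp, cexp, b, Cmult, Copp, RtoC. simpl fst; simpl snd.
    replace (- s * INR n - - (2 * PI * th) * 0) with (- (s * INR n)) by ring.
    replace (- s * 0 + - (2 * PI * th) * INR n) with (- (2 * PI * INR n * th)) by ring.
    rewrite cos_neg. field. exact Hf. }
  split.
  - eapply ex_series_ext; [intros n; symmetry; apply X|].
    apply ex_series_scal_R. exact E1.
  - rewrite (Series_ext _ _ X), Series_scal_l, E3. f_equal. apply Series_ext. intros n.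
    unfold lip_pair, lip_coef. rewrite !Rmult_0_r, !cis_0, !Cmult_1_r.
    assert (P1 : im_shift b (Z.of_nat n) = (s, 2 * PI * (INR n + th))).
    { unfold im_shift, b; simpl. rewrite <- INR_IZR_INZ. f_equal. ring. }
    assert (P2 : im_shift b (- Z.of_nat n - 1) = (s, 2 * PI * - (INR n + 1 - th))).
    { unfold im_shift, b; simpl. rewrite minus_IZR, opp_IZR, <- INR_IZR_INZ. f_equal. ring. }
    rewrite P1, P2. rewrite <- (rpow_neg_r k s (INR n + 1 - th)). reflexivity.
Qed.

(* Folds the sum of an even function over the integers into a sum over [nat]. *)
Definition wt (e : nat) : R := match e with O => 1 | S _ => 2 end.

Lemma fst_cis_sum x c : fst (Cmult c (cis x)) + fst (Cmult c (cis (- x))) = 2 * cos x * fst c.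
Proof. unfold cis, Cmult; simpl. rewrite cos_neg, sin_neg. ring. Qed.

Lemma sum_n_wt (r : nat -> R) N :
  sum_n (fun n => 2 * r n + 2 * r (S n)) N = 2 * sum_n (fun e => wt e * r e) N + 2 * r (S N).
Proof.
  induction N as [|N IH].
  - rewrite !sum_O. unfold wt. R_eq. ring.
  - rewrite !sum_Sn, IH. unfold plus; simpl. R_eq. ring.
Qed.

Lemma fst_pow_exp_real b k t : fst (pow_exp (RtoC b) k t) = / INR (fact k) * (t ^ k * exp (- (b * t))).
Proof.
  unfold pow_exp, cexp, Cmult, Copp, RtoC. simpl fst; simpl snd.
  replace (- b * t - -0 * 0) with (- (b * t)) by ring.
  replace (- b * 0 + - 0 * t) with 0 by ring. rewrite cos_0. field. apply INR_fact_neq_0.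
Qed.

(** Adding the Lipschitz formulas at [psi] and [1 - psi] turns the phases into cosines. Each pair of
    indices then contributes [2 r n + 2 r (n + 1)], so every [r e] with [e >= 1] is counted twice
    and [r 0] once; this is the origin of [wt] and of the factor [1/2]. *)
Lemma lipschitz_cos k b psi : (1 <= k)%nat -> 0 < b -> 0 <= psi <= 1 ->
  is_series (fun e => wt e * (cos (2 * PI * INR e * psi) * rpow k b (INR e)))
   (/ 2 * / INR (fact k) * Series (fun n => (INR n + psi) ^ k * exp (- (b * (INR n + psi)))
       + (INR n + 1 - psi) ^ k * exp (- (b * (INR n + 1 - psi))))).
Proof.
  intros Hk Hb Hpsi. set (z := RtoC b).
  destruct (lipschitz_formula z k psi Hb Hk) as (A1 & A2 & A3); [lra|].
  destruct (lipschitz_formula z k (1 - psi) Hb Hk) as (B1 & B2 & B3); [lra|].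
  assert (Hf := INR_fact_neq_0 k).
  assert (X := fst_pow_exp_real b k). fold z in X.
  set (r := fun e => cos (2 * PI * INR e * psi) * rpow k b (INR e)).
  assert (Y : forall n, fst (lip_pair z k n psi) + fst (lip_pair z k n (1 - psi)) = 2 * r n + 2 * r (S n)).
  { intros n. unfold lip_pair, lip_coef.
    assert (P1 : im_shift z (Z.of_nat n) = (b, 2 * PI * INR n)).
    { unfold im_shift, z, RtoC; simpl. rewrite <- INR_IZR_INZ. f_equal. ring. }
    assert (P2 : im_shift z (- Z.of_nat n - 1) = Cconj (b, 2 * PI * INR (S n))).
    { unfold im_shift, z, RtoC, Cconj; cbn [fst snd]. rewrite minus_IZR, opp_IZR, <- INR_IZR_INZ, S_INR. f_equal. ring. }
    rewrite P1, P2, Cinv_pow_conj.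
    set (c1 := Cinv (Cpow (b, 2 * PI * INR n) (S k))).
    set (c2 := Cinv (Cpow (b, 2 * PI * INR (S n)) (S k))).
    assert (Q1 : cis (2 * PI * IZR (Z.of_nat n) * (1 - psi)) = cis (- (2 * PI * INR n * psi))).
    { rewrite <- INR_IZR_INZ. replace (2 * PI * INR n * (1 - psi)) with (2 * PI * INR n + - (2 * PI * INR n * psi)) by ring.
      rewrite cis_plus, cis_2PI_nat. ring. }
    assert (Q2 : cis (2 * PI * IZR (- Z.of_nat n - 1) * (1 - psi)) = cis (2 * PI * INR (S n) * psi)).
    { replace (2 * PI * IZR (- Z.of_nat n - 1) * (1 - psi)) with (2 * PI * IZR (- Z.of_nat n - 1) + 2 * PI * INR (S n) * psi).
      - rewrite cis_plus, cis_2PI_Z. ring.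
      - rewrite minus_IZR, opp_IZR, <- INR_IZR_INZ, S_INR. ring. }
    assert (Q3 : cis (2 * PI * IZR (- Z.of_nat n - 1) * psi) = cis (- (2 * PI * INR (S n) * psi))).
    { f_equal. rewrite minus_IZR, opp_IZR, <- INR_IZR_INZ, S_INR. ring. }
    rewrite Q1, Q2, Q3, <- INR_IZR_INZ.
    assert (F1 := fst_cis_sum (2 * PI * INR n * psi) c1).
    assert (F2 := fst_cis_sum (2 * PI * INR (S n) * psi) (Cconj c2)).
    unfold r, rpow. fold c1 c2. change (fst (Cconj c2)) with (fst c2) in F2.
    unfold Cplus at 1 2. simpl fst at 1 4. 
    change (fst (Cmult c1 (cis (2 * PI * INR n * psi))) + fst (Cmult (Cconj c2) (cis (- (2 * PI * INR (S n) * psi))))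
      + (fst (Cmult c1 (cis (- (2 * PI * INR n * psi)))) + fst (Cmult (Cconj c2) (cis (2 * PI * INR (S n) * psi))))
      = 2 * (cos (2 * PI * INR n * psi) * fst c1) + 2 * (cos (2 * PI * INR (S n) * psi) * fst c2)).
    lra. }
  set (V := Series (fun n => fst (lip_pair z k n psi)) + Series (fun n => fst (lip_pair z k n (1 - psi)))).
  assert (HV : V = / INR (fact k) * Series (fun n => (INR n + psi) ^ k * exp (- (b * (INR n + psi)))
       + (INR n + 1 - psi) ^ k * exp (- (b * (INR n + 1 - psi))))).
  { unfold V. rewrite <- A3, <- B3, <- Series_plus, <- Series_scal_l by assumption.
    apply Series_ext. intros n. rewrite !X. replace (INR n + (1 - psi)) with (INR n + 1 - psi) by ring. ring. }
  rewrite Rmult_assoc, <- HV.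
  assert (HS : is_series (fun n => 2 * r n + 2 * r (S n)) V).
  { eapply is_series_ext; [exact Y|]. apply (is_series_plus (K := R_AbsRing) (V := R_NormedModule)); apply Series_correct; assumption. }
  (* The last [r (S N)] has been counted only once in the folding; this boundary term tends to 0. *)
  assert (Hr0 : is_lim_seq (fun N => r (S N)) 0).
  { apply -> (is_lim_seq_incr_1 r 0).
    destruct (lip_coef_bound z k Hb Hk) as [K [HK HB]].
    apply is_lim_seq_abs_0. apply is_lim_seq_squeeze_0 with (w := fun N => K * Rpower (INR N + 1) (- 2)).
    - intros N. split; [apply Rabs_pos|]. unfold r. rewrite Rabs_mult.
      destruct (HB N) as [HB1 _]. unfold lip_coef in HB1.
      assert (P1 : im_shift z (Z.of_nat N) = (b, 2 * PI * INR N)).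
      { unfold im_shift, z, RtoC; simpl. rewrite <- INR_IZR_INZ. f_equal. ring. }
      rewrite P1 in HB1. assert (C1 : Rabs (cos (2 * PI * INR N * psi)) <= 1) by apply Rabs_le, COS_bound.
      assert (C2 : Rabs (rpow k b (INR N)) <= K * Rpower (INR N + 1) (-2)).
      { eapply Rle_trans; [apply Rabs_fst_le_Cmod|exact HB1]. }
      generalize (Rabs_pos (cos (2 * PI * INR N * psi))) (Rabs_pos (rpow k b (INR N))). nra.
    - apply is_lim_seq_scal_0. apply ex_series_lim_0, ex_series_Rpower_m2; lra. }
  change (is_lim_seq (sum_n (fun e => wt e * r e)) (/ 2 * V)).
  apply is_lim_seq_ext with (u := fun N => / 2 * (sum_n (fun n => 2 * r n + 2 * r (S n)) N - 2 * r (S N))).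
  - intros N. rewrite sum_n_wt. field.
  - replace (/ 2 * V) with (/ 2 * (V - 2 * 0)) by ring.
    apply (is_lim_seq_scal_l _ (/ 2) (V - 2 * 0)). apply is_lim_seq_minus'; [exact HS|].
    apply (is_lim_seq_scal_l _ 2 0). exact Hr0.
Qed.

(** * Exchange of a cosine sum with a lattice sum *)

(* Minus the second difference of the even extension of [G] to the integers. *)
Definition diff2 (G : nat -> R) (e : nat) : R :=
  match e with
  | O => 2 * G O - 2 * G 1%nat
  | S e' => 2 * G (S e') - G e' - G (S (S e'))
  end.

Lemma sum_Sn_R (a : nat -> R) n : sum_n a (S n) = sum_n a n + a (S n).
Proof. exact (sum_Sn a n). Qed.

(** The factor [2 - 2 cos phi] is the eigenvalue of minus the second difference on [cos (e phi)], by
    [cos ((e+1) phi) + cos ((e-1) phi) = 2 cos phi cos (e phi)]. The weight at 0 and the special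
    case of [diff2] both express evenness, so only the upper end leaves boundary terms. *)
Lemma sum_by_parts (G : nat -> R) (phi : R) N :
  (2 - 2 * cos phi) * sum_n (fun e => wt e * (cos (INR e * phi) * G e)) N
  = sum_n (fun e => wt e * (cos (INR e * phi) * diff2 G e)) N
    - 2 * cos (INR (S N) * phi) * G N + 2 * cos (INR N * phi) * G (S N).
Proof.
  induction N as [|N IH].
  - rewrite !sum_O. unfold wt, diff2. simpl INR. rewrite Rmult_0_l, !Rmult_1_l, cos_0.
    R_eq. ring.
  - rewrite !sum_Sn_R.
    rewrite Rmult_plus_distr_l, IH. unfold wt, diff2.
    assert (E1 : cos (INR (S (S N)) * phi) = 2 * cos phi * cos (INR (S N) * phi) - cos (INR N * phi)).
    { rewrite (S_INR (S N)). replace (INR N * phi) with (INR (S N) * phi - phi) by (rewrite S_INR; ring).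
      rewrite Rmult_plus_distr_r, Rmult_1_l, cos_plus, cos_minus. ring. }
    rewrite E1. R_eq. ring.
Qed.

Lemma is_lim_bounded_mult_0 (u v : nat -> R) (M : R) :
  (forall n, Rabs (u n) <= M) -> is_lim_seq v 0 -> is_lim_seq (fun n => u n * v n) 0.
Proof.
  intros Hu Hv. apply is_lim_seq_abs_0.
  apply is_lim_seq_squeeze_0 with (w := fun n => M * Rabs (v n)).
  - intros n. split; [apply Rabs_pos|]. rewrite Rabs_mult.
    apply Rmult_le_compat_r; [apply Rabs_pos|apply Hu].
  - replace (Finite 0) with (Finite (M * Rabs 0)) by (rewrite Rabs_R0; f_equal; ring).
    apply (is_lim_seq_scal_l _ M (Rabs 0)). apply (is_lim_seq_abs v 0). exact Hv.
Qed.

Lemma is_series_by_parts (G : nat -> R) (phi B : R) : cos phi <> 1 -> is_lim_seq G 0 ->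
  is_series (fun e => wt e * (cos (INR e * phi) * diff2 G e)) B ->
  is_series (fun e => wt e * (cos (INR e * phi) * G e)) (B / (2 - 2 * cos phi)).
Proof.
  intros Hphi HG HB.
  change (is_lim_seq (sum_n (fun e => wt e * (cos (INR e * phi) * G e))) (B / (2 - 2 * cos phi))).
  apply is_lim_seq_ext with (u := fun N => / (2 - 2 * cos phi) * (sum_n (fun e => wt e * (cos (INR e * phi) * diff2 G e)) N
    - (2 * cos (INR (S N) * phi)) * G N + (2 * cos (INR N * phi)) * G (S N))).
  - intros N. rewrite <- sum_by_parts. field. lra.
  - replace (B / (2 - 2 * cos phi)) with (/ (2 - 2 * cos phi) * (B - 0 + 0)) by (field; lra).
    apply (is_lim_seq_scal_l _ _ (B - 0 + 0)).
    assert (Hc : forall x, Rabs (2 * cos x) <= 2).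
    { intros x. generalize (COS_bound x). intros. apply Rabs_le. lra. }
    apply is_lim_seq_plus'; [apply is_lim_seq_minus'; [exact HB|]|].
    + apply (is_lim_bounded_mult_0 _ _ 2); auto.
    + apply (is_lim_bounded_mult_0 _ _ 2); auto. apply -> (is_lim_seq_incr_1 G 0). exact HG.
Qed.

(* The double series of [wt e * cos (e phi) * g e m] need not converge absolutely; multiplying by
   [2 - 2 cos phi] turns [g] into its second differences in [e], for which Fubini applies. *)
Lemma cos_series_switch (g : nat -> nat -> R) (phi : R) (A B : nat -> R) : cos phi <> 1 ->
  (forall e m, Rabs (diff2 (fun e => g e m) e) <= A e * B m) ->
  (forall e, 0 <= A e) -> (forall m, 0 <= B m) -> ex_series A -> ex_series B ->
  (forall e, ex_series (g e)) -> (forall m, is_lim_seq (fun e => g e m) 0) ->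
  is_lim_seq (fun e => Series (g e)) 0 ->
  is_series (fun e => wt e * (cos (INR e * phi) * Series (g e)))
    (Series (fun m => Series (fun e => wt e * (cos (INR e * phi) * g e m)))).
Proof.
  intros Hphi Hd HA0 HB0 HA HB Hex Hm HG.
  set (lam := 2 - 2 * cos phi). assert (Hlam : lam <> 0) by (unfold lam; lra).
  set (a := fun e m => wt e * (cos (INR e * phi) * diff2 (fun e => g e m) e)).
  assert (Ha : forall e m, Rabs (a e m) <= (2 * A e) * B m).
  { intros e m. unfold a. rewrite !Rabs_mult.
    assert (W : Rabs (wt e) <= 2) by (destruct e; simpl; rewrite Rabs_pos_eq; lra).
    assert (C1 : Rabs (cos (INR e * phi)) <= 1) by apply Rabs_le, COS_bound.
    specialize (Hd e m). specialize (HA0 e). specialize (HB0 m).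
    assert (0 <= A e * B m) by nra.
    assert (Rabs (cos (INR e * phi)) * Rabs (diff2 (fun e0 => g e0 m) e) <= 1 * (A e * B m)).
    { apply Rmult_le_compat; auto using Rabs_pos. }
    replace (2 * A e * B m) with (2 * (1 * (A e * B m))) by ring.
    apply Rmult_le_compat; auto using Rabs_pos.
    apply Rmult_le_pos; apply Rabs_pos. }
  assert (HA2 : ex_series (fun e => 2 * A e)) by (apply ex_series_scal_R; exact HA).
  assert (Hsw := dominated_switch a (fun e => 2 * A e) B Ha HA2 HB).
  (* Second differences in [e] commute with the sum over [m], so the row sums of [a] are again
     second differences and can be summed back by parts. *)
  assert (Hrow : forall e, Series (a e) = wt e * (cos (INR e * phi) * diff2 (fun e => Series (g e)) e)).
  { intros e. unfold a. rewrite !Series_scal_l. f_equal. f_equal.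
    destruct e as [|e]; unfold diff2.
    - rewrite Series_minus by (apply ex_series_scal_R; apply Hex).
      rewrite !Series_scal_l. reflexivity.
    - rewrite !Series_minus; try rewrite Series_scal_l; try reflexivity;
      repeat apply (ex_series_minus (K := R_AbsRing) (V := R_NormedModule) _ _);
      try apply ex_series_scal_R; apply Hex. }
  assert (Hcol : forall m, Series (fun e => a e m) = lam * Series (fun e => wt e * (cos (INR e * phi) * g e m))).
  { intros m. assert (E : ex_series (fun e => a e m)).
    { apply (dominated_ex_inner (fun m e => a e m) B (fun e => 2 * A e)); auto.
      intros m' e. rewrite Rmult_comm. apply Ha. }
    assert (T := is_series_by_parts (fun e => g e m) phi _ Hphi (Hm m) (Series_correct _ E)).
    apply is_series_unique in T. rewrite T. fold lam. unfold a. field. exact Hlam. }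
  assert (Eo := dominated_ex_outer a (fun e => 2 * A e) B Ha HA2 HB).
  assert (T : is_series (fun e => wt e * (cos (INR e * phi) * diff2 (fun e => Series (g e)) e))
     (Series (fun e => Series (a e)))).
  { eapply is_series_ext; [exact Hrow|]. apply Series_correct. exact Eo. }
  apply (is_series_by_parts _ phi _ Hphi HG) in T.
  replace (Series (fun m => Series (fun e => wt e * (cos (INR e * phi) * g e m))))
    with (Series (fun e => Series (a e)) / (2 - 2 * cos phi)); [exact T|].
  fold lam. change (Series (fun e => Series (a e))) with (Series (fun e => Series (fun m => a e m))).
  rewrite Hsw, (Series_ext _ _ Hcol), Series_scal_l. field. exact Hlam.
Qed.

Lemma Cpow_diff_bound (u v : C) (r : R) n : Cmod u <= r -> Cmod v <= r ->
  Cmod (Cminus (Cpow u (S n)) (Cpow v (S n))) <= INR (S n) * r ^ n * Cmod (Cminus u v).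
Proof.
  intros Hu Hv. assert (Hr : 0 <= r) by (generalize (Cmod_ge_0 u); lra).
  induction n as [|n IH].
  - rewrite !Cpow_1_r. simpl. lra.
  - rewrite (Cpow_S u (S n)), (Cpow_S v (S n)).
    replace (Cminus (Cmult u (Cpow u (S n))) (Cmult v (Cpow v (S n))))
      with (Cplus (Cmult u (Cminus (Cpow u (S n)) (Cpow v (S n)))) (Cmult (Cminus u v) (Cpow v (S n)))) by ring.
    eapply Rle_trans; [apply Cmod_triangle|]. rewrite !Cmod_mult, Cmod_pow.
    assert (P1 : Cmod v ^ S n <= r ^ S n) by (apply pow_incr; split; [apply Cmod_ge_0|exact Hv]).
    assert (P2 : Cmod u * Cmod (Cminus (Cpow u (S n)) (Cpow v (S n))) <= r * (INR (S n) * r ^ n * Cmod (Cminus u v))).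
    { apply Rmult_le_compat; auto using Cmod_ge_0. }
    rewrite (S_INR (S n)). 
    assert (P3 : Cmod (Cminus u v) * Cmod v ^ S n <= Cmod (Cminus u v) * r ^ S n)
      by (apply Rmult_le_compat_l; auto using Cmod_ge_0).
    replace ((INR (S n) + 1) * r ^ S n * Cmod (Cminus u v))
      with (r * (INR (S n) * r ^ n * Cmod (Cminus u v)) + Cmod (Cminus u v) * r ^ S n) by (simpl; ring).
    lra.
Qed.

Lemma rpow_abs_le k s al r : 0 < r -> (s, 2 * PI * al) <> RtoC 0 -> / r <= Cmod (s, 2 * PI * al) ->
  Rabs (rpow k s al) <= r ^ S k.
Proof.
  intros Hr Hz H. unfold rpow. eapply Rle_trans; [apply Rabs_fst_le_Cmod|].
  rewrite <- Cpow_inv, Cmod_pow, Cmod_inv by exact Hz. apply pow_incr.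
  split; [left; apply Rinv_0_lt_compat, Cmod_gt_0; exact Hz|].
  rewrite <- (Rinv_inv r). apply Rinv_le_contravar; [apply Rinv_0_lt_compat; exact Hr|exact H].
Qed.

(** Applied to the inverses, the power difference gives [r^k], and [1/z - 1/z' = (z' - z)/(z z')]
    gives two further powers. This is one power of [r] more than the size [r^(k+1)] of a single
    term. *)
Lemma rpow_diff_le k s s' al r : 0 < r -> al <> 0 ->
  / r <= Cmod (s, 2 * PI * al) -> / r <= Cmod (s', 2 * PI * al) ->
  Rabs (rpow k s al - rpow k s' al) <= INR (S k) * r ^ (k + 2) * Rabs (s - s').
Proof.
  intros Hr Hal H1 H2. assert (HP := PI_RGT_0).
  assert (Hnz : forall t, (t, 2 * PI * al) <> RtoC 0).
  { intros t E. injection E. intros E1 _. apply Rmult_integral in E1. destruct E1; lra. }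
  set (z := (s, 2 * PI * al) : C) in *. set (z' := (s', 2 * PI * al) : C) in *.
  assert (Hz : z <> RtoC 0) by apply Hnz. assert (Hz' : z' <> RtoC 0) by apply Hnz.
  assert (Hi : forall y, y <> RtoC 0 -> / r <= Cmod y -> Cmod (Cinv y) <= r).
  { intros y Hy H. rewrite Cmod_inv by exact Hy.
    rewrite <- (Rinv_inv r). apply Rinv_le_contravar; [apply Rinv_0_lt_compat; exact Hr|exact H]. }
  unfold rpow. fold z z'. rewrite <- !Cpow_inv by assumption.
  change (fst (Cpow (Cinv z) (S k)) - fst (Cpow (Cinv z') (S k)))
    with (fst (Cminus (Cpow (Cinv z) (S k)) (Cpow (Cinv z') (S k)))).
  eapply Rle_trans; [apply Rabs_fst_le_Cmod|].
  eapply Rle_trans; [apply (Cpow_diff_bound _ _ r); apply Hi; assumption|].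
  replace (Cminus (Cinv z) (Cinv z')) with (Cmult (Cmult (Cinv z) (Cinv z')) (Cminus z' z)) by (field; auto).
  rewrite !Cmod_mult.
  replace (Cmod (Cminus z' z)) with (Rabs (s - s')).
  2:{ replace (Cminus z' z) with (RtoC (s' - s)).
      - rewrite Cmod_R. apply Rabs_minus_sym.
      - unfold z, z', RtoC, Cminus, Cplus, Copp; simpl. f_equal; ring. }
  assert (M : Cmod (Cinv z) * Cmod (Cinv z') <= r * r).
  { apply Rmult_le_compat; auto using Cmod_ge_0. }
  replace (INR (S k) * r ^ (k + 2) * Rabs (s - s')) with (INR (S k) * r ^ k * (r * r * Rabs (s - s'))) by (rewrite pow_add; simpl; ring).
  apply Rmult_le_compat_l; [apply Rmult_le_pos; [apply pos_INR|apply pow_le; lra]|].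
  apply Rmult_le_compat_r; [apply Rabs_pos|exact M].
Qed.

(** The second difference is estimated crudely as two first differences; the single power gained is
    enough. The bound on [t] covers the points [e - 1], [e] and [e + 1], including -1 when [e = 0],
    where evenness in the first argument is used. *)
Lemma diff2_rpow_le k w al e r : Nat.Odd k -> 0 < r -> al <> 0 -> 0 < w ->
  (forall t, INR e - 1 <= Rabs t -> / r <= Cmod (t * w, 2 * PI * al)) ->
  Rabs (diff2 (fun e => rpow k (INR e * w) al) e) <= 2 * INR (S k) * w * r ^ (k + 2).
Proof.
  intros Hk Hr Hal Hw H.
  assert (E : diff2 (fun e => rpow k (INR e * w) al) e
    = (rpow k (INR e * w) al - rpow k ((INR e - 1) * w) al) + (rpow k (INR e * w) al - rpow k ((INR e + 1) * w) al)).
  { destruct e as [|e]; unfold diff2.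
    - simpl INR. replace ((0 - 1) * w) with (- (1 * w)) by ring. rewrite rpow_neg_l by exact Hk.
      replace ((0 + 1) * w) with (1 * w) by ring. ring.
    - rewrite !S_INR. replace (INR e + 1 - 1) with (INR e) by ring. ring. }
  rewrite E. eapply Rle_trans; [apply Rabs_triang|].
  assert (He := pos_INR e).
  assert (D1 : Rabs (rpow k (INR e * w) al - rpow k ((INR e - 1) * w) al) <= INR (S k) * r ^ (k + 2) * Rabs (INR e * w - (INR e - 1) * w)).
  { apply rpow_diff_le; auto; apply H; [rewrite Rabs_pos_eq; lra|apply Rle_abs]. }
  assert (D2 : Rabs (rpow k (INR e * w) al - rpow k ((INR e + 1) * w) al) <= INR (S k) * r ^ (k + 2) * Rabs (INR e * w - (INR e + 1) * w)).
  { apply rpow_diff_le; auto; apply H; rewrite Rabs_pos_eq; lra. }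
  replace (INR e * w - (INR e - 1) * w) with w in D1 by ring.
  replace (INR e * w - (INR e + 1) * w) with (- w) in D2 by ring.
  rewrite Rabs_Ropp in D2. rewrite (Rabs_pos_eq w) in D1, D2 by lra. lra.
Qed.

(** The inequality between arithmetic and geometric means makes the squared modulus dominate a
    product, which separates the variables [e] and [m]. The constant [q] collects
    [|t| al <= t^2/2 + al^2/2] and [2 al <= (2/al0) al^2]. *)
Lemma lattice_lower_bound w al0 : 0 < w -> 0 < al0 -> exists c, 0 < c /\
  forall e m t, INR e - 1 <= Rabs t ->
    c * ((INR e + 1) * (INR m + al0)) <= (t * w) ^ 2 + (2 * PI * (INR m + al0)) ^ 2.
Proof.
  intros Hw Hal. assert (HP := PI_RGT_0).
  set (q := / 2 + 2 / al0). assert (Hq : 0 < q) by (unfold q; assert (0 < 2 / al0) by (apply Rdiv_lt_0_compat; lra); lra).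
  set (c := Rmin (2 * w ^ 2) (4 * PI ^ 2 / q)).
  assert (Hc1 : c <= 2 * w ^ 2) by apply Rmin_l. assert (Hc2 : c <= 4 * PI ^ 2 / q) by apply Rmin_r.
  assert (Hc : 0 < c).
  { unfold c. apply Rmin_glb_lt; [assert (0 < w ^ 2) by (apply pow_lt; lra); lra|].
    apply Rdiv_lt_0_compat; [|exact Hq]. assert (0 < PI ^ 2) by (apply pow_lt; lra); lra. }
  exists c. split; [exact Hc|]. intros e m t Ht. set (al := INR m + al0).
  assert (Hm := pos_INR m). assert (Hal0 : al0 <= al) by (unfold al; lra).
  assert (H1 : (INR e + 1) * al <= t ^ 2 / 2 + al ^ 2 * q).
  { assert (A1 : (INR e + 1) * al <= (Rabs t + 2) * al) by (apply Rmult_le_compat_r; lra).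
    assert (A2 : 2 * al <= al ^ 2 * (2 / al0)).
    { replace (al ^ 2 * (2 / al0)) with (2 * al * (al / al0)) by (field; lra).
      rewrite <- (Rmult_1_r (2 * al)) at 1. apply Rmult_le_compat_l; [lra|]. apply le_div; lra. }
    assert (A3 : Rabs t * al <= t ^ 2 / 2 + al ^ 2 / 2).
    { rewrite <- (pow2_abs t). generalize (pow2_ge_0 (Rabs t - al)). intros. nra. }
    unfold q. lra. }
  assert (H2 : c * q <= 4 * PI ^ 2).
  { apply Rle_trans with (4 * PI ^ 2 / q * q); [apply Rmult_le_compat_r; lra|right; field; lra]. }
  assert (Ht2 := pow2_ge_0 t). assert (Ha2 := pow2_ge_0 al).
  apply Rle_trans with (c * (t ^ 2 / 2 + al ^ 2 * q)); [apply Rmult_le_compat_l; lra|].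
  replace ((t * w) ^ 2 + (2 * PI * al) ^ 2) with (t ^ 2 / 2 * (2 * w ^ 2) + al ^ 2 * (4 * PI ^ 2)) by field.
  replace (c * (t ^ 2 / 2 + al ^ 2 * q)) with (t ^ 2 / 2 * c + al ^ 2 * (c * q)) by ring.
  apply Rplus_le_compat; apply Rmult_le_compat_l; lra.
Qed.

Lemma sqrt_inv_pow X n : 0 < X -> (/ sqrt X) ^ n = Rpower X (- (INR n / 2)).
Proof.
  intros HX. rewrite <- (Rpower_sqrt X) by exact HX.
  rewrite <- Rpower_Ropp, <- Rpower_pow by (unfold Rpower; apply exp_pos).
  rewrite Rpower_mult. f_equal. field.
Qed.

Lemma Rpower_neg_mono a b s : 0 < a -> a <= b -> 0 <= s -> Rpower b (- s) <= Rpower a (- s).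
Proof.
  intros Ha Hab Hs. rewrite !Rpower_Ropp. apply Rinv_le_contravar; [unfold Rpower; apply exp_pos|].
  apply Rle_Rpower_l; lra.
Qed.

(** Taking [r = X^(-1/2)], with [X] the product bound, the estimate [r^(k+2)] splits into powers of
    exponent [(k+2)/2], which is at least 3/2. Undifferenced terms would only give [(k+1)/2], equal
    to 1 for [k = 1]. *)
Lemma diff2_rpow_dominated k w al0 : Nat.Odd k -> 0 < w -> 0 < al0 -> exists K, 0 < K /\
  forall e m, Rabs (diff2 (fun e => rpow k (INR e * w) (INR m + al0)) e)
    <= Rpower (INR e + 1) (- (INR (k + 2) / 2)) * (K * Rpower (INR m + al0) (- (INR (k + 2) / 2))).
Proof.
  intros Hk Hw Hal. destruct (lattice_lower_bound w al0 Hw Hal) as [c [Hc H]].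
  exists (2 * INR (S k) * w * Rpower c (- (INR (k + 2) / 2))). split.
  { apply Rmult_lt_0_compat; [|unfold Rpower; apply exp_pos].
    assert (0 < INR (S k)) by (apply lt_0_INR; lia). nra. }
  intros e m. assert (He := pos_INR e). assert (Hm := pos_INR m).
  set (X := c * ((INR e + 1) * (INR m + al0))).
  assert (HX1 : 0 < (INR e + 1) * (INR m + al0)) by (apply Rmult_lt_0_compat; lra).
  assert (HX : 0 < X) by (apply Rmult_lt_0_compat; lra).
  assert (Hs : 0 < sqrt X) by (apply sqrt_lt_R0; exact HX).
  eapply Rle_trans; [apply (diff2_rpow_le k w (INR m + al0) e (/ sqrt X)); auto; try lra|].
  - apply Rinv_0_lt_compat; exact Hs.
  - intros t Ht. rewrite Rinv_inv. unfold Cmod. cbn [fst snd]. apply sqrt_le_1_alt. apply H. exact Ht.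
  - rewrite sqrt_inv_pow by exact HX. unfold X. rewrite <- !Rpower_mult_distr by lra. right. ring.
Qed.

Lemma rpow_le_s k s al : (1 <= k)%nat -> 0 < al -> Rabs (rpow k s al) <= (/ (2 * PI * al)) ^ S k.
Proof.
  intros Hk Hal. assert (HP := PI_RGT_0). apply rpow_abs_le.
  - apply Rinv_0_lt_compat. nra.
  - intros E. injection E. intros E1 _. nra.
  - rewrite Rinv_inv. eapply Rle_trans; [|apply Rabs_snd_le_Cmod]. apply Rle_abs.
Qed.

Lemma ex_series_rpow k s al : (1 <= k)%nat -> 0 < al -> ex_series (fun m => rpow k s (INR m + al)).
Proof.
  intros Hk Hal. assert (HP := PI_RGT_0).
  apply (ex_series_le_R _
    (fun m => (/ (2 * PI)) ^ S k * Rpower (INR m + al) (- INR (S k)))).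
  - intros m. assert (Hm := pos_INR m). eapply Rle_trans; [apply rpow_le_s; [exact Hk|lra]|].
    rewrite Rinv_mult, Rpow_mult_distr. apply Rmult_le_compat_l; [apply pow_le; left; apply Rinv_0_lt_compat; lra|].
    rewrite Rpower_Ropp, Rpower_pow, pow_inv by lra. lra.
  - apply ex_series_scal_R. apply ex_series_Rpower; [exact Hal|].
    apply (lt_INR 1). lia.
Qed.

(** Here [q] ensures [e + 1 <= q |e w + 2 pi i al|]: the real part controls [e], the imaginary part
    controls 1. *)
Lemma rpow_lim_e k w al : (1 <= k)%nat -> 0 < w -> 0 < al -> is_lim_seq (fun e => rpow k (INR e * w) al) 0.
Proof.
  intros Hk Hw Hal. assert (HP := PI_RGT_0).
  set (q := / w + / (2 * PI * al)).
  assert (Hw' : 0 < / w) by (apply Rinv_0_lt_compat; lra).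
  assert (Hq' : 0 < / (2 * PI * al)) by (apply Rinv_0_lt_compat; nra).
  assert (Hq : 0 < q) by (unfold q; lra).
  apply is_lim_seq_abs_0. apply is_lim_seq_squeeze_0 with (w := fun e => q ^ S k * Rpower (INR e + 1) (- INR (S k))).
  - intros e. split; [apply Rabs_pos|]. assert (He := pos_INR e).
    eapply Rle_trans; [apply (rpow_abs_le k _ _ (q / (INR e + 1)))|].
    + apply Rdiv_lt_0_compat; lra.
    + intros E. injection E. intros E1 _. nra.
    + replace (/ (q / (INR e + 1))) with ((INR e + 1) / q) by (field; lra).
      apply div_le; [exact Hq|]. set (z := (INR e * w, 2 * PI * al) : C).
      assert (Z1 : INR e * w <= Cmod z) by (eapply Rle_trans; [apply Rle_abs|apply (Rabs_fst_le_Cmod z)]).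
      assert (Z2 : 2 * PI * al <= Cmod z) by (eapply Rle_trans; [apply Rle_abs|apply (Rabs_snd_le_Cmod z)]).
      assert (Y1 : INR e <= Cmod z * / w) by (apply le_div; lra).
      assert (Y2 : 1 <= Cmod z * / (2 * PI * al)) by (apply le_div; nra).
      unfold q. lra.
    + unfold Rdiv. rewrite Rpow_mult_distr. apply Rmult_le_compat_l; [apply pow_le; lra|].
      rewrite Rpower_Ropp, Rpower_pow, pow_inv by lra. lra.
  - apply is_lim_seq_scal_0. apply ex_series_lim_0, ex_series_Rpower; [lra|]. apply (lt_INR 1). lia.
Qed.

(** * Transformation of the Lambert series *)

Definition theta_pair (k : nat) (psi b : R) (n : nat) : R :=
  (INR n + psi) ^ k * exp (- (b * (INR n + psi))) + (INR n + 1 - psi) ^ k * exp (- (b * (INR n + 1 - psi))).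

Lemma ex_series_theta_pair k psi b : (1 <= k)%nat -> 0 < b -> 0 <= psi <= 1 ->
  ex_series (theta_pair k psi b).
Proof.
  intros Hk Hb Hpsi. set (z := RtoC b).
  destruct (lipschitz_formula z k psi Hb Hk) as (A1 & _ & _); [lra|].
  destruct (lipschitz_formula z k (1 - psi) Hb Hk) as (B1 & _ & _); [lra|].
  assert (Hf := INR_fact_neq_0 k).
  assert (X : forall t, t ^ k * exp (- (b * t)) = INR (fact k) * fst (pow_exp z k t))
    by (intros t; unfold z; rewrite fst_pow_exp_real; field; exact Hf).
  apply (ex_series_ext (fun n => INR (fact k) * fst (pow_exp z k (INR n + psi)) + INR (fact k) * fst (pow_exp z k (INR n + (1 - psi))))).
  - intros n. unfold theta_pair. rewrite <- !X.
    replace (INR n + (1 - psi)) with (INR n + 1 - psi) by ring. reflexivity.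
  - apply ex_series_plus_R;
    apply ex_series_scal_R; assumption.
Qed.

Lemma ex_series_pow_exp_S k r : 0 < r -> ex_series (fun n => INR (S n) ^ k * exp (- (r * INR (S n)))).
Proof.
  intros Hr. destruct (pow_exp_decay r k Hr) as [K [HK H]].
  apply (ex_series_le_R _ (fun n => K * Rpower (INR n + 1) (- 2))).
  - intros n. assert (Hn := pos_INR n). rewrite S_INR. unfold norm; simpl. unfold abs; simpl.
    rewrite Rabs_pos_eq; [apply H; lra|].
    apply Rmult_le_pos; [apply pow_le; lra|left; apply exp_pos].
  - apply ex_series_scal_R. apply ex_series_Rpower_m2; lra.
Qed.

Lemma exp_le x y : x <= y -> exp x <= exp y.
Proof. intros [H| ->]; [left; apply exp_increasing; exact H|lra]. Qed.

Definition twisted_sigma (k : nat) (theta psi : R) (n : nat) : R :=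
  divisor_sum n (fun d => INR d ^ k * cos (2 * PI * INR d * theta) * cos (2 * PI * INR n * psi / INR d)).

Lemma twisted_sigma_bound k theta psi n : (1 <= n)%nat ->
  Rabs (twisted_sigma k theta psi n) <= INR n ^ (k + 1).
Proof.
  intros Hn. unfold twisted_sigma, divisor_sum. rewrite <- sum_n_Reals.
  apply Rle_trans with (sum_n (fun _ => INR n ^ k) (n - 1)).
  - rewrite (sum_n_ext_loc _ (fun i => if Nat.leb i (n - 1) then
       (if Nat.eqb (n mod S i) 0 then INR (S i) ^ k * cos (2 * PI * INR (S i) * theta) * cos (2 * PI * INR n * psi / INR (S i)) else 0) else 0)).
    + apply sum_n_abs_le. intros i.
      assert (P : 0 <= INR n ^ k) by (apply pow_le, pos_INR).
      destruct (Nat.leb_spec i (n - 1)); [|rewrite Rabs_R0; exact P].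
      destruct (Nat.eqb (n mod S i) 0); [|rewrite Rabs_R0; exact P].
      rewrite !Rabs_mult.
      assert (C1 : Rabs (cos (2 * PI * INR (S i) * theta)) <= 1) by apply Rabs_le, COS_bound.
      assert (C2 : Rabs (cos (2 * PI * INR n * psi / INR (S i))) <= 1) by apply Rabs_le, COS_bound.
      assert (C3 : Rabs (INR (S i) ^ k) <= INR n ^ k).
      { rewrite Rabs_pos_eq by apply pow_le, pos_INR. apply pow_incr. split; [apply pos_INR|apply le_INR; lia]. }
      rewrite <- (Rmult_1_r (INR n ^ k)). apply Rmult_le_compat; auto using Rabs_pos.
      { apply Rmult_le_pos; apply Rabs_pos. }
      rewrite <- (Rmult_1_r (INR n ^ k)). apply Rmult_le_compat; auto using Rabs_pos.
    + intros i Hi. destruct (Nat.leb_spec i (n - 1)); [reflexivity|lia].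
  - rewrite sum_n_const. replace (S (n - 1)) with n by lia. rewrite pow_add. simpl. lra.
Qed.

Lemma Series_finite_support (u : nat -> R) N : (forall n, (N < n)%nat -> u n = 0) -> Series u = sum_n u N.
Proof.
  intros H. apply is_series_unique. change (is_lim_seq (sum_n u) (sum_n u N)).
  apply is_lim_seq_ext_loc with (u := fun _ => sum_n u N); [|apply is_lim_seq_const].
  exists N. intros n Hn. induction Hn as [|n Hn IH]; [reflexivity|].
  rewrite sum_Sn_R, <- IH, H by lia. symmetry. apply Rplus_0_r.
Qed.

(** The sum starts at [n = 0], where the term vanishes for [k >= 1], to match the Lipschitz
    formula. *)
Definition lambert_cos (k : nat) (theta s : R) : R :=
  Series (fun n => INR n ^ k * (exp (- (s * INR n)) * cos (2 * PI * INR n * theta))).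

Lemma lambert_cos_shift k theta s : (1 <= k)%nat -> 0 < s ->
  lambert_cos k theta s =
  Series (fun i => INR (S i) ^ k * (exp (- (s * INR (S i))) * cos (2 * PI * INR (S i) * theta))).
Proof.
  intros Hk Hs. unfold lambert_cos. rewrite Series_incr_1 by apply (lipschitz_at_0 k s theta Hk Hs).
  simpl INR. rewrite pow_i by lia. ring.
Qed.

(** The pairs [(d, n)] with [d | n] are summed in both orders: fixing [n] gives the divisor sum,
    fixing [d] and writing [n = d q] gives a sum over the cofactor [q]. For integers at least 1,
    [d q >= (d + q)/2], and likewise [n >= (d + n)/2], so the exponential splits into a product
    majorant. *)
Lemma lambert_divisor k theta psi w : (1 <= k)%nat -> 0 < w ->
  is_series (fun j => twisted_sigma k theta psi (S j) * exp (- (INR (S j) * w)))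
    (Series (fun l => cos (2 * PI * INR (S l) * psi) * lambert_cos k theta (INR (S l) * w))).
Proof.
  intros Hk Hw.
  set (A := fun i => INR (S i) ^ k * exp (- (w / 2 * INR (S i)))).
  set (B := fun j => INR (S j) ^ 0 * exp (- (w / 2 * INR (S j)))).
  assert (HA : ex_series A) by (apply ex_series_pow_exp_S; lra).
  assert (HB : ex_series B) by (apply ex_series_pow_exp_S; lra).
  assert (HA0 : forall i, 0 <= A i).
  { intros i. unfold A. apply Rmult_le_pos; [apply pow_le, pos_INR|left; apply exp_pos]. }
  assert (HB0 : forall i, 0 <= B i).
  { intros i. unfold B. apply Rmult_le_pos; [apply pow_le, pos_INR|left; apply exp_pos]. }
  assert (HAB : forall i j x c1 c2, Rabs c1 <= 1 -> Rabs c2 <= 1 -> (INR (S i) + INR (S j)) / 2 <= x ->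
     Rabs (INR (S i) ^ k * c1 * c2 * exp (- (x * w))) <= A i * B j).
  { intros i j x c1 c2 H1 H2 Hx. rewrite !Rabs_mult, (Rabs_pos_eq (exp _)) by (left; apply exp_pos).
    rewrite (Rabs_pos_eq (INR (S i) ^ k)) by apply pow_le, pos_INR.
    unfold A, B.
    replace (INR (S i) ^ k * exp (- (w / 2 * INR (S i))) * (INR (S j) ^ 0 * exp (- (w / 2 * INR (S j)))))
      with (INR (S i) ^ k * exp (- (w / 2 * INR (S i)) + - (w / 2 * INR (S j)))) by (rewrite exp_plus; simpl; ring).
    assert (P : 0 <= INR (S i) ^ k) by apply pow_le, pos_INR.
    apply Rmult_le_compat.
    - apply Rmult_le_pos; [|apply Rabs_pos]. apply Rmult_le_pos; [exact P|apply Rabs_pos].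
    - left; apply exp_pos.
    - rewrite <- (Rmult_1_r (INR (S i) ^ k)) at 2. rewrite Rmult_assoc. apply Rmult_le_compat_l; [exact P|].
      rewrite <- (Rmult_1_r 1). apply Rmult_le_compat; auto using Rabs_pos.
    - apply exp_le. nra. }
  set (g := fun i q => INR (S i) ^ k * cos (2 * PI * INR (S i) * theta) * cos (2 * PI * INR q * psi) * exp (- (INR (S i) * INR q * w))).
  (* [S i] is the divisor and [S j] its multiple; [g i] is evaluated at the cofactor. *)
  set (b := fun i j => if Nat.eqb (S j mod S i) 0 then g i (S j / S i)%nat else 0).
  assert (Hb : forall i j, Rabs (b i j) <= A i * B j).
  { intros i j. unfold b. destruct (Nat.eqb_spec (S j mod S i) 0) as [E|E].
    - assert (D : (S j = S i * (S j / S i))%nat) by (apply Nat.Div0.div_exact; exact E).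
      unfold g. apply HAB; try (apply Rabs_le, COS_bound). rewrite <- mult_INR, <- D.
      assert (INR (S i) <= INR (S j)) by (apply le_INR; destruct (S j / S i)%nat; nia). lra.
    - rewrite Rabs_R0. apply Rmult_le_pos; auto. }
  assert (Hg : forall i l, Rabs (g i (S l)) <= A i * B l).
  { intros i l. unfold g. apply HAB; try (apply Rabs_le, COS_bound).
    rewrite !S_INR. generalize (pos_INR i) (pos_INR l). nra. }
  assert (Hcol : forall j, Series (fun i => b i j) = twisted_sigma k theta psi (S j) * exp (- (INR (S j) * w))).
  { intros j. rewrite (Series_finite_support _ j).
    - unfold twisted_sigma, divisor_sum. rewrite <- sum_n_Reals, <- sum_n_Rmult_r.
      replace (S j - 1)%nat with j by lia. apply sum_n_ext. intros i. unfold b, g.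
      destruct (Nat.eqb_spec (S j mod S i) 0) as [E|E]; [|rewrite Rmult_0_l; reflexivity].
      assert (D : (S j = S i * (S j / S i))%nat) by (apply Nat.Div0.div_exact; exact E).
      assert (N : INR (S i) <> 0) by (apply not_0_INR; lia).
      rewrite D at 3 4. rewrite mult_INR. f_equal. f_equal. f_equal. field. exact N.
    - intros n Hn. unfold b. rewrite Nat.mod_small by lia. reflexivity. }
  assert (Hrow : forall i, Series (b i) = Series (fun l => g i (S l))).
  { intros i. apply (Series_multiples (S i) (g i)); [lia|].
    apply (dominated_ex_inner b A B i Hb HB). }
  assert (T1 := dominated_switch b A B Hb HA HB).
  assert (T2 := dominated_switch (fun i l => g i (S l)) A B Hg HA HB).
  assert (Ex : ex_series (fun j => Series (fun i => b i j))).
  { apply (dominated_ex_outer (fun j i => b i j) B A); auto.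
    intros m n. rewrite Rmult_comm. apply Hb. }
  replace (Series (fun l => cos (2 * PI * INR (S l) * psi) * lambert_cos k theta (INR (S l) * w)))
    with (Series (fun j => Series (fun i => b i j))).
  - eapply is_series_ext; [exact Hcol|]. apply Series_correct. exact Ex.
  - rewrite <- T1. etransitivity; [apply Series_ext; exact Hrow|]. rewrite T2.
    apply Series_ext. intros l.
    rewrite lambert_cos_shift; [|exact Hk|apply Rmult_lt_0_compat; [apply lt_0_INR; lia|lra]].
    rewrite <- Series_scal_l. apply Series_ext. intros i. unfold g.
    replace (INR (S l) * w * INR (S i)) with (INR (S i) * INR (S l) * w) by ring. ring.
Qed.

(** A geometric factor splits off because [(l + 1)(i + 1) >= l + (i + 1)]. *)
Lemma lambert_cos_lim k theta w : (1 <= k)%nat -> 0 < w ->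
  is_lim_seq (fun l => lambert_cos k theta (INR (S l) * w)) 0.
Proof.
  intros Hk Hw.
  set (v := fun i => INR (S i) ^ k * exp (- (w * INR (S i)))).
  assert (Hv : ex_series v) by (apply ex_series_pow_exp_S; exact Hw).
  apply is_lim_seq_abs_0. apply is_lim_seq_squeeze_0 with (w := fun l => Series v * (exp (- w)) ^ l).
  - intros l. split; [apply Rabs_pos|]. assert (Hl := pos_INR l).
    rewrite lambert_cos_shift; [|exact Hk|apply Rmult_lt_0_compat; [apply lt_0_INR; lia|lra]].
    replace (Series v * exp (- w) ^ l) with (Series (fun i => exp (- w) ^ l * v i)) by (rewrite Series_scal_l; ring).
    apply Series_abs_le.
    + intros i. rewrite !Rabs_mult, (Rabs_pos_eq (exp _)), (Rabs_pos_eq (INR (S i) ^ k)) by (try apply pow_le, pos_INR; left; apply exp_pos).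
      unfold v. assert (P : 0 <= INR (S i) ^ k) by apply pow_le, pos_INR.
      replace (exp (- w) ^ l * (INR (S i) ^ k * exp (- (w * INR (S i)))))
        with (INR (S i) ^ k * (exp (- (w * INR (S i))) * exp (- w) ^ l)) by ring.
      apply Rmult_le_compat_l; [exact P|].
      assert (C1 : Rabs (cos (2 * PI * INR (S i) * theta)) <= 1) by apply Rabs_le, COS_bound.
      apply Rle_trans with (exp (- (INR (S l) * w * INR (S i))) * 1).
      { apply Rmult_le_compat_l; [left; apply exp_pos|exact C1]. }
      rewrite Rmult_1_r. replace (exp (- w) ^ l) with (exp (- (INR l * w))).
      2:{ rewrite <- Rpower_pow by apply exp_pos. unfold Rpower. rewrite ln_exp. f_equal. ring. }
      rewrite <- exp_plus. apply exp_le. rewrite !S_INR. assert (Hi := pos_INR i).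
      assert (0 <= INR l * INR i * w) by (apply Rmult_le_pos; [apply Rmult_le_pos|]; lra). nra.
    + apply ex_series_scal_R. exact Hv.
  - apply is_lim_seq_scal_0. apply is_lim_seq_geom.
    rewrite Rabs_pos_eq by (left; apply exp_pos). rewrite <- exp_0. apply exp_increasing. lra.
Qed.

(** The lattice sum of [g e m] is evaluated in two ways. Row [e >= 1] is [lambert_cos] divided by
    [k!], and row 0 gives the zeta values. Each column is a Lipschitz sum after [rpow_transfer]. As
    rows with [e >= 1] have weight 2, solving for the Lambert sum multiplies everything by [k!/2];
    hence the constants [k!/2] and [1/4 = (k!/2) / (2 k!)]. *)
Lemma theta_transformation k theta psi w : Nat.Odd k -> 0 < theta < 1 -> 0 < psi < 1 -> 0 < w ->
  Series (fun l => cos (2 * PI * INR (S l) * psi) * lambert_cos k theta (INR (S l) * w))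
  = - (INR (fact k) / 2) * ((-1) ^ ((k + 1) / 2) / (2 * PI) ^ (k + 1) *
       (hurwitz_zeta (INR k + 1) theta + hurwitz_zeta (INR k + 1) (1 - theta)))
    + / 4 * ((-1) ^ ((k + 1) / 2) * (2 * PI / w) ^ (k + 1)) *
      Series (fun m => Series (fun n => theta_pair k psi (4 * PI ^ 2 * (INR m + theta) / w) n
                                      + theta_pair k psi (4 * PI ^ 2 * (INR m + (1 - theta)) / w) n)).
Proof.
  intros Hodd Hth Hpsi Hw. assert (HP := PI_RGT_0).
  assert (Hk : (1 <= k)%nat) by (destruct Hodd; lia).
  assert (Hf := INR_fact_neq_0 k).
  set (phi := 2 * PI * psi).
  (* [psi] keeps a positive distance from both 0 and 1; that distance, cut off at 1/4, bounds the
     cosine away from 1. *)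
  assert (Hphi : cos phi <> 1).
  { assert (cos phi <= cos (2 * PI * Rmin (1 / 4) (Rmin psi (1 - psi)))).
    { apply cos_2PI_far; unfold Rmin; repeat destruct Rle_dec; lra. }
    assert (cos (2 * PI * Rmin (1 / 4) (Rmin psi (1 - psi))) < cos 0).
    { assert (0 < Rmin (1 / 4) (Rmin psi (1 - psi)) <= 1 / 4) by (unfold Rmin; repeat destruct Rle_dec; lra).
      apply cos_decreasing_1; nra. }
    rewrite cos_0 in H0. lra. }
  set (g := fun e m => rpow k (INR e * w) (INR m + theta) + rpow k (INR e * w) (INR m + (1 - theta))).
  destruct (diff2_rpow_dominated k w theta Hodd Hw) as [K1 [HK1 D1]]; [lra|].
  destruct (diff2_rpow_dominated k w (1 - theta) Hodd Hw) as [K2 [HK2 D2]]; [lra|].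
  set (s := INR (k + 2) / 2) in *.
  assert (Hs : 1 < s). { unfold s. assert (3 <= INR (k + 2)) by (replace 3 with (INR 3) by (simpl; ring); apply le_INR; lia). lra. }
  assert (HG : forall e, ex_series (g e)).
  { intros e. apply ex_series_plus_R; apply ex_series_rpow; auto; lra. }
  assert (HF : forall l, lambert_cos k theta (INR (S l) * w) = INR (fact k) * Series (g (S l))).
  { intros l. assert (0 < INR (S l) * w) by (apply Rmult_lt_0_compat; [apply lt_0_INR; lia|lra]).
    unfold lambert_cos. rewrite (proj2 (lipschitz_at_0 k _ theta Hk H)). f_equal. apply Series_ext.
    intros n. unfold g. f_equal. f_equal. ring. }
  assert (SW : is_series (fun e => wt e * (cos (INR e * phi) * Series (g e)))
    (Series (fun m => Series (fun e => wt e * (cos (INR e * phi) * g e m))))).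
  { apply (cos_series_switch g phi (fun e => Rpower (INR e + 1) (- s))
      (fun m => K1 * Rpower (INR m + theta) (- s) + K2 * Rpower (INR m + (1 - theta)) (- s))); auto.
    - intros e m. replace (diff2 (fun e0 => g e0 m) e) with
        (diff2 (fun e => rpow k (INR e * w) (INR m + theta)) e + diff2 (fun e => rpow k (INR e * w) (INR m + (1 - theta))) e)
        by (unfold diff2, g; destruct e; ring).
      eapply Rle_trans; [apply Rabs_triang|]. specialize (D1 e m). specialize (D2 e m). lra.
    - intros e. unfold Rpower. left; apply exp_pos.
    - intros m. assert (0 < Rpower (INR m + theta) (- s)) by (unfold Rpower; apply exp_pos).
      assert (0 < Rpower (INR m + (1 - theta)) (- s)) by (unfold Rpower; apply exp_pos). nra.
    - apply ex_series_Rpower; lra.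
    - apply ex_series_plus_R;
      apply ex_series_scal_R; apply ex_series_Rpower; lra.
    - intros m. assert (Hm := pos_INR m). unfold g. apply is_lim_seq_plus_0; apply rpow_lim_e; auto; lra.
    - apply is_lim_seq_incr_1. apply is_lim_seq_ext with (u := fun l => / INR (fact k) * lambert_cos k theta (INR (S l) * w)).
      + intros l. rewrite HF. field. exact Hf.
      + apply is_lim_seq_scal_0. apply lambert_cos_lim; assumption. }
  assert (HL := is_series_unique _ _ SW).
  rewrite Series_incr_1 in HL by (eexists; exact SW).
  set (sg := (-1) ^ ((k + 1) / 2)) in *.
  assert (G0 : Series (g O) = sg / (2 * PI) ^ (k + 1) * (hurwitz_zeta (INR k + 1) theta + hurwitz_zeta (INR k + 1) (1 - theta))).
  { unfold hurwitz_zeta, g. rewrite <- Series_plus by (apply ex_series_Rpower; try lra;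
      assert (1 <= INR k) by (apply (le_INR 1); exact Hk); lra).
    rewrite <- Series_scal_l. apply Series_ext. intros m. assert (Hm := pos_INR m).
    simpl INR. rewrite Rmult_0_l, !rpow_0 by (auto; lra). fold sg. ring. }
  assert (Hpos4 : 0 < 4 * PI ^ 2) by (assert (0 < PI ^ 2) by (apply pow_lt; lra); lra).
  assert (Hin : forall al, 0 < al -> is_series (fun e => wt e * (cos (INR e * phi) * rpow k (INR e * w) al))
     (sg * (2 * PI / w) ^ (k + 1) * (/ 2 * / INR (fact k) * Series (theta_pair k psi (4 * PI ^ 2 * al / w))))).
  { intros al Hal.
    assert (Hb : 0 < 4 * PI ^ 2 * al / w) by (apply Rdiv_lt_0_compat; [apply Rmult_lt_0_compat|]; lra).
    assert (T := lipschitz_cos k _ psi Hk Hb ltac:(lra)).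
    apply (is_series_scal (K := R_AbsRing) (V := R_NormedModule) (sg * (2 * PI / w) ^ (k + 1))) in T.
    eapply is_series_ext; [|exact T]. intros e. cbv beta. unfold scal; simpl; unfold mult; simpl.
    rewrite (rpow_transfer k w (INR e) al Hodd Hw) by lra. fold sg.
    replace (2 * PI * INR e * psi) with (INR e * phi) by (unfold phi; ring).
    R_eq. simpl. ring. }
  assert (Hm2 : forall m, Series (fun e => wt e * (cos (INR e * phi) * g e m)) =
     sg * (2 * PI / w) ^ (k + 1) * (/ 2 * / INR (fact k)) *
      Series (fun n => theta_pair k psi (4 * PI ^ 2 * (INR m + theta) / w) n
                                      + theta_pair k psi (4 * PI ^ 2 * (INR m + (1 - theta)) / w) n)).
  { intros m. assert (Hm := pos_INR m).
    assert (T1 := Hin (INR m + theta) ltac:(lra)). assert (T2 := Hin (INR m + (1 - theta)) ltac:(lra)).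
    assert (T := is_series_plus (K := R_AbsRing) (V := R_NormedModule) _ _ _ _ T1 T2).
    assert (T' : is_series (fun e => wt e * (cos (INR e * phi) * g e m))
      (sg * (2 * PI / w) ^ (k + 1) * (/ 2 * / INR (fact k) * Series (theta_pair k psi (4 * PI ^ 2 * (INR m + theta) / w)))
       + sg * (2 * PI / w) ^ (k + 1) * (/ 2 * / INR (fact k) * Series (theta_pair k psi (4 * PI ^ 2 * (INR m + (1 - theta)) / w))))).
    { eapply is_series_ext; [|exact T]. intros e. unfold g, plus; simpl. R_eq. ring. }
    rewrite (is_series_unique _ _ T'), Series_plus.
    2,3: apply ex_series_theta_pair; try lra; auto; apply Rdiv_lt_0_compat; [apply Rmult_lt_0_compat|]; lra.
    R_eq. ring. }
  rewrite (Series_ext _ _ Hm2), Series_scal_l in HL.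
  assert (HS : Series (fun n => wt (S n) * (cos (INR (S n) * phi) * Series (g (S n))))
     = 2 / INR (fact k) * Series (fun l => cos (2 * PI * INR (S l) * psi) * lambert_cos k theta (INR (S l) * w))).
  { rewrite <- Series_scal_l. apply Series_ext. intros l. rewrite HF.
    replace (2 * PI * INR (S l) * psi) with (INR (S l) * phi) by (unfold phi; ring). unfold wt. field. exact Hf. }
  rewrite HS, G0 in HL. change (INR 0) with 0 in HL. clear SW HS. rewrite Rmult_0_l, cos_0 in HL. unfold wt in HL.
  set (SS := Series (fun l => cos (2 * PI * INR (S l) * psi) * lambert_cos k theta (INR (S l) * w))) in *.
  set (Q := Series (fun m => Series (fun n => theta_pair k psi (4 * PI ^ 2 * (INR m + theta) / w) n
                                      + theta_pair k psi (4 * PI ^ 2 * (INR m + (1 - theta)) / w) n))) in *. set (Zt := hurwitz_zeta _ _ + _) in *.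
  set (P := (2 * PI / w) ^ (k + 1)) in *. set (P' := (2 * PI) ^ (k + 1)) in *.
  assert (E : 2 / INR (fact k) * SS = sg * P * (/ 2 * / INR (fact k)) * Q - 1 * (1 * (sg / P' * Zt))) by lra.
  replace SS with (INR (fact k) / 2 * (2 / INR (fact k) * SS)) by (field; exact Hf).
  rewrite E. field. split; [unfold P'; apply pow_nonzero; lra|exact Hf].
Qed.

(** * Improper complex integrals *)

Definition cint (f : R -> C) (l : C) : Prop :=
  is_RInt_gen (V := C_R_NormedModule) f (at_right 0) (Rbar_locally p_infty) l.

Lemma cint_unique f l : cint f l -> cint0inf f = l.
Proof.
  intros H. unfold cint0inf.
  apply (is_RInt_gen_unique (V := C_R_CompleteNormedModule)). exact H.
Qed.

Lemma norm_C_Cmod (z : C) : norm (V := C_R_NormedModule) z = Cmod z.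
Proof. symmetry. apply Cmod_norm. Qed.

Lemma locally_C (l : C) (P : C -> Prop) :
  locally (T := C_R_NormedModule) l P <-> exists eps : posreal, forall y, Cmod (Cminus y l) < eps -> P y.
Proof.
  split.
  - intros H. apply (locally_norm_le_locally (V := C_R_NormedModule) l P) in H.
    destruct H as [eps H]. exists eps. intros y Hy. apply H. unfold ball_norm.
    rewrite norm_C_Cmod. exact Hy.
  - intros [eps H]. apply (locally_le_locally_norm (V := C_R_NormedModule) l P).
    exists eps. intros y Hy. apply H. unfold ball_norm in Hy. rewrite norm_C_Cmod in Hy. exact Hy.
Qed.

(** Unfolds the product filter: the two limits of integration move independently, and the integral
    over each such segment must exist. Later substitutions are carried out on these segments. *)
Lemma cint_iff f l : cint f l <->
  (forall eps, 0 < eps -> exists d M, 0 < d /\ forall a b, 0 < a < d -> M < b ->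
     exists y, is_RInt_complex f a b y /\ Cmod (Cminus y l) < eps).
Proof.
  split.
  - intros H eps He.
    assert (HL : locally (T := C_R_NormedModule) l (fun y : C => Cmod (Cminus y l) < eps)).
    { apply locally_C. exists (mkposreal _ He). intros y Hy. exact Hy. }
    destruct (H _ HL) as [Q R0 [d HQ] [M HR] HP].
    exists d, M. split; [apply cond_pos|]. intros a b Ha Hb.
    apply (HP a b).
    + apply HQ; [|lra]. apply ball_R_intro. rewrite Rabs_pos_eq; lra.
    + apply HR. exact Hb.
  - intros H P HP. apply locally_C in HP. destruct HP as [eps HP].
    destruct (H eps (cond_pos eps)) as (d & M & Hd & HM).
    apply (Filter_prod _ _ _ (fun a => 0 < a < d) (fun b => M < b)).
    + exists (mkposreal _ Hd). intros y Hy Hy0. apply ball_R_elim in Hy; simpl in Hy.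
      apply Rabs_def2 in Hy. lra.
    + exists M. auto.
    + intros a b Ha Hb. destruct (HM a b Ha Hb) as [y [Hy1 Hy2]]. exists y. split; [exact Hy1|]. apply HP. exact Hy2.
Qed.

Definition ccont (f : R -> C) : Prop := forall u, 0 < u ->
  continuous (fun t => fst (f t)) u /\ continuous (fun t => snd (f t)) u.

Definition CRInt (f : R -> C) (a b : R) : C := (RInt (fun t => fst (f t)) a b, RInt (fun t => snd (f t)) a b).

Lemma CRInt_correct f a b : ccont f -> 0 < a -> 0 < b ->
  is_RInt_complex f a b (CRInt f a b).
Proof.
  intros Hf Ha Hb. assert (Hm : 0 < Rmin a b) by (apply Rmin_glb_lt; assumption).
  apply is_RInt_C; simpl; apply (RInt_correct (V := R_CompleteNormedModule)),
    (ex_RInt_continuous (V := R_CompleteNormedModule)); intros z Hz; apply Hf; lra.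
Qed.

Lemma is_RInt_C_unique f a b l m : is_RInt_complex f a b l ->
  is_RInt_complex f a b m -> l = m.
Proof.
  intros H1 H2. apply (is_RInt_unique (V := C_R_CompleteNormedModule)) in H1.
  apply (is_RInt_unique (V := C_R_CompleteNormedModule)) in H2. rewrite <- H1, <- H2. reflexivity.
Qed.

Lemma cint_ext f g l : (forall u, 0 < u -> f u = g u) -> cint f l -> cint g l.
Proof.
  intros E H. apply cint_iff. intros eps He. destruct (proj1 (cint_iff f l) H eps He) as (d & M & Hd & HM).
  exists d, (Rmax M 0). split; [exact Hd|]. intros a b Ha Hb.
  assert (M < b) by (generalize (Rmax_l M 0); lra). assert (0 < b) by (generalize (Rmax_r M 0); lra).
  destruct (HM a b Ha H0) as [y [Hy1 Hy2]]. exists y. split; [|exact Hy2].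
  eapply is_RInt_ext; [|exact Hy1]. intros x Hx. apply E.
  assert (0 < Rmin a b) by (apply Rmin_glb_lt; lra). lra.
Qed.

Lemma cint_plus f g l m : cint f l -> cint g m -> cint (fun u => Cplus (f u) (g u)) (Cplus l m).
Proof. intros H1 H2. exact (is_RInt_gen_plus (V := C_R_NormedModule) f g l m H1 H2). Qed.

Lemma cint_scal (c : C) f l : cint f l -> cint (fun u => Cmult c (f u)) (Cmult c l).
Proof.
  intros H. apply cint_iff. intros eps He.
  assert (Hc : 0 <= Cmod c) by apply Cmod_ge_0.
  destruct (proj1 (cint_iff f l) H (eps / (Cmod c + 1))) as (d & M & Hd & HM).
  { apply Rdiv_lt_0_compat; lra. }
  exists d, M. split; [exact Hd|]. intros a b Ha Hb. destruct (HM a b Ha Hb) as [y [Hy1 Hy2]].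
  exists (Cmult c y). split; [apply is_RInt_C_scal; exact Hy1|].
  replace (Cminus (Cmult c y) (Cmult c l)) with (Cmult c (Cminus y l)) by ring. rewrite Cmod_mult.
  assert (H0 := Cmod_ge_0 (Cminus y l)).
  apply Rle_lt_trans with ((Cmod c) * (eps / (Cmod c + 1))); [apply Rmult_le_compat_l; lra|].
  replace (Cmod c * (eps / (Cmod c + 1))) with (eps - eps / (Cmod c + 1)) by (field; lra).
  assert (0 < eps / (Cmod c + 1)) by (apply Rdiv_lt_0_compat; lra). lra.
Qed.

Lemma CRInt_norm_le f (G g : R -> R) a b : ccont f -> 0 < a -> a <= b ->
  (forall u, 0 < u -> is_derive G u (g u)) -> (forall u, 0 < u -> continuous g u) ->
  (forall u, 0 < u -> Cmod (f u) <= g u) -> Cmod (CRInt f a b) <= G b - G a.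
Proof.
  intros Hf Ha Hab HG Hg Hfg.
  assert (H1 := CRInt_correct f a b Hf Ha ltac:(lra)).
  assert (H2 : is_RInt g a b (minus (G b) (G a))).
  { apply (is_RInt_derive (V := R_CompleteNormedModule)); intros x Hx; rewrite Rmin_left, Rmax_right in Hx by lra;
    [apply HG|apply Hg]; lra. }
  rewrite <- norm_C_Cmod.
  refine (norm_RInt_le (V := C_R_NormedModule) f g a b _ _ Hab _ H1 H2).
  intros x Hx. rewrite norm_C_Cmod. apply Hfg. lra.
Qed.

Lemma CRInt_Chasles f a b c : ccont f -> 0 < a -> 0 < b -> 0 < c ->
  Cplus (CRInt f a b) (CRInt f b c) = CRInt f a c.
Proof.
  intros Hf Ha Hb Hc. apply (is_RInt_C_unique f a c); [|apply CRInt_correct; assumption].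
  exact (is_RInt_Chasles (V := C_R_NormedModule) f a b c _ _ (CRInt_correct f a b Hf Ha Hb) (CRInt_correct f b c Hf Hb Hc)).
Qed.

Lemma CRInt_point f a : ccont f -> 0 < a -> CRInt f a a = RtoC 0.
Proof. intros _ _. unfold CRInt. rewrite !RInt_point. reflexivity. Qed.

(** The absolute value allows the endpoints in either order, as they occur in the Cauchy criterion
    below. *)
Lemma CRInt_norm_le_abs f (G g : R -> R) a b : ccont f -> 0 < a -> 0 < b ->
  (forall u, 0 < u -> is_derive G u (g u)) -> (forall u, 0 < u -> continuous g u) ->
  (forall u, 0 < u -> Cmod (f u) <= g u) -> Cmod (CRInt f a b) <= Rabs (G b - G a).
Proof.
  intros Hf Ha Hb HG Hg Hfg. destruct (Rle_dec a b) as [Hab|Hab].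
  - eapply Rle_trans; [apply (CRInt_norm_le f G g); assumption|apply Rle_abs].
  - assert (E : CRInt f a b = Copp (CRInt f b a)).
    { assert (T := CRInt_Chasles f a b a Hf Ha Hb Ha). rewrite CRInt_point in T by assumption.
      replace (CRInt f a b) with (Cminus (Cplus (CRInt f a b) (CRInt f b a)) (CRInt f b a)) by ring.
      rewrite T. ring. }
    rewrite E, Cmod_opp, Rabs_minus_sym.
    eapply Rle_trans; [apply (CRInt_norm_le f G g); try assumption; lra|apply Rle_abs].
Qed.

(** Two integrals over large segments differ by a piece near 0 and a piece near infinity, each
    bounded by an increment of [G]. Finite limits of [G] at both ends thus give the Cauchy
    criterion. *)
Lemma cint_exists f (G g : R -> R) l0 l1 : ccont f ->
  (forall u, 0 < u -> is_derive G u (g u)) -> (forall u, 0 < u -> continuous g u) ->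
  (forall u, 0 < u -> Cmod (f u) <= g u) ->
  filterlim G (at_right 0) (locally l0) -> filterlim G (Rbar_locally p_infty) (locally l1) ->
  exists l, cint f l.
Proof.
  intros Hf HG Hg Hfg H0 H1.
  assert (Hcauchy : exists l : C_R_CompleteNormedModule, filterlim (fun ab : R * R => (CRInt f (fst ab) (snd ab) : C_R_CompleteNormedModule))
     (filter_prod (at_right 0) (Rbar_locally p_infty)) (locally l)).
  { apply (proj1 (filterlim_locally_cauchy (U := C_R_CompleteNormedModule)
      (F := filter_prod (at_right 0) (Rbar_locally p_infty)) (fun ab : R * R => CRInt f (fst ab) (snd ab)))). intros eps.
    assert (He : 0 < eps / 4) by (assert (H := cond_pos eps); lra).
    assert (B0 := proj1 (filterlim_locally _ _) H0 (mkposreal _ He)).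
    assert (B1 := proj1 (filterlim_locally _ _) H1 (mkposreal _ He)).
    exists (fun ab => (0 < fst ab /\ Rabs (G (fst ab) - l0) < eps / 4) /\ (0 < snd ab /\ Rabs (G (snd ab) - l1) < eps / 4)).
    split.
    - apply (Filter_prod _ _ _ (fun a => 0 < a /\ Rabs (G a - l0) < eps / 4) (fun b => 0 < b /\ Rabs (G b - l1) < eps / 4)).
      + apply filter_and; [|exact B0]. exists (mkposreal _ Rlt_0_1). auto.
      + apply filter_and; [|exact B1]. exists 0. auto.
      + auto.
    - intros [a b] [a' b'] [[A1 A2] [A3 A4]] [[C1 C2] [C3 C4]]. simpl in *.
      apply (norm_compat1 (V := C_R_NormedModule)).
      change (norm (V := C_R_NormedModule) (Cminus (CRInt f a' b') (CRInt f a b)) < eps).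
      rewrite norm_C_Cmod.
      replace (Cminus (CRInt f a' b') (CRInt f a b)) with (Cplus (CRInt f a' a) (CRInt f b b')).
      2:{ rewrite <- (CRInt_Chasles f a' a b') by assumption. rewrite <- (CRInt_Chasles f a b b') by assumption. ring. }
      eapply Rle_lt_trans; [apply Cmod_triangle|].
      assert (D1 := CRInt_norm_le_abs f G g a' a Hf C1 A1 HG Hg Hfg).
      assert (D2 := CRInt_norm_le_abs f G g b b' Hf A3 C3 HG Hg Hfg).
      apply Rabs_def2 in A2. apply Rabs_def2 in A4. apply Rabs_def2 in C2. apply Rabs_def2 in C4.
      assert (Rabs (G a - G a') < eps / 2) by (apply Rabs_def1; lra).
      assert (Rabs (G b' - G b) < eps / 2) by (apply Rabs_def1; lra). lra. }
  destruct Hcauchy as [l Hl]. exists l. intros P HP.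
  assert (T := Hl P HP). unfold filtermap in T.
  assert (Hpos : filter_prod (at_right 0) (Rbar_locally p_infty) (fun ab : R * R => 0 < fst ab /\ 0 < snd ab)).
  { apply (Filter_prod _ _ _ (fun a => 0 < a) (fun b => 0 < b)).
    - exists (mkposreal _ Rlt_0_1). auto.
    - exists 0. auto.
    - auto. }
  unfold filtermapi. generalize (filter_and _ _ T Hpos). apply filter_imp. intros ab [K1 [K2 K3]].
  eexists. split; [apply (CRInt_correct f (fst ab) (snd ab) Hf K2 K3)|exact K1].
Qed.

(* An integrable majorant of [u^(s-1) e^(-c u)], with the explicit antiderivative [DomG s]; its total mass is 1. *)
Definition Dom (s u : R) : R := s * Rpower u (s - 1) / (1 + Rpower u s) ^ 2.
Definition DomG (s u : R) : R := - / (1 + Rpower u s).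

Lemma Rpower_pos x y : 0 < Rpower x y.
Proof. unfold Rpower. apply exp_pos. Qed.

Lemma is_derive_Rpower s u : 0 < u -> is_derive (fun u => Rpower u s) u (s * Rpower u (s - 1)).
Proof. intros Hu. apply is_derive_Reals. apply derivable_pt_lim_power. exact Hu. Qed.

Lemma is_derive_DomG s u : 0 < u -> is_derive (DomG s) u (Dom s u).
Proof.
  intros Hu. unfold DomG, Dom. assert (H := is_derive_Rpower s u Hu).
  assert (HR := Rpower_pos u s).
  assert (T : is_derive (fun x => - / (1 + x)) (Rpower u s) (/ (1 + Rpower u s) ^ 2)).
  { auto_derive; [lra|]. field. lra. }
  assert (T' := is_derive_comp (fun x => - / (1 + x)) (fun u => Rpower u s) u _ _ T H).
  eapply is_derive_eq; [exact T'|]. unfold scal; simpl; unfold mult; simpl. field. lra.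
Qed.

Lemma continuous_Rpower s u : 0 < u -> continuous (fun u => Rpower u s) u.
Proof.
  intros Hu. apply ex_derive_continuous_R.
  eexists. apply is_derive_Rpower. exact Hu.
Qed.

Lemma continuous_Dom s u : 0 < u -> continuous (Dom s) u.
Proof.
  intros Hu. assert (HR := Rpower_pos u s). unfold Dom, Rdiv.
  apply continuous_mult_R.
  - apply continuous_mult_R; [apply continuous_const|apply continuous_Rpower; exact Hu].
  - apply (continuous_comp (fun u => Rpower u s) (fun x => / (1 + x) ^ 2)); [apply continuous_Rpower; exact Hu|].
    apply ex_derive_continuous_R. auto_derive. 
    assert (0 < (1 + Rpower u s) ^ 2) by (apply pow_lt; lra). simpl in *. lra.
Qed.

Lemma DomG_lim_0 s : 0 < s -> filterlim (DomG s) (at_right 0) (locally (- 1)).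
Proof.
  intros Hs. apply filterlim_locally. intros eps. assert (He := cond_pos eps).
  assert (Hd : 0 < Rpower eps (/ s)) by apply Rpower_pos.
  exists (mkposreal _ Hd). intros y Hy Hy0.
  apply ball_R_intro. apply ball_R_elim in Hy; simpl in Hy.
  rewrite Rminus_0_r, Rabs_pos_eq in Hy by lra. unfold DomG.
  assert (HR := Rpower_pos y s).
  assert (Hlt : Rpower y s < eps).
  { replace (pos eps) with (Rpower (Rpower eps (/ s)) s).
    - apply Rlt_Rpower_l; lra.
    - rewrite Rpower_mult. replace (/ s * s) with 1 by (field; lra). apply Rpower_1. exact He. }
  replace (- / (1 + Rpower y s) - - 1) with (Rpower y s / (1 + Rpower y s)) by (field; lra).
  rewrite Rabs_pos_eq by (apply le_div; lra).
  apply Rle_lt_trans with (Rpower y s); [apply div_le; nra|exact Hlt].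
Qed.

Lemma DomG_lim_infty s : 0 < s -> filterlim (DomG s) (Rbar_locally p_infty) (locally 0).
Proof.
  intros Hs. apply filterlim_locally. intros eps. assert (He := cond_pos eps).
  exists (Rpower (/ eps) (/ s)). intros y Hy.
  assert (Hie : 0 < / eps) by (apply Rinv_0_lt_compat; exact He).
  apply ball_R_intro. unfold DomG. assert (HR := Rpower_pos y s).
  assert (Hlt : / eps < Rpower y s).
  { replace (/ eps) with (Rpower (Rpower (/ eps) (/ s)) s).
    - apply Rlt_Rpower_l; [exact Hs|]. split; [apply Rpower_pos|exact Hy].
    - rewrite Rpower_mult. replace (/ s * s) with 1 by (field; lra). apply Rpower_1. exact Hie. }
  rewrite Rminus_0_r, Rabs_Ropp, Rabs_pos_eq by (left; apply Rinv_0_lt_compat; lra).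
  rewrite <- (Rinv_inv eps). apply Rinv_lt_contravar; [apply Rmult_lt_0_compat; lra|lra].
Qed.

Lemma DomG_range s u : -1 <= DomG s u <= 0.
Proof.
  unfold DomG. assert (HR := Rpower_pos u s).
  assert (0 < / (1 + Rpower u s)) by (apply Rinv_0_lt_compat; lra).
  assert (/ (1 + Rpower u s) <= 1) by (rewrite <- Rinv_1 at 2; apply Rinv_le_contravar; lra). lra.
Qed.

(** Writing [X = u^s], the claim amounts to a bound on [(1 + X)^2 e^(-c u)]. The choice [A = 2 s]
    makes [u^(-A)] cancel [X^2]. *)
Lemma Dom_bound s c : 0 < s -> 0 < c -> exists K, 0 < K /\
  forall u, 0 < u -> Rpower u (s - 1) * exp (- (c * u)) <= K * Dom s u.
Proof.
  intros Hs Hc. set (A := 2 * s). assert (HA : 0 < A) by (unfold A; lra).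
  set (M := exp (A * ln A - A) * Rpower c (- A)).
  assert (HM : 0 < M) by (apply Rmult_lt_0_compat; [apply exp_pos|apply Rpower_pos]).
  exists ((2 + 2 * M) / s). split; [apply Rdiv_lt_0_compat; lra|]. intros u Hu.
  set (X := Rpower u s). assert (HX : 0 < X) by apply Rpower_pos.
  assert (H1 := Rpower_exp_le A (c * u) HA ltac:(nra)).
  rewrite <- Rpower_mult_distr, <- Rmult_assoc in H1 by assumption. fold M in H1.
  assert (HX2 : Rpower u (- A) * X ^ 2 = 1).
  { unfold X. rewrite <- (Rpower_pow 2) by apply Rpower_pos. rewrite Rpower_mult, <- Rpower_plus.
    replace (- A + s * INR 2) with 0 by (unfold A; simpl; ring). apply Rpower_O. exact Hu. }
  assert (H2 : X ^ 2 * exp (- (c * u)) <= M).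
  { apply Rle_trans with (X ^ 2 * (M * Rpower u (- A))).
    - apply Rmult_le_compat_l; [apply pow2_ge_0|exact H1].
    - replace (X ^ 2 * (M * Rpower u (- A))) with (M * (Rpower u (- A) * X ^ 2)) by ring. rewrite HX2. lra. }
  assert (H3 : exp (- (c * u)) <= 1).
  { rewrite <- exp_0. apply exp_le. nra. }
  assert (H4 : (1 + X) ^ 2 * exp (- (c * u)) <= 2 + 2 * M).
  { assert (0 < exp (- (c * u))) by apply exp_pos.
    assert ((1 + X) ^ 2 <= 2 + 2 * X ^ 2) by (generalize (pow2_ge_0 (1 - X)); nra). nra. }
  unfold Dom. fold X. assert (HP := Rpower_pos u (s - 1)).
  replace ((2 + 2 * M) / s * (s * Rpower u (s - 1) / (1 + X) ^ 2)) with (Rpower u (s - 1) * ((2 + 2 * M) / (1 + X) ^ 2)) by (field; lra).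
  apply Rmult_le_compat_l; [lra|]. apply le_div; [apply pow_lt; lra|lra].
Qed.

Lemma cint_dom_exists f K s : 0 < s -> ccont f -> (forall u, 0 < u -> Cmod (f u) <= K * Dom s u) ->
  exists l, cint f l.
Proof.
  intros Hs Hf H.
  apply (cint_exists f (fun u => K * DomG s u) (fun u => K * Dom s u) (K * -1) (K * 0)); auto.
  - intros u Hu. apply (is_derive_scal (DomG s)). apply is_derive_DomG. exact Hu.
  - intros u Hu. apply continuous_mult_R; [apply continuous_const|apply continuous_Dom; exact Hu].
  - apply (filterlim_comp _ _ _ (DomG s) (fun x => K * x) _ (locally (-1))); [apply DomG_lim_0; exact Hs|].
    apply (continuous_mult_R (fun _ => K) (fun x => x) (-1)); [apply continuous_const|apply continuous_id].
  - apply (filterlim_comp _ _ _ (DomG s) (fun x => K * x) _ (locally 0)); [apply DomG_lim_infty; exact Hs|].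
    apply (continuous_mult_R (fun _ => K) (fun x => x) 0); [apply continuous_const|apply continuous_id].
Qed.

(** Since [DomG] stays between -1 and 0, each majorant has mass at most 1 on any segment. Two
    exponents are allowed because the errors of the two expansions carry different powers of [u]. *)
Lemma cint_dom_le f l K1 K2 s1 s2 : ccont f -> cint f l -> 0 <= K1 -> 0 <= K2 ->
  (forall u, 0 < u -> Cmod (f u) <= K1 * Dom s1 u + K2 * Dom s2 u) -> Cmod l <= K1 + K2.
Proof.
  intros Hf Hl HK1 HK2 H. apply le_epsilon. intros eps He.
  destruct (proj1 (cint_iff f l) Hl eps He) as (d & M & Hd & HM).
  set (a := Rmin (d / 2) 1). set (b := Rmax (M + 1) 1).
  assert (Ha : 0 < a < d) by (unfold a, Rmin; destruct Rle_dec; lra).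
  assert (Hb : M < b) by (unfold b, Rmax; destruct Rle_dec; lra).
  assert (Hab : a <= b) by (unfold a, b, Rmin, Rmax; repeat destruct Rle_dec; lra).
  destruct (HM a b Ha Hb) as [y [Hy1 Hy2]].
  assert (E : y = CRInt f a b) by (apply (is_RInt_C_unique f a b); [exact Hy1|apply CRInt_correct; auto; lra]).
  assert (B : Cmod (CRInt f a b) <= (K1 * DomG s1 b + K2 * DomG s2 b) - (K1 * DomG s1 a + K2 * DomG s2 a)).
  { apply (CRInt_norm_le f (fun u => K1 * DomG s1 u + K2 * DomG s2 u) (fun u => K1 * Dom s1 u + K2 * Dom s2 u)); auto; try lra.
    - intros u Hu. apply (is_derive_plus (V := R_NormedModule)); [apply (is_derive_scal (DomG s1))|apply (is_derive_scal (DomG s2))]; apply is_derive_DomG; exact Hu.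
    - intros u Hu. apply (continuous_plus (V := R_NormedModule)); (apply continuous_mult_R; [apply continuous_const|apply continuous_Dom; exact Hu]). }
  rewrite E in Hy2.
  assert (T := Cmod_triangle (CRInt f a b) (Copp (Cminus (CRInt f a b) l))).
  replace (Cplus (CRInt f a b) (Copp (Cminus (CRInt f a b) l))) with l in T by ring. rewrite Cmod_opp in T.
  generalize (DomG_range s1 a) (DomG_range s1 b) (DomG_range s2 a) (DomG_range s2 b). intros. nra.
Qed.

(** * Gamma and Bessel integrals *)

Lemma cpow_cexp b s : cpow b s = cexp (Cmult s (RtoC (ln b))).
Proof.
  unfold cpow, cexp, Cmult, RtoC; simpl.
  replace (fst s * ln b - snd s * 0) with (fst s * ln b) by ring.
  replace (fst s * 0 + snd s * ln b) with (snd s * ln b) by ring. reflexivity.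
Qed.

Lemma cpow_plus b s t : cpow b (Cplus s t) = Cmult (cpow b s) (cpow b t).
Proof. rewrite !cpow_cexp, <- cexp_plus. f_equal. ring. Qed.

Lemma cpow_mult_base a b s : 0 < a -> 0 < b -> cpow (a * b) s = Cmult (cpow a s) (cpow b s).
Proof.
  intros Ha Hb. rewrite !cpow_cexp, <- cexp_plus. f_equal. rewrite ln_mult, RtoC_plus by assumption. ring.
Qed.

Lemma Cmod_cpow b s : Cmod (cpow b s) = Rpower b (fst s).
Proof.
  rewrite cpow_cexp, Cmod_cexp. unfold Rpower. f_equal. unfold Cmult, RtoC; simpl. ring.
Qed.

Lemma cpow_real b r : cpow b (RtoC r) = RtoC (Rpower b r).
Proof.
  unfold cpow, RtoC, Rpower; simpl. rewrite Rmult_0_l, cos_0, sin_0. f_equal; ring.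
Qed.

Lemma cexp_0 : cexp (RtoC 0) = RtoC 1.
Proof. unfold cexp, RtoC; simpl. rewrite exp_0, cos_0, sin_0. f_equal; ring. Qed.

Lemma cpow_opp_l b s : Cmult (cpow b (Copp s)) (cpow b s) = RtoC 1.
Proof.
  rewrite !cpow_cexp, <- cexp_plus. rewrite <- cexp_0. f_equal. ring.
Qed.

Lemma cpow_exp t s : cpow (exp t) s = cexp (Cmult s (RtoC t)).
Proof. rewrite cpow_cexp, ln_exp. reflexivity. Qed.

Lemma cpow_minus_1 b s : 0 < b -> Cmult (RtoC b) (cpow b (Cminus s (RtoC 1))) = cpow b s.
Proof.
  intros Hb. replace (RtoC b) with (cpow b (RtoC 1)) at 1.
  - rewrite <- cpow_plus. f_equal. ring.
  - rewrite cpow_real, Rpower_1 by exact Hb. reflexivity.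
Qed.

(** One kernel for both sides: [r = 0] gives the scaled Gamma integral, and [c = 1] with [r > 0] the
    integral behind the Bessel function. *)
Definition gamma_kernel (s : C) (c r u : R) : C :=
  Cmult (cpow u (Cminus s (RtoC 1))) (RtoC (exp (- (c * u + r / u)))).

Lemma ccont_gamma_kernel s c r : ccont (gamma_kernel s c r).
Proof.
  intros u Hu. split; apply ex_derive_continuous_R;
  unfold gamma_kernel, cpow, Cmult, Cminus, Cplus, Copp, RtoC; simpl; auto_derive; repeat split; auto; lra.
Qed.

Lemma gamma_kernel_le s c r u : 0 < u -> 0 <= r ->
  Cmod (gamma_kernel s c r u) <= Rpower u (fst s - 1) * exp (- (c * u)).
Proof.
  intros Hu Hr. unfold gamma_kernel. rewrite Cmod_mult, Cmod_cpow, Cmod_R, Rabs_pos_eq by (left; apply exp_pos).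
  replace (fst (Cminus s (RtoC 1))) with (fst s - 1) by (unfold Cminus, Cplus, Copp, RtoC; simpl; ring).
  apply Rmult_le_compat_l; [left; apply Rpower_pos|]. apply exp_le.
  assert (0 <= r / u) by (apply le_div; lra). lra.
Qed.

Lemma gamma_kernel_dom s c r : 0 < fst s -> 0 < c -> 0 <= r -> exists K, 0 < K /\
  forall u, 0 < u -> Cmod (gamma_kernel s c r u) <= K * Dom (fst s) u.
Proof.
  intros Hs Hc Hr. destruct (Dom_bound (fst s) c Hs Hc) as [K [HK H]]. exists K. split; [exact HK|].
  intros u Hu. eapply Rle_trans; [apply gamma_kernel_le; assumption|apply H; exact Hu].
Qed.

Lemma gamma_kernel_exists s c r : 0 < fst s -> 0 < c -> 0 <= r -> exists l, cint (gamma_kernel s c r) l.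
Proof.
  intros Hs Hc Hr. destruct (gamma_kernel_dom s c r Hs Hc Hr) as [K [HK H]].
  apply (cint_dom_exists _ K (fst s)); auto. apply ccont_gamma_kernel.
Qed.

Lemma cint_cGamma s : 0 < fst s -> cint (gamma_kernel s 1 0) (cGamma s).
Proof.
  intros Hs. destruct (gamma_kernel_exists s 1 0 Hs Rlt_0_1 (Rle_refl 0)) as [l Hl].
  assert (E : cGamma s = l); [|rewrite E; exact Hl].
  unfold cGamma. apply cint_unique. eapply cint_ext; [|exact Hl].
  intros u Hu. unfold gamma_kernel. f_equal. f_equal. f_equal. field. lra.
Qed.

Lemma scal_C (r : R) (z : C) : scal (K := R_AbsRing) (V := C_R_NormedModule) r z = Cmult (RtoC r) z.
Proof.
  destruct z as [x y]. unfold Cmult, RtoC. unfold scal; simpl. unfold prod_scal, scal; simpl. unfold mult; simpl.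
  f_equal; ring.
Qed.

(** The substitution of [c u] for [u] on each finite segment produces [c^(s-1)] from the power and
    [c] from the differential. The identity is proved multiplied by [c^s], which is removed at the
    end. *)
Lemma cint_gamma_scaled s c : 0 < fst s -> 0 < c ->
  cint (gamma_kernel s c 0) (Cmult (cpow c (Copp s)) (cGamma s)).
Proof.
  intros Hs Hc.
  assert (H : cint (fun u => Cmult (cpow c s) (gamma_kernel s c 0 u)) (cGamma s)).
  { assert (HG := cint_cGamma s Hs). apply cint_iff. intros eps He.
    destruct (proj1 (cint_iff _ _) HG eps He) as (d & M & Hd & HM).
    assert (Hcd : 0 < d / c) by (apply Rdiv_lt_0_compat; lra).
    exists (d / c), (Rmax (M / c) 0). split; [exact Hcd|].
    intros a b Ha Hb. assert (Hb1 : M / c < b) by (generalize (Rmax_l (M / c) 0); lra).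
    assert (Hb2 : 0 < b) by (generalize (Rmax_r (M / c) 0); lra).
    assert (Ha1 : c * a < d).
    { replace d with (c * (d / c)) by (field; lra). apply Rmult_lt_compat_l; lra. }
    assert (Hb3 : M < c * b).
    { replace M with (c * (M / c)) by (field; lra). apply Rmult_lt_compat_l; lra. }
    destruct (HM (c * a) (c * b)) as [y [Hy1 Hy2]]; [split; [nra|exact Ha1]|exact Hb3|].
    exists y. split; [|exact Hy2].
    replace (c * a) with (c * a + 0) in Hy1 by ring. replace (c * b) with (c * b + 0) in Hy1 by ring.
    apply (is_RInt_comp_lin (V := C_R_NormedModule)) in Hy1.
    eapply is_RInt_ext; [|exact Hy1]. intros x Hx. cbv beta. rewrite scal_C.
    assert (Hx0 : 0 < x) by (assert (0 < Rmin a b) by (apply Rmin_glb_lt; lra); lra).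
    unfold gamma_kernel. rewrite Rplus_0_r, cpow_mult_base by lra.
    rewrite <- (cpow_minus_1 c s Hc).
    replace (1 * (c * x) + 0 / (c * x)) with (c * x + 0 / x) by (field; lra). C_eq. ring. }
  apply (cint_scal (cpow c (Copp s))) in H. eapply cint_ext; [|exact H].
  intros u Hu. cbv beta. rewrite Cmult_assoc, cpow_opp_l. ring.
Qed.

Lemma is_RInt_C_comp f (g dg : R -> R) a b : ccont f ->
  (forall t, 0 < g t) -> (forall t, is_derive g t (dg t)) -> (forall t, continuous dg t) ->
  is_RInt_complex (fun t => Cmult (RtoC (dg t)) (f (g t))) a b (CRInt f (g a) (g b)).
Proof.
  intros Hf Hg Hdg Hc. apply is_RInt_C; unfold CRInt; cbn [fst snd].
  - assert (T := is_RInt_comp (V := R_CompleteNormedModule) (fun u => fst (f u)) g dg a b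
      (fun x _ => proj1 (Hf (g x) (Hg x))) (fun x _ => conj (Hdg x) (Hc x))).
    eapply is_RInt_ext; [|exact T]. intros x _. unfold scal; simpl; unfold mult; simpl. ring.
  - assert (T := is_RInt_comp (V := R_CompleteNormedModule) (fun u => snd (f u)) g dg a b
      (fun x _ => proj2 (Hf (g x) (Hg x))) (fun x _ => conj (Hdg x) (Hc x))).
    eapply is_RInt_ext; [|exact T]. intros x _. unfold scal; simpl; unfold mult; simpl. ring.
Qed.

Lemma gamma_kernel_exp nu r t : 0 < r ->
  Cmult (RtoC (r * exp t)) (gamma_kernel nu 1 (r ^ 2) (r * exp t))
  = Cmult (cpow r nu) (Cmult (RtoC (exp (- (2 * r) * cosh t))) (cexp (Cmult nu (RtoC t)))).
Proof.
  intros Hr. assert (He := exp_pos t). assert (Hp : 0 < r * exp t) by nra.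
  unfold gamma_kernel. rewrite Cmult_assoc, cpow_minus_1 by exact Hp.
  rewrite cpow_mult_base, cpow_exp by assumption.
  replace (- (1 * (r * exp t) + r ^ 2 / (r * exp t))) with (- (2 * r) * cosh t).
  - ring.
  - unfold cosh. rewrite exp_Ropp. field. lra.
Qed.

(* The substitution [u = r e^t] turns the kernel into that of the Bessel function, and folds the real line at 0. *)
Lemma besselK_kernel nu r I : 0 < r -> 0 < fst nu -> cint (gamma_kernel nu 1 (r ^ 2)) I ->
  besselK nu (2 * r) = Cmult (Cmult (RtoC (1 / 2)) (cpow r (Copp nu))) I.
Proof.
  intros Hr Hnu HI. unfold besselK. apply cint_unique.
  set (h := gamma_kernel nu 1 (r ^ 2)) in *.
  set (q := Cmult (RtoC (1 / 2)) (cpow r (Copp nu))).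
  assert (Hh : ccont h) by apply ccont_gamma_kernel.
  destruct (gamma_kernel_dom nu 1 (r ^ 2) Hnu Rlt_0_1 (pow2_ge_0 r)) as [K [HK HKd]].
  assert (Hgp : forall t, 0 < r * exp t) by (intros t; generalize (exp_pos t); nra).
  (* The [nu] exponential uses [u = r e^t] and covers [[r e^a, r e^b]]; the [- nu] exponential uses
     [u = r e^(-t)] and covers [[r e^(-b), r e^(-a)]]. Together they make up [[r e^(-b), r e^b]]
     without its middle piece [[r e^(-a), r e^a]]. *)
  assert (Hint : forall a b, is_RInt_complex (fun t => Cmult (RtoC (exp (- (2 * r) * cosh t)))
     (Cmult (RtoC (1/2)) (Cplus (cexp (Cmult nu (RtoC t))) (cexp (Cmult (Copp nu) (RtoC t)))))) a b
     (Cmult q (Cminus (CRInt h (r * exp (- b)) (r * exp b)) (CRInt h (r * exp (- a)) (r * exp a))))).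
  { intros a b.
    assert (T1 := is_RInt_C_comp h (fun t => r * exp t) (fun t => r * exp t) a b Hh Hgp
       ltac:(intros t; auto_derive; auto; ring)
       ltac:(intros t; apply ex_derive_continuous_R; auto_derive; auto)).
    assert (T2 := is_RInt_C_comp h (fun t => r * exp (- t)) (fun t => - (r * exp (- t))) a b Hh (fun t => Hgp (- t))
       ltac:(intros t; auto_derive; auto; ring)
       ltac:(intros t; apply ex_derive_continuous_R; auto_derive; auto)).
    cbv beta in T1, T2.
    assert (T := is_RInt_C_scal q _ _ _ _ (is_RInt_C_plus _ _ _ _ _ _ T1 (is_RInt_C_scal (Copp (RtoC 1)) _ _ _ _ T2))).
    assert (E : Cplus (CRInt h (r * exp a) (r * exp b)) (Cmult (Copp (RtoC 1)) (CRInt h (r * exp (- a)) (r * exp (- b))))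
      = Cminus (CRInt h (r * exp (- b)) (r * exp b)) (CRInt h (r * exp (- a)) (r * exp a))).
    { assert (A1 := CRInt_Chasles h (r * exp (- b)) (r * exp (- a)) (r * exp b) Hh (Hgp _) (Hgp _) (Hgp _)).
      assert (A2 := CRInt_Chasles h (r * exp (- a)) (r * exp a) (r * exp b) Hh (Hgp _) (Hgp _) (Hgp _)).
      assert (A3 := CRInt_Chasles h (r * exp (- b)) (r * exp (- a)) (r * exp (- b)) Hh (Hgp _) (Hgp _) (Hgp _)).
      rewrite CRInt_point in A3 by (auto; apply Hgp).
      rewrite <- A1, <- A2.
      replace (CRInt h (r * exp (- a)) (r * exp (- b))) with
        (Cminus (Cplus (CRInt h (r * exp (- b)) (r * exp (- a))) (CRInt h (r * exp (- a)) (r * exp (- b)))) (CRInt h (r * exp (- b)) (r * exp (- a)))) by ring.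
      rewrite A3. ring. }
    rewrite E in T. eapply is_RInt_ext; [|exact T]. intros t _. cbv beta.
    assert (B1 := gamma_kernel_exp nu r t Hr). assert (B2 := gamma_kernel_exp nu r (- t) Hr). fold h in B1, B2.
    rewrite RtoC_opp, B1.
    replace (Cmult (Copp (RtoC 1)) (Cmult (Copp (RtoC (r * exp (- t)))) (h (r * exp (- t)))))
      with (Cmult (RtoC (r * exp (- t))) (h (r * exp (- t)))) by ring.
    rewrite B2. unfold q.
    replace (cosh (- t)) with (cosh t) by (unfold cosh; rewrite Ropp_involutive; f_equal; ring).
    replace (Cmult nu (RtoC (- t))) with (Cmult (Copp nu) (RtoC t)) by (rewrite RtoC_opp; ring).
    assert (P := cpow_opp_l r nu).
    set (e := RtoC (exp _)). set (x := cexp _). set (y := cexp _).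
    transitivity (Cmult (Cmult (cpow r (Copp nu)) (cpow r nu)) (Cmult (RtoC (1 / 2)) (Cplus (Cmult e x) (Cmult e y)))).
    - C_eq. ring.
    - rewrite P. C_eq. ring. }
  apply cint_iff. intros eps He.
  set (Q := Cmod q + 1). assert (HQ : 0 < Q) by (unfold Q; generalize (Cmod_ge_0 q); lra).
  assert (HeQ : 0 < eps / (2 * Q)) by (apply Rdiv_lt_0_compat; lra).
  destruct (proj1 (cint_iff _ _) HI _ HeQ) as (d & M & Hd & HM).
  (* [phi a] bounds the missing middle piece; it is continuous and zero at 0, so the piece
     disappears as [a] tends to 0. *)
  set (phi := fun t => K * DomG (fst nu) (r * exp t) - K * DomG (fst nu) (r * exp (- t))).
  assert (Hphi : continuous phi 0).
  { assert (Hk : forall v, continuous (fun t => K * DomG (fst nu) (r * exp (v * t))) 0).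
    { intros v. apply continuous_mult_R; [apply continuous_const|].
      apply (continuous_comp (fun t => r * exp (v * t)) (DomG (fst nu))).
      - apply ex_derive_continuous_R; auto_derive; auto.
      - apply ex_derive_continuous_R. eexists. apply is_derive_DomG. apply Hgp. }
    apply (continuous_ext (fun t => K * DomG (fst nu) (r * exp (1 * t)) - K * DomG (fst nu) (r * exp (-1 * t)))).
    - intros t. unfold phi. rewrite Rmult_1_l. replace (-1 * t) with (- t) by ring. reflexivity.
    - apply (continuous_minus (V := R_NormedModule)); apply Hk. }
  destruct (proj1 (filterlim_locally phi (phi 0)) Hphi (mkposreal _ HeQ)) as [d' Hd'].
  (* Beyond [Mx], both [r e^(-b) < d] and [r e^b > M] hold; [Rmax M 1] keeps the argument of the
     logarithm positive. *)
  set (Mx := Rmax (Rmax (ln (r / d)) (ln (Rmax M 1 / r))) 0).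
  exists d', Mx. split; [apply cond_pos|]. intros a b Ha Hb.
  eexists. split; [apply Hint|].
  assert (HM1 : 0 < Rmax M 1) by (generalize (Rmax_r M 1); lra).
  assert (Hb1 : r * exp (- b) < d).
  { assert (Hlt : ln (r / d) < b) by (eapply Rle_lt_trans; [|exact Hb]; unfold Mx; eapply Rle_trans; [apply Rmax_l|apply Rmax_l]).
    apply exp_increasing in Hlt. rewrite exp_ln in Hlt by (apply Rdiv_lt_0_compat; lra).
    rewrite exp_Ropp. apply Rmult_lt_reg_r with (exp b); [apply exp_pos|].
    rewrite Rmult_assoc, Rinv_l, Rmult_1_r by (apply Rgt_not_eq, exp_pos).
    replace r with (d * (r / d)) by (field; lra). apply Rmult_lt_compat_l; lra. }
  assert (Hb2 : M < r * exp b).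
  { assert (Hlt : ln (Rmax M 1 / r) < b) by (eapply Rle_lt_trans; [|exact Hb]; unfold Mx; eapply Rle_trans; [apply Rmax_r|apply Rmax_l]).
    apply exp_increasing in Hlt. rewrite exp_ln in Hlt by (apply Rdiv_lt_0_compat; lra).
    apply Rle_lt_trans with (Rmax M 1); [apply Rmax_l|].
    replace (Rmax M 1) with (r * (Rmax M 1 / r)) by (field; lra). apply Rmult_lt_compat_l; lra. }
  destruct (HM (r * exp (- b)) (r * exp b)) as [y [Hy1 Hy2]]; [split; [apply Hgp|exact Hb1]|exact Hb2|].
  assert (Ey : y = CRInt h (r * exp (- b)) (r * exp b))
    by (eapply is_RInt_C_unique; [exact Hy1|apply CRInt_correct; auto]).
  rewrite Ey in Hy2.
  assert (Hs : Cmod (CRInt h (r * exp (- a)) (r * exp a)) < eps / (2 * Q)).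
  { eapply Rle_lt_trans; [apply (CRInt_norm_le_abs h (fun u => K * DomG (fst nu) u) (fun u => K * Dom (fst nu) u)); auto|].
    - intros u Hu. apply (is_derive_scal (DomG (fst nu))). apply is_derive_DomG. exact Hu.
    - intros u Hu. apply continuous_mult_R; [apply continuous_const|apply continuous_Dom; exact Hu].
    - assert (B : ball 0 d' a).
      { apply ball_R_intro. rewrite Rminus_0_r, Rabs_pos_eq; lra. }
      specialize (Hd' a B). apply ball_R_elim in Hd'; simpl in Hd'.
      replace (phi 0) with 0 in Hd' by (unfold phi; rewrite Ropp_0; ring).
      rewrite Rminus_0_r in Hd'. exact Hd'. }
  replace (Cminus (Cmult q (Cminus (CRInt h (r * exp (- b)) (r * exp b)) (CRInt h (r * exp (- a)) (r * exp a)))) (Cmult q I))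
    with (Cmult q (Cplus (Cminus (CRInt h (r * exp (- b)) (r * exp b)) I) (Copp (CRInt h (r * exp (- a)) (r * exp a))))) by ring.
  rewrite Cmod_mult.
  assert (T := Cmod_triangle (Cminus (CRInt h (r * exp (- b)) (r * exp b)) I) (Copp (CRInt h (r * exp (- a)) (r * exp a)))).
  rewrite Cmod_opp in T.
  apply Rle_lt_trans with (Cmod q * (eps / Q)).
  - apply Rmult_le_compat_l; [apply Cmod_ge_0|]. replace (eps / Q) with (eps / (2 * Q) + eps / (2 * Q)) by (field; lra). lra.
  - replace (Cmod q * (eps / Q)) with (eps - eps / Q) by (unfold Q; field; unfold Q in HQ; lra).
    assert (0 < eps / Q) by (apply Rdiv_lt_0_compat; lra). lra.
Qed.

(** * Double series of complex terms *)

Definition csum (a : nat -> C) (N : nat) : C := (sum_n (fun n => fst (a n)) N, sum_n (fun n => snd (a n)) N).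

Lemma csum_O a : csum a 0 = a 0%nat.
Proof. unfold csum. rewrite !sum_O. destruct (a 0%nat); reflexivity. Qed.

Lemma csum_S a N : csum a (S N) = Cplus (csum a N) (a (S N)).
Proof. unfold csum. rewrite !sum_Sn_R. reflexivity. Qed.

Lemma csum_ext a b N : (forall n, a n = b n) -> csum a N = csum b N.
Proof. intros H. unfold csum. f_equal; apply sum_n_ext; intros n; rewrite H; reflexivity. Qed.

Lemma csum_mult_l z a N : csum (fun n => Cmult z (a n)) N = Cmult z (csum a N).
Proof. induction N as [|N IH]; [rewrite !csum_O|rewrite !csum_S, IH]; ring. Qed.

Lemma csum_RtoC (r : nat -> R) N : csum (fun n => RtoC (r n)) N = RtoC (sum_n r N).
Proof. induction N as [|N IH]; [rewrite csum_O, sum_O; reflexivity|rewrite csum_S, IH, sum_Sn_R, RtoC_plus; reflexivity]. Qed.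

Lemma cint_csum (f : nat -> R -> C) (l : nat -> C) N : (forall n, cint (f n) (l n)) ->
  cint (fun u => csum (fun n => f n u) N) (csum l N).
Proof.
  intros H. induction N as [|N IH].
  - rewrite csum_O. eapply cint_ext; [|apply (H 0%nat)]. intros u _. rewrite csum_O. reflexivity.
  - rewrite csum_S. eapply cint_ext; [|apply (cint_plus _ _ _ _ IH (H (S N)))]. intros u _. rewrite csum_S. reflexivity.
Qed.

Lemma ccont_ext f g : (forall u, f u = g u) -> ccont f -> ccont g.
Proof.
  intros E H u Hu. destruct (H u Hu) as [H1 H2]. split.
  - eapply continuous_ext; [|exact H1]. intros t. simpl. rewrite E. reflexivity.
  - eapply continuous_ext; [|exact H2]. intros t. simpl. rewrite E. reflexivity.
Qed.

Lemma ccont_plus f g : ccont f -> ccont g -> ccont (fun u => Cplus (f u) (g u)).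
Proof.
  intros Hf Hg u Hu. destruct (Hf u Hu) as [F1 F2]. destruct (Hg u Hu) as [G1 G2].
  split; simpl; apply (continuous_plus (V := R_NormedModule)); assumption.
Qed.

Lemma ccont_scal c f : ccont f -> ccont (fun u => Cmult c (f u)).
Proof.
  intros Hf u Hu. destruct (Hf u Hu) as [F1 F2].
  split; simpl; [apply (continuous_minus (V := R_NormedModule))|apply (continuous_plus (V := R_NormedModule))];
  (apply continuous_mult_R; [apply continuous_const|assumption]).
Qed.

Lemma ccont_csum (f : nat -> R -> C) N : (forall n, ccont (f n)) -> ccont (fun u => csum (fun n => f n u) N).
Proof.
  intros H. induction N as [|N IH].
  - apply (ccont_ext (f 0%nat)); [|apply H]. intros u. rewrite csum_O. reflexivity.
  - apply (ccont_ext (fun u => Cplus (csum (fun n => f n u) N) (f (S N) u))); [|apply ccont_plus; auto].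
    intros u. rewrite csum_S. reflexivity.
Qed.

Definition clim (s : nat -> C) (l : C) : Prop := is_lim_seq (fun n => Cmod (Cminus (s n) l)) 0.

Lemma clim_squeeze s l (b : nat -> R) : (forall n, Cmod (Cminus (s n) l) <= b n) -> is_lim_seq b 0 -> clim s l.
Proof.
  intros H Hb. apply is_lim_seq_squeeze_0 with (w := b); auto.
  - intros n. split; [apply Cmod_ge_0|apply H].
Qed.

Lemma Cmod_le_abs z : Cmod z <= Rabs (fst z) + Rabs (snd z).
Proof.
  destruct z as [x y]. replace (x, y) with (Cplus (RtoC x) (Cmult Ci (RtoC y)))
    by (unfold Cplus, Cmult, Ci, RtoC; simpl; f_equal; ring).
  eapply Rle_trans; [apply Cmod_triangle|]. rewrite Cmod_mult, Cmod_Ci, !Cmod_R. simpl.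
  replace (x + (0 * y - 1 * 0)) with x by ring. replace (0 + (0 * 0 + 1 * y)) with y by ring. lra.
Qed.

Lemma clim_components (s : nat -> C) (l : C) : is_lim_seq (fun n => fst (s n)) (fst l) -> is_lim_seq (fun n => snd (s n)) (snd l) -> clim s l.
Proof.
  intros H1 H2. apply (clim_squeeze _ _ (fun n => Rabs (fst (s n) - fst l) + Rabs (snd (s n) - snd l))).
  - intros n. apply Cmod_le_abs.
  - assert (T : forall (u : nat -> R) (v : R), is_lim_seq u v -> is_lim_seq (fun n => Rabs (u n - v)) 0).
    { intros u v H. rewrite <- Rabs_R0. apply (is_lim_seq_abs _ 0).
      replace (Finite 0) with (Finite (v - v)) by (f_equal; ring). apply is_lim_seq_minus'; [exact H|apply is_lim_seq_const]. }
    apply is_lim_seq_plus_0; apply T; assumption.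
Qed.

Lemma clim_affine s l c d : clim s l -> clim (fun n => Cplus d (Cmult c (s n))) (Cplus d (Cmult c l)).
Proof.
  intros H. apply (clim_squeeze _ _ (fun n => Cmod c * Cmod (Cminus (s n) l))).
  - intros n. rewrite <- Cmod_mult. right. f_equal. ring.
  - apply is_lim_seq_scal_0. exact H.
Qed.

Lemma clim_close s t l (b : nat -> R) : clim t l -> (forall n, Cmod (Cminus (s n) (t n)) <= b n) -> is_lim_seq b 0 -> clim s l.
Proof.
  intros Ht H Hb. apply (clim_squeeze _ _ (fun n => b n + Cmod (Cminus (t n) l))).
  - intros n. replace (Cminus (s n) l) with (Cplus (Cminus (s n) (t n)) (Cminus (t n) l)) by ring.
    eapply Rle_trans; [apply Cmod_triangle|]. specialize (H n). lra.
  - apply is_lim_seq_plus_0; assumption.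
Qed.

Lemma clim_is_series (a : nat -> C) l : clim (csum a) l -> is_series (V := C_R_NormedModule) a l.
Proof.
  intros H P HP. apply locally_C in HP. destruct HP as [eps HP].
  destruct (proj1 (filterlim_locally _ _) H eps) as [N HN]. exists N. intros n Hn. apply HP.
  assert (E : sum_n (G := C_R_NormedModule) a n = csum a n).
  { clear. induction n as [|n IH]; [rewrite sum_O, csum_O; reflexivity|rewrite sum_Sn, csum_S, IH; reflexivity]. }
  rewrite E. specialize (HN n Hn). apply ball_R_elim in HN; simpl in HN.
  rewrite Rminus_0_r, Rabs_pos_eq in HN by apply Cmod_ge_0. exact HN.
Qed.

Definition quad (theta psi : R) (F : R -> R -> C) (m n : nat) : C :=
  Cplus (Cplus (F (INR m + theta) (INR n + psi)) (F (INR m + theta) (INR n + 1 - psi)))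
        (Cplus (F (INR m + 1 - theta) (INR n + psi)) (F (INR m + 1 - theta) (INR n + 1 - psi))).

Definition zeta_pair (s al : R) (n : nat) : R := Rpower (INR n + al) (- s) + Rpower (INR n + 1 - al) (- s).

Lemma ex_series_zeta_pair s al : 1 < s -> 0 < al < 1 -> ex_series (zeta_pair s al).
Proof.
  intros Hs Hal.
  apply (ex_series_ext (fun n => Rpower (INR n + al) (- s) + Rpower (INR n + (1 - al)) (- s))).
  - intros n. unfold zeta_pair. replace (INR n + (1 - al)) with (INR n + 1 - al) by ring. reflexivity.
  - apply ex_series_plus_R; apply ex_series_Rpower; lra.
Qed.

Lemma zeta_pair_pos s al n : 0 <= zeta_pair s al n.
Proof. unfold zeta_pair. left. apply Rplus_lt_0_compat; apply Rpower_pos. Qed.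

Lemma quad_bound theta psi F K s t m n : 0 < theta < 1 -> 0 < psi < 1 ->
  (forall al xi, 0 < al -> 0 < xi -> Cmod (F al xi) <= K * (Rpower al (- s) * Rpower xi (- t))) ->
  Cmod (quad theta psi F m n) <= K * zeta_pair s theta m * zeta_pair t psi n.
Proof.
  intros Hth Hpsi H. assert (Hm := pos_INR m). assert (Hn := pos_INR n).
  unfold quad, zeta_pair.
  eapply Rle_trans; [apply Cmod_triangle|].
  eapply Rle_trans; [apply Rplus_le_compat; apply Cmod_triangle|].
  assert (H1 := H (INR m + theta) (INR n + psi) ltac:(lra) ltac:(lra)).
  assert (H2 := H (INR m + theta) (INR n + 1 - psi) ltac:(lra) ltac:(lra)).
  assert (H3 := H (INR m + 1 - theta) (INR n + psi) ltac:(lra) ltac:(lra)).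
  assert (H4 := H (INR m + 1 - theta) (INR n + 1 - psi) ltac:(lra) ltac:(lra)).
  lra.
Qed.

Lemma quad_ext theta psi F G m n : 0 < theta < 1 -> 0 < psi < 1 ->
  (forall al xi, 0 < al -> 0 < xi -> F al xi = G al xi) -> quad theta psi F m n = quad theta psi G m n.
Proof.
  intros Hth Hpsi H. assert (Hm := pos_INR m). assert (Hn := pos_INR n).
  unfold quad. rewrite !H by lra. reflexivity.
Qed.

Lemma quad_mult theta psi c F m n :
  quad theta psi (fun al xi => Cmult c (F al xi)) m n = Cmult c (quad theta psi F m n).
Proof. unfold quad. ring. Qed.

Lemma cint_quad theta psi (F : R -> R -> R -> C) (G : R -> R -> C) m n : 0 < theta < 1 -> 0 < psi < 1 ->
  (forall al xi, 0 < al -> 0 < xi -> cint (F al xi) (G al xi)) ->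
  cint (fun u => quad theta psi (fun al xi => F al xi u) m n) (quad theta psi G m n).
Proof.
  intros Hth Hpsi H. assert (Hm := pos_INR m). assert (Hn := pos_INR n).
  assert (A1 : 0 < INR m + theta) by lra. assert (A2 : 0 < INR m + 1 - theta) by lra.
  assert (B1 : 0 < INR n + psi) by lra. assert (B2 : 0 < INR n + 1 - psi) by lra.
  exact (cint_plus _ _ _ _ (cint_plus _ _ _ _ (H _ _ A1 B1) (H _ _ A1 B2))
                           (cint_plus _ _ _ _ (H _ _ A2 B1) (H _ _ A2 B2))).
Qed.

Lemma ccont_quad theta psi (F : R -> R -> R -> C) m n : (forall al xi, ccont (F al xi)) ->
  ccont (fun u => quad theta psi (fun al xi => F al xi u) m n).
Proof. intros H. exact (ccont_plus _ _ (ccont_plus _ _ (H _ _) (H _ _)) (ccont_plus _ _ (H _ _) (H _ _))). Qed.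

(** [CSeries] is defined by total real series, so its value is meaningful only under convergence;
    the product majorant supplies it for both components. *)
Lemma csum_square_lim (T : nat -> nat -> C) (A B : nat -> R) :
  (forall m n, Cmod (T m n) <= A m * B n) -> ex_series A -> ex_series B ->
  clim (fun N => csum (fun m => csum (T m) N) N) (CSeries (fun m => CSeries (T m))).
Proof.
  intros H HA HB. apply clim_components.
  - apply (dominated_square_lim (fun m n => fst (T m n)) A B); auto.
    intros m n. eapply Rle_trans; [apply Rabs_fst_le_Cmod|apply H].
  - apply (dominated_square_lim (fun m n => snd (T m n)) A B); auto.
    intros m n. eapply Rle_trans; [apply Rabs_snd_le_Cmod|apply H].
Qed.

(** * Termwise identities and tail bounds uniform in [u] *)

Definition theta_term (k : nat) (y u al xi : R) : R := xi ^ k * exp (- (4 * PI ^ 2 * al / (y / u) * xi)).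

Lemma theta_pair_quad k theta psi y u m n :
  theta_pair k psi (4 * PI ^ 2 * (INR m + theta) / (y / u)) n
  + theta_pair k psi (4 * PI ^ 2 * (INR m + (1 - theta)) / (y / u)) n
  = fst (quad theta psi (fun al xi => RtoC (theta_term k y u al xi)) m n).
Proof.
  unfold quad, theta_pair, theta_term. simpl. replace (INR m + (1 - theta)) with (INR m + 1 - theta) by ring. ring.
Qed.

(** With [A = k + 1 + d], the factor [xi^k] leaves [xi^(-(1+d))], so both lattice variables have
    exponents above 1, while [u^(-A)] is only [u^(-d)] worse than the factor [u^(k+1)] can
    repair. *)
Lemma theta_term_bound k y d : 0 < y -> 0 < d -> exists K, 0 < K /\
  forall u al xi, 0 < u -> 0 < al -> 0 < xi ->
  theta_term k y u al xi <= K * Rpower u (- (INR k + 1 + d)) * (Rpower al (- (INR k + 1 + d)) * Rpower xi (- (1 + d))).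
Proof.
  intros Hy Hd. assert (HP := PI_RGT_0). set (A := INR k + 1 + d).
  assert (HA : 0 < A) by (unfold A; generalize (pos_INR k); lra).
  set (q := 4 * PI ^ 2 / y).
  assert (Hq : 0 < q) by (apply Rdiv_lt_0_compat; [assert (0 < PI ^ 2) by (apply pow_lt; lra)|]; lra).
  exists (exp (A * ln A - A) * Rpower q (- A)). split; [apply Rmult_lt_0_compat; [apply exp_pos|apply Rpower_pos]|].
  intros u al xi Hu Hal Hxi. unfold theta_term.
  replace (4 * PI ^ 2 * al / (y / u) * xi) with (q * (u * (al * xi))) by (unfold q; field; lra).
  assert (Hax : 0 < al * xi) by nra. assert (Huax : 0 < u * (al * xi)) by (apply Rmult_lt_0_compat; assumption).
  assert (H := Rpower_exp_le A (q * (u * (al * xi))) HA (Rmult_lt_0_compat _ _ Hq Huax)).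
  rewrite <- !Rpower_mult_distr in H by assumption.
  assert (E : Rpower xi (- (1 + d)) = xi ^ k * Rpower xi (- A)).
  { rewrite <- Rpower_pow, <- Rpower_plus by exact Hxi. f_equal. unfold A. ring. }
  rewrite E. assert (0 < xi ^ k) by (apply pow_lt; exact Hxi).
  apply Rle_trans with (xi ^ k * (exp (A * ln A - A) * (Rpower q (- A) * (Rpower u (- A) * (Rpower al (- A) * Rpower xi (- A)))))).
  - apply Rmult_le_compat_l; [lra|exact H].
  - right. ring.
Qed.

Definition series_gap (v : nat -> R) (N : nat) : R := Series v - sum_n v N.

Lemma series_gap_lim v : ex_series v -> is_lim_seq (series_gap v) 0.
Proof.
  intros Hv. replace (Finite 0) with (Finite (Series v - Series v)) by (f_equal; ring).
  apply is_lim_seq_minus'; [apply is_lim_seq_const|apply is_lim_sum_Series; exact Hv].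
Qed.

(** The divisor sum is at most [n^(k+1)], so [A = k + 3] leaves [n^(-2)]; the dependence on [w]
    separates as [w^(-A)]. *)
Lemma twisted_sigma_tail k theta psi : exists K, 0 < K /\ forall w N, 0 < w ->
  Rabs (Series (fun j => twisted_sigma k theta psi (S j) * exp (- (INR (S j) * w)))
        - sum_n (fun j => twisted_sigma k theta psi (S j) * exp (- (INR (S j) * w))) N)
  <= K * Rpower w (- (INR k + 3)) * series_gap (fun n => Rpower (INR n + 1) (- 2)) N.
Proof.
  set (A := INR k + 3). assert (HA : 0 < A) by (unfold A; generalize (pos_INR k); lra).
  exists (exp (A * ln A - A)). split; [apply exp_pos|]. intros w N Hw.
  set (c := exp (A * ln A - A) * Rpower w (- A)).
  assert (Hv : ex_series (fun n => Rpower (INR n + 1) (- 2))) by (apply ex_series_Rpower_m2; lra).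
  unfold series_gap. rewrite Rmult_minus_distr_l, <- Series_scal_l, <- sum_n_Rmult_l.
  apply (Series_tail_le _ (fun n => c * Rpower (INR n + 1) (- 2))).
  2:{ apply ex_series_scal_R. exact Hv. }
  intros n. assert (Hn := pos_INR n). rewrite S_INR. set (t := INR n + 1). assert (Ht : 0 < t) by (unfold t; lra).
  rewrite Rabs_mult, (Rabs_pos_eq (exp _)) by (left; apply exp_pos).
  assert (B := twisted_sigma_bound k theta psi (S n) ltac:(lia)). rewrite S_INR in B. fold t in B.
  assert (H := Rpower_exp_le A (t * w) HA (Rmult_lt_0_compat _ _ Ht Hw)).
  rewrite <- Rpower_mult_distr in H by assumption.
  assert (E : t ^ (k + 1) * Rpower t (- A) = Rpower t (- 2)).
  { rewrite <- Rpower_pow, <- Rpower_plus by exact Ht. f_equal. unfold A. rewrite plus_INR. simpl. lra. }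
  apply Rle_trans with (t ^ (k + 1) * (exp (A * ln A - A) * (Rpower t (- A) * Rpower w (- A)))).
  - apply Rmult_le_compat; auto using Rabs_pos. left; apply exp_pos.
  - rewrite <- E. unfold c. right. ring.
Qed.

Lemma quad_RtoC theta psi F m n :
  quad theta psi (fun al xi => RtoC (F al xi)) m n = RtoC (fst (quad theta psi (fun al xi => RtoC (F al xi)) m n)).
Proof. unfold quad, RtoC, Cplus; simpl. f_equal. ring. Qed.

Lemma gamma_kernel_split nu c u : 0 < u ->
  gamma_kernel nu 1 c u = Cmult (gamma_kernel nu 1 0 u) (RtoC (exp (- (c / u)))).
Proof.
  intros Hu. unfold gamma_kernel. rewrite <- Cmult_assoc, <- RtoC_mult, <- exp_plus.
  f_equal. f_equal. f_equal. field. lra.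
Qed.

(** The factor [u^(k+1)] raises the order from [nu] to [nu + k + 1], and the theta exponential,
    linear in [u] at [w = y/u], adds to the decay rate. So every transformed term is a scaled Gamma
    integral. *)
Lemma gamma_kernel_shift nu k y al xi u : 0 < u -> 0 < y ->
  Cmult (RtoC (xi ^ k)) (gamma_kernel (Cplus nu (RtoC (INR k + 1))) (1 + 4 * PI ^ 2 * (al * xi) / y) 0 u)
  = Cmult (gamma_kernel nu 1 0 u) (Cmult (RtoC (u ^ (k + 1))) (RtoC (theta_term k y u al xi))).
Proof.
  intros Hu Hy. unfold gamma_kernel, theta_term.
  replace (Cminus (Cplus nu (RtoC (INR k + 1))) (RtoC 1)) with (Cplus (Cminus nu (RtoC 1)) (RtoC (INR k + 1))) by ring.
  rewrite cpow_plus, cpow_real. replace (INR k + 1) with (INR (k + 1)) by (rewrite plus_INR; reflexivity).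
  rewrite Rpower_pow by exact Hu.
  replace (- ((1 + 4 * PI ^ 2 * (al * xi) / y) * u + 0 / u))
    with (- (1 * u + 0 / u) + - (4 * PI ^ 2 * al / (y / u) * xi)) by (field; lra).
  rewrite exp_plus, !RtoC_mult. ring.
Qed.

(** With [r = a sqrt(n x) / 2], the Bessel argument is [2 r] and [r^2 = n y]; the powers of [n] and
    [y] of order [nu/2] combine to [r^nu], cancelling [r^(-nu)]. *)
Lemma cint_bessel_term nu a x n : 0 < a -> 0 < x -> 0 < fst nu -> 0 < n ->
  cint (gamma_kernel nu 1 (n * (a ^ 2 * x / 4)))
    (Cmult (Cmult (RtoC 2) (cpow (a ^ 2 * x / 4) (Cdiv nu (RtoC 2))))
           (Cmult (cpow n (Cdiv nu (RtoC 2))) (besselK nu (a * sqrt (n * x))))).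
Proof.
  intros Ha Hx Hnu Hn. set (y := a ^ 2 * x / 4). set (r := a * sqrt (n * x) / 2).
  assert (Hnx : 0 < n * x) by nra. assert (Hs : 0 < sqrt (n * x)) by (apply sqrt_lt_R0; exact Hnx).
  assert (Hr : 0 < r) by (unfold r; apply Rdiv_lt_0_compat; [apply Rmult_lt_0_compat|]; lra).
  assert (Hy : 0 < y) by (unfold y; assert (0 < a ^ 2) by (apply pow_lt; lra); apply Rdiv_lt_0_compat; [apply Rmult_lt_0_compat|]; lra).
  assert (Hr2 : r ^ 2 = n * y).
  { unfold r, y. replace ((a * sqrt (n * x) / 2) ^ 2) with (a ^ 2 * (sqrt (n * x) * sqrt (n * x)) / 4) by field.
    rewrite sqrt_sqrt by lra. field. }
  destruct (gamma_kernel_exists nu 1 (r ^ 2) Hnu Rlt_0_1 (pow2_ge_0 r)) as [I HI].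
  assert (HB := besselK_kernel nu r I Hr Hnu HI).
  replace (2 * r) with (a * sqrt (n * x)) in HB by (unfold r; field).
  rewrite HB. rewrite Hr2 in HI.
  assert (Hc : Cmult (cpow n (Cdiv nu (RtoC 2))) (cpow y (Cdiv nu (RtoC 2))) = cpow r nu).
  { rewrite <- cpow_mult_base by assumption. rewrite <- Hr2. replace (r ^ 2) with (r * r) by ring.
    rewrite cpow_mult_base, <- cpow_plus by assumption. f_equal. field. }
  replace (Cmult (Cmult (RtoC 2) (cpow y (Cdiv nu (RtoC 2))))
      (Cmult (cpow n (Cdiv nu (RtoC 2))) (Cmult (Cmult (RtoC (1 / 2)) (cpow r (Copp nu))) I))) with I; [exact HI|].
  transitivity (Cmult (Cmult (Cmult (RtoC 2) (RtoC (1 / 2))) (Cmult (cpow r (Copp nu))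
     (Cmult (cpow n (Cdiv nu (RtoC 2))) (cpow y (Cdiv nu (RtoC 2)))))) I); [|ring].
  rewrite Hc, cpow_opp_l, <- RtoC_mult. replace (2 * (1 / 2)) with 1 by field. ring.
Qed.

(** Half of [Re nu] is spent: the exponent [k + 1 + Re nu / 2] is used after dropping the summand 1,
    which makes both variables summable, and the remaining power of a base at least 1 is bounded by
    1. *)
Lemma cpow_term_bound nu k q : 0 < q -> 0 < fst nu -> exists K, 0 < K /\ forall al xi, 0 < al -> 0 < xi ->
  Cmod (Cmult (RtoC (xi ^ k)) (cpow (q * (al * xi) + 1) (Copp (Cplus nu (RtoC (INR k + 1))))))
  <= K * (Rpower al (- (INR k + 1 + fst nu / 2)) * Rpower xi (- (1 + fst nu / 2))).
Proof.
  intros Hq Hnu. set (A := INR k + 1 + fst nu / 2). assert (HA : 0 < A) by (unfold A; generalize (pos_INR k); lra).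
  exists (Rpower q (- A)). split; [apply Rpower_pos|]. intros al xi Hal Hxi.
  assert (Hax : 0 < al * xi) by nra. assert (Hqax : 0 < q * (al * xi)) by nra.
  rewrite Cmod_mult, Cmod_cpow, Cmod_R. assert (Hk : 0 < xi ^ k) by (apply pow_lt; exact Hxi).
  rewrite Rabs_pos_eq by lra.
  replace (fst (Copp (Cplus nu (RtoC (INR k + 1))))) with (- A + - (fst nu / 2)) by (unfold A, Copp, Cplus, RtoC; simpl; field).
  rewrite Rpower_plus.
  assert (H1 : Rpower (q * (al * xi) + 1) (- A) <= Rpower (q * (al * xi)) (- A)) by (apply Rpower_neg_mono; lra).
  assert (H2 : Rpower (q * (al * xi) + 1) (- (fst nu / 2)) <= 1).
  { apply Rle_trans with (Rpower 1 (- (fst nu / 2))); [apply Rpower_neg_mono; lra|].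
    unfold Rpower. rewrite ln_1, Rmult_0_r, exp_0. lra. }
  rewrite <- !Rpower_mult_distr in H1 by assumption.
  replace (Rpower xi (- (1 + fst nu / 2))) with (xi ^ k * Rpower xi (- A)).
  2:{ rewrite <- Rpower_pow, <- Rpower_plus by exact Hxi. f_equal. unfold A. ring. }
  apply Rle_trans with (xi ^ k * (Rpower q (- A) * (Rpower al (- A) * Rpower xi (- A)) * 1)); [|right; ring].
  apply Rmult_le_compat_l; [lra|]. apply Rmult_le_compat; auto; left; apply Rpower_pos.
Qed.

Lemma theta_square_tail k theta psi y d : (1 <= k)%nat -> 0 < theta < 1 -> 0 < psi < 1 -> 0 < y -> 0 < d ->
  exists K, 0 < K /\ forall u N, 0 < u ->
  Rabs (Series (fun m => Series (fun n => fst (quad theta psi (fun al xi => RtoC (theta_term k y u al xi)) m n)))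
        - sum_n (fun m => sum_n (fun n => fst (quad theta psi (fun al xi => RtoC (theta_term k y u al xi)) m n)) N) N)
  <= K * Rpower u (- (INR k + 1 + d)) *
     (Series (zeta_pair (INR k + 1 + d) theta) * Series (zeta_pair (1 + d) psi)
      - sum_n (zeta_pair (INR k + 1 + d) theta) N * sum_n (zeta_pair (1 + d) psi) N).
Proof.
  intros Hk Hth Hpsi Hy Hd. destruct (theta_term_bound k y d Hy Hd) as [K [HK H]].
  assert (Hk1 : 1 <= INR k) by (apply (le_INR 1); exact Hk).
  exists K. split; [exact HK|]. intros u N Hu.
  set (c := K * Rpower u (- (INR k + 1 + d))).
  assert (HA := ex_series_zeta_pair (INR k + 1 + d) theta ltac:(lra) Hth).
  assert (HB := ex_series_zeta_pair (1 + d) psi ltac:(lra) Hpsi).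
  assert (HA' : ex_series (fun m => c * zeta_pair (INR k + 1 + d) theta m))
    by (apply ex_series_scal_R; exact HA).
  assert (T := dominated_square_le
    (fun m n => fst (quad theta psi (fun al xi => RtoC (theta_term k y u al xi)) m n))
    (fun m => c * zeta_pair (INR k + 1 + d) theta m) (zeta_pair (1 + d) psi)).
  eapply Rle_trans; [apply T|]; auto.
  - intros m n. eapply Rle_trans; [apply Rabs_fst_le_Cmod|]. apply quad_bound; auto.
    intros al xi Hal Hxi. rewrite Cmod_R, Rabs_pos_eq; [apply H; assumption|].
    unfold theta_term. apply Rmult_le_pos; [apply pow_le; lra|left; apply exp_pos].
  - rewrite Series_scal_l, sum_n_Rmult_l. right. ring.
Qed.

(** The existential with [is_series] asserts convergence on the Bessel side. The double sum, written
    with total [CSeries], converges absolutely by [cpow_term_bound]. *)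
Theorem theorem2p13 (a x theta psi : R) (k : nat) (nu : C)
  (ha : 0 < a) (hx : 0 < x)
  (htheta : 0 < theta < 1) (hpsi : 0 < psi < 1)
  (hk : Nat.Odd k) (hnu : 0 < fst nu) :
  exists L : C,
    is_series (V := C_R_NormedModule)
      (fun j : nat =>
         let n := S j in
         Cmult (Cmult (cpow (INR n) (Cdiv nu (RtoC 2))) (besselK nu (a * sqrt (INR n * x))))
           (RtoC (divisor_sum n (fun d =>
              INR d ^ k * cos (2 * PI * INR d * theta)
                        * cos (2 * PI * INR n * psi / INR d)))))
      L /\
    Cmult (cpow (a ^ 2 * x / 4) (Cplus (Cdiv nu (RtoC 2)) (RtoC (INR k + 1)))) L =
    Cplus
      (Cmult (Cmult (RtoC ((-1) ^ ((k - 1) / 2) * a ^ (2 * k + 2) * INR (fact k)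
                            / (2 ^ (2 * k + 4) * (2 * PI) ^ (k + 1))))
                    (cGamma nu))
             (RtoC ((hurwitz_zeta (INR k + 1) theta + hurwitz_zeta (INR k + 1) (1 - theta))
                    * x ^ (k + 1))))
      (Cmult (Cmult (RtoC ((-1) ^ ((k + 1) / 2) / 8 * (2 * PI) ^ (k + 1)))
                    (cGamma (Cplus nu (RtoC (INR k + 1)))))
        (CSeries (fun m : nat => CSeries (fun n : nat =>
           let e := Copp (Cplus nu (RtoC (INR k + 1))) in
           let c := 16 * PI ^ 2 / a ^ 2 in
           Cplus (Cplus
             (Cmult (RtoC ((INR n + psi) ^ k))
                    (cpow (c * ((INR m + theta) * (INR n + psi)) / x + 1) e))
             (Cmult (RtoC ((INR n + 1 - psi) ^ k))
                    (cpow (c * ((INR m + theta) * (INR n + 1 - psi)) / x + 1) e)))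
           (Cplus
             (Cmult (RtoC ((INR n + psi) ^ k))
                    (cpow (c * ((INR m + 1 - theta) * (INR n + psi)) / x + 1) e))
             (Cmult (RtoC ((INR n + 1 - psi) ^ k))
                    (cpow (c * ((INR m + 1 - theta) * (INR n + 1 - psi)) / x + 1) e))))))).
Proof.
  assert (HP := PI_RGT_0).
  assert (Hk : (1 <= k)%nat) by (destruct hk; lia).
  set (y := a ^ 2 * x / 4).
  assert (Ha2 : 0 < a ^ 2) by (apply pow_lt; lra).
  assert (Hy : 0 < y) by (unfold y; apply Rdiv_lt_0_compat; [apply Rmult_lt_0_compat|]; lra).
  set (sg := (-1) ^ ((k + 1) / 2)).
  set (Zt := hurwitz_zeta (INR k + 1) theta + hurwitz_zeta (INR k + 1) (1 - theta)).
  set (nup := Cplus nu (RtoC (INR k + 1))).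
  assert (Hnup : 0 < fst nup) by (unfold nup, Cplus, RtoC; simpl; generalize (pos_INR k); lra).
  (* [Mc] and [D] are the coefficients of [theta_transformation] at [w = y/u], with [u^(k+1)] taken
     out of [(2 pi / w)^(k+1)]. *)
  set (Mc := - (INR (fact k) / 2) * (sg / (2 * PI) ^ (k + 1) * Zt)).
  set (D := / 4 * (sg * (2 * PI / y) ^ (k + 1))).
  set (F := fun al xi : R => Cmult (RtoC (xi ^ k)) (cpow (16 * PI ^ 2 / a ^ 2 * (al * xi) / x + 1) (Copp nup))).
  set (term := fun j : nat => Cmult (Cmult (cpow (INR (S j)) (Cdiv nu (RtoC 2))) (besselK nu (a * sqrt (INR (S j) * x))))
           (RtoC (twisted_sigma k theta psi (S j)))).
  set (W := CSeries (fun m => CSeries (fun n => quad theta psi F m n))).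
  set (HL := Cplus (Cmult (RtoC Mc) (cGamma nu)) (Cmult (Cmult (RtoC D) (cGamma nup)) W)).
  set (c2 := Cmult (RtoC 2) (cpow y (Cdiv nu (RtoC 2)))).
  assert (Hpos4 : 0 < 4 * PI ^ 2) by (assert (0 < PI ^ 2) by (apply pow_lt; lra); lra).
  (* [fN] and [hN] are the integrands of the partial sums on the two sides; being finite sums, they
     are integrated exactly in [cf] and [ch]. *)
  set (fN := fun N u => csum (fun j => Cmult (RtoC (twisted_sigma k theta psi (S j))) (gamma_kernel nu 1 (INR (S j) * y) u)) N).
  set (kern := fun al xi u : R => Cmult (RtoC (xi ^ k)) (gamma_kernel nup (1 + 4 * PI ^ 2 * (al * xi) / y) 0 u)).
  set (hN := fun N u => Cplus (Cmult (RtoC Mc) (gamma_kernel nu 1 0 u))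
     (Cmult (RtoC D) (csum (fun m => csum (fun n => quad theta psi (fun al xi => kern al xi u) m n) N) N))).
  assert (cf : forall N, cint (fN N) (Cmult c2 (csum term N))).
  { intros N. unfold fN. rewrite <- csum_mult_l. apply cint_csum. intros j.
    assert (T := cint_scal (RtoC (twisted_sigma k theta psi (S j))) _ _
       (cint_bessel_term nu a x (INR (S j)) ha hx hnu ltac:(apply lt_0_INR; lia))).
    replace (Cmult c2 (term j)) with (Cmult (RtoC (twisted_sigma k theta psi (S j)))
        (Cmult (Cmult (RtoC 2) (cpow (a ^ 2 * x / 4) (Cdiv nu (RtoC 2))))
           (Cmult (cpow (INR (S j)) (Cdiv nu (RtoC 2))) (besselK nu (a * sqrt (INR (S j) * x)))))); [exact T|].
    unfold c2, term. fold y. ring. }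
  assert (ch : forall N, cint (hN N) (Cplus (Cmult (RtoC Mc) (cGamma nu))
     (Cmult (Cmult (RtoC D) (cGamma nup)) (csum (fun m => csum (quad theta psi F m) N) N)))).
  { intros N. unfold hN. apply cint_plus; [apply cint_scal, cint_cGamma; exact hnu|].
    rewrite <- Cmult_assoc. apply cint_scal. rewrite <- csum_mult_l. apply cint_csum. intros m.
    rewrite <- csum_mult_l. apply cint_csum. intros n. rewrite <- quad_mult.
    apply cint_quad; auto. intros al xi Hal Hxi. unfold kern, F.
    assert (Hax : 0 < al * xi) by nra.
    assert (E : 16 * PI ^ 2 / a ^ 2 * (al * xi) / x + 1 = 1 + 4 * PI ^ 2 * (al * xi) / y) by (unfold y; field; lra).
    rewrite E.
    assert (Hc : 0 < 1 + 4 * PI ^ 2 * (al * xi) / y) by (assert (0 < 4 * PI ^ 2 * (al * xi) / y) by (apply Rdiv_lt_0_compat; [apply Rmult_lt_0_compat|]; lra); lra).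
    assert (T := cint_scal (RtoC (xi ^ k)) _ _ (cint_gamma_scaled nup _ Hnup Hc)).
    match type of T with cint _ ?v => replace (Cmult (cGamma nup) _) with v; [exact T|] end. ring. }
  assert (ccf : forall N, ccont (fN N)).
  { intros N. apply ccont_csum. intros j. apply ccont_scal, ccont_gamma_kernel. }
  assert (cch : forall N, ccont (hN N)).
  { intros N. apply ccont_plus; apply ccont_scal; [apply ccont_gamma_kernel|].
    apply ccont_csum. intros m. apply ccont_csum. intros n. apply ccont_quad. intros al xi.
    apply ccont_scal, ccont_gamma_kernel. }
  (* Any [d] strictly between 0 and [Re nu] keeps the lattice exponents summable and [Re nu - d]
     positive; the half also matches [cpow_term_bound]. *)
  set (d := fst nu / 2). assert (Hd : 0 < d) by (unfold d; lra).
  set (gap := fun N => Series (zeta_pair (INR k + 1 + d) theta) * Series (zeta_pair (1 + d) psi)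
      - sum_n (zeta_pair (INR k + 1 + d) theta) N * sum_n (zeta_pair (1 + d) psi) N).
  set (tau := series_gap (fun n => Rpower (INR n + 1) (- 2))).
  assert (Hk1 : 1 <= INR k) by (apply (le_INR 1); exact Hk).
  assert (HA := ex_series_zeta_pair (INR k + 1 + d) theta ltac:(lra) htheta).
  assert (HB := ex_series_zeta_pair (1 + d) psi ltac:(lra) hpsi).
  assert (Hgap : is_lim_seq gap 0) by (apply dominated_square_gap_lim; assumption).
  assert (Htau : is_lim_seq tau 0) by (apply series_gap_lim, ex_series_Rpower_m2; lra).
  assert (Htau0 : forall N, 0 <= tau N).
  { intros N. unfold tau, series_gap. apply Rge_le, Rge_minus, Rle_ge, sum_n_le_Series; [|apply ex_series_Rpower_m2; lra].
    intros n. left; apply Rpower_pos. }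
  assert (Hgap0 : forall N, 0 <= gap N).
  { intros N. unfold gap.
    assert (S1 := sum_n_le_Series _ N (fun n => zeta_pair_pos (INR k + 1 + d) theta n) HA).
    assert (S2 := sum_n_le_Series _ N (fun n => zeta_pair_pos (1 + d) psi n) HB).
    assert (P1 : forall s al, 0 <= sum_n (zeta_pair s al) N).
    { intros s al. clear. induction N as [|N IH]; [rewrite sum_O|rewrite sum_Sn_R]; generalize (zeta_pair_pos s al); intros Z.
      - apply Z. - specialize (Z (S N)). lra. }
    assert (Q1 := P1 (INR k + 1 + d) theta). assert (Q2 := P1 (1 + d) psi).
    assert (sum_n (zeta_pair (INR k + 1 + d) theta) N * sum_n (zeta_pair (1 + d) psi) N
      <= Series (zeta_pair (INR k + 1 + d) theta) * Series (zeta_pair (1 + d) psi)) by (apply Rmult_le_compat; assumption).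
    lra. }
  destruct (twisted_sigma_tail k theta psi) as [K1 [HK1 B1]].
  destruct (theta_square_tail k theta psi y d Hk htheta hpsi Hy Hd) as [K2 [HK2 B2]].
  (* The two majorants belong to the error powers [u^(k+3)] and [u^(-d)], each multiplied by
     [u^(Re nu - 1) e^(-u)]. *)
  destruct (Dom_bound (fst nu + INR k + 3) 1) as [K3 [HK3 B3]]; [lra|lra|].
  destruct (Dom_bound (fst nu - d) 1) as [K4 [HK4 B4]]; [unfold d; lra|lra|].
  set (C1 := K1 * Rpower y (- (INR k + 3)) * K3). set (C2 := Rabs D * K2 * K4).
  assert (HC1 : 0 <= C1) by (unfold C1; left; repeat apply Rmult_lt_0_compat; auto using Rpower_pos).
  assert (HC2 : 0 <= C2) by (unfold C2; apply Rmult_le_pos; [apply Rmult_le_pos; [apply Rabs_pos|lra]|lra]).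
  assert (Hclose : forall N, Cmod (Cminus (Cmult c2 (csum term N)) (Cplus (Cmult (RtoC Mc) (cGamma nu))
     (Cmult (Cmult (RtoC D) (cGamma nup)) (csum (fun m => csum (quad theta psi F m) N) N)))) <= C1 * tau N + C2 * gap N).
  { intros N. assert (ci := cint_plus _ _ _ _ (cf N) (cint_scal (Copp (RtoC 1)) _ _ (ch N))).
    replace (Cminus (Cmult c2 (csum term N)) _) with
      (Cplus (Cmult c2 (csum term N)) (Cmult (Copp (RtoC 1)) (Cplus (Cmult (RtoC Mc) (cGamma nu))
     (Cmult (Cmult (RtoC D) (cGamma nup)) (csum (fun m => csum (quad theta psi F m) N) N))))) by ring.
    apply (cint_dom_le _ _ (C1 * tau N) (C2 * gap N) (fst nu + INR k + 3) (fst nu - d)) with (2 := ci).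
    - apply ccont_plus; [apply ccf|apply ccont_scal, cch].
    - apply Rmult_le_pos; auto.
    - apply Rmult_le_pos; auto.
    - intros u Hu. assert (Hw : 0 < y / u) by (apply Rdiv_lt_0_compat; lra).
      set (p := gamma_kernel nu 1 0 u).
      set (sf := sum_n (fun j => twisted_sigma k theta psi (S j) * exp (- (INR (S j) * (y / u)))) N).
      set (qt := fun m n => fst (quad theta psi (fun al xi => RtoC (theta_term k y u al xi)) m n)).
      set (sq := sum_n (fun m => sum_n (qt m) N) N).
      assert (Ef : fN N u = Cmult p (RtoC sf)).
      { unfold fN, sf. rewrite <- csum_RtoC, <- csum_mult_l. apply csum_ext. intros j.
        rewrite gamma_kernel_split by exact Hu. fold p. rewrite RtoC_mult.
        replace (INR (S j) * y / u) with (INR (S j) * (y / u)) by (field; lra). ring. }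
      assert (Eh : hN N u = Cmult p (RtoC (Mc + D * u ^ (k + 1) * sq))).
      { assert (Eq : csum (fun m => csum (fun n => quad theta psi (fun al xi => kern al xi u) m n) N) N
           = Cmult (Cmult p (RtoC (u ^ (k + 1)))) (RtoC sq)).
        { unfold sq. rewrite <- csum_RtoC, <- csum_mult_l. apply csum_ext. intros m.
          rewrite <- csum_RtoC, <- csum_mult_l. apply csum_ext. intros n.
          unfold qt. rewrite <- quad_RtoC, <- quad_mult. apply quad_ext; auto. intros al xi Hal Hxi.
          unfold kern, nup. rewrite gamma_kernel_shift by assumption. fold p. ring. }
        unfold hN. fold p. rewrite Eq, RtoC_plus, !RtoC_mult. ring. }
      (* Both expansions sum to the same function of [u], so the difference of the partial sums is a
         difference of two tails. *)
      assert (S1 := is_series_unique _ _ (lambert_divisor k theta psi (y / u) Hk Hw)).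
      rewrite theta_transformation in S1 by assumption.
      fold sg Zt Mc in S1.
      assert (S2 : Series (fun j => twisted_sigma k theta psi (S j) * exp (- (INR (S j) * (y / u))))
        = Mc + D * u ^ (k + 1) * Series (fun m => Series (qt m))).
      { rewrite S1. f_equal. f_equal.
        - unfold D. replace (2 * PI / (y / u)) with (2 * PI / y * u) by (field; lra). rewrite Rpow_mult_distr. ring.
        - apply Series_ext. intros m. apply Series_ext. intros n. apply theta_pair_quad. }
      assert (T1 := B1 (y / u) N Hw). fold tau sf in T1. rewrite S2 in T1.
      assert (T2 := B2 u N Hu). fold (gap N) in T2. 
      change (Rabs (Series (fun m => Series (qt m)) - sq) <= K2 * Rpower u (- (INR k + 1 + d)) * gap N) in T2.
      rewrite Ef, Eh.
      replace (Cplus (Cmult p (RtoC sf)) (Cmult (Copp (RtoC 1)) (Cmult p (RtoC (Mc + D * u ^ (k + 1) * sq)))))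
        with (Cmult p (RtoC (sf - (Mc + D * u ^ (k + 1) * sq)))) by (rewrite RtoC_minus; ring).
      rewrite Cmod_mult, Cmod_R.
      assert (Hp := gamma_kernel_le nu 1 0 u Hu (Rle_refl 0)). fold p in Hp.
      set (SS := Series (fun m => Series (qt m))) in *.
      assert (Huk : u ^ (k + 1) = Rpower u (INR k + 1)).
      { rewrite <- Rpower_pow by exact Hu. f_equal. rewrite plus_INR. reflexivity. }
      assert (Hdiff : Rabs (sf - (Mc + D * u ^ (k + 1) * sq)) <=
        K1 * Rpower y (- (INR k + 3)) * Rpower u (INR k + 3) * tau N + Rabs D * K2 * Rpower u (- d) * gap N).
      { replace (sf - (Mc + D * u ^ (k + 1) * sq)) with
          (- (Mc + D * u ^ (k + 1) * SS - sf) + D * u ^ (k + 1) * (SS - sq)) by ring.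
        eapply Rle_trans; [apply Rabs_triang|]. rewrite Rabs_Ropp. apply Rplus_le_compat.
        - eapply Rle_trans; [exact T1|]. right.
          replace (Rpower (y / u) (- (INR k + 3))) with (Rpower y (- (INR k + 3)) * Rpower u (INR k + 3)); [ring|].
          unfold Rdiv. rewrite <- Rpower_mult_distr by (try apply Rinv_0_lt_compat; lra). f_equal.
          unfold Rpower. rewrite ln_Rinv by exact Hu. f_equal. ring.
        - rewrite !Rabs_mult, (Rabs_pos_eq (u ^ (k + 1))) by (apply pow_le; lra).
          apply Rle_trans with (Rabs D * u ^ (k + 1) * (K2 * Rpower u (- (INR k + 1 + d)) * gap N)).
          + apply Rmult_le_compat_l; [apply Rmult_le_pos; [apply Rabs_pos|apply pow_le; lra]|exact T2].
          + right. replace (Rpower u (- d)) with (u ^ (k + 1) * Rpower u (- (INR k + 1 + d))); [ring|].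
            rewrite Huk, <- Rpower_plus. f_equal. ring. }
      apply Rle_trans with (Rpower u (fst nu - 1) * exp (- (1 * u)) *
         (K1 * Rpower y (- (INR k + 3)) * Rpower u (INR k + 3) * tau N + Rabs D * K2 * Rpower u (- d) * gap N)).
      { apply Rmult_le_compat; auto using Cmod_ge_0, Rabs_pos. }
      assert (D3 := B3 u Hu). assert (D4 := B4 u Hu).
      replace (fst nu + INR k + 3 - 1) with (fst nu - 1 + (INR k + 3)) in D3 by ring. rewrite Rpower_plus in D3.
      replace (fst nu - d - 1) with (fst nu - 1 + - d) in D4 by ring. rewrite Rpower_plus in D4.
      assert (G1 : 0 <= K1 * Rpower y (- (INR k + 3)) * tau N).
      { apply Rmult_le_pos; auto. left. apply Rmult_lt_0_compat; auto using Rpower_pos. }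
      assert (G2 : 0 <= Rabs D * K2 * gap N).
      { apply Rmult_le_pos; auto. apply Rmult_le_pos; [apply Rabs_pos|lra]. }
      apply (Rmult_le_compat_l _ _ _ G1) in D3. apply (Rmult_le_compat_l _ _ _ G2) in D4.
      unfold C1, C2.
      eapply Rle_trans; [|eapply Rle_trans; [apply (Rplus_le_compat _ _ _ _ D3 D4)|]]; right; ring. }
  assert (HhL : clim (fun N => Cplus (Cmult (RtoC Mc) (cGamma nu))
     (Cmult (Cmult (RtoC D) (cGamma nup)) (csum (fun m => csum (quad theta psi F m) N) N))) HL).
  { apply clim_affine.
    destruct (cpow_term_bound nu k (16 * PI ^ 2 / a ^ 2 / x)) as [K [HK HKb]]; [|exact hnu|].
    { apply Rdiv_lt_0_compat; [|exact hx]. apply Rdiv_lt_0_compat; lra. }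
    apply (csum_square_lim (quad theta psi F) (fun m => K * zeta_pair (INR k + 1 + d) theta m) (zeta_pair (1 + d) psi)).
    - intros m n. apply quad_bound; auto. intros al xi Hal Hxi.
      specialize (HKb al xi Hal Hxi). unfold F.
      replace (16 * PI ^ 2 / a ^ 2 * (al * xi) / x) with (16 * PI ^ 2 / a ^ 2 / x * (al * xi)) by (field; lra).
      exact HKb.
    - apply ex_series_scal_R. exact HA.
    - exact HB. }
  assert (HfL : clim (fun N => Cmult c2 (csum term N)) HL).
  { apply (clim_close _ _ _ (fun N => C1 * tau N + C2 * gap N) HhL Hclose).
    apply is_lim_seq_plus_0; apply is_lim_seq_scal_0; assumption. }
  set (c2i := Cmult (RtoC (/ 2)) (cpow y (Copp (Cdiv nu (RtoC 2))))).
  assert (Hc2 : Cmult c2i c2 = RtoC 1).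
  { unfold c2i, c2.
    transitivity (Cmult (Cmult (RtoC (/ 2)) (RtoC 2)) (Cmult (cpow y (Copp (Cdiv nu (RtoC 2)))) (cpow y (Cdiv nu (RtoC 2))))); [ring|].
    rewrite cpow_opp_l, <- RtoC_mult. replace (/ 2 * 2) with 1 by field. ring. }
  exists (Cmult c2i HL). split.
  - change (is_series (V := C_R_NormedModule) term (Cmult c2i HL)).
    apply clim_is_series. assert (T := clim_affine _ _ c2i (RtoC 0) HfL).
    unfold clim in *. rewrite Cplus_0_l in T. eapply is_lim_seq_ext; [|exact T].
    intros N. cbv beta. rewrite Cplus_0_l, Cmult_assoc, Hc2, Cmult_1_l. reflexivity.
  - change (Cmult (cpow y (Cplus (Cdiv nu (RtoC 2)) (RtoC (INR k + 1)))) (Cmult c2i HL) =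
      Cplus (Cmult (Cmult (RtoC ((-1) ^ ((k - 1) / 2) * a ^ (2 * k + 2) * INR (fact k)
                            / (2 ^ (2 * k + 4) * (2 * PI) ^ (k + 1)))) (cGamma nu)) (RtoC (Zt * x ^ (k + 1))))
       (Cmult (Cmult (RtoC (sg / 8 * (2 * PI) ^ (k + 1))) (cGamma nup)) W)).
    rewrite cpow_plus, cpow_real.
    replace (Rpower y (INR k + 1)) with (y ^ (k + 1)).
    2:{ rewrite <- Rpower_pow by exact Hy. f_equal. rewrite plus_INR. reflexivity. }
    transitivity (Cmult (Cmult (RtoC (y ^ (k + 1) / 2)) HL)
       (Cmult (cpow y (Copp (Cdiv nu (RtoC 2)))) (cpow y (Cdiv nu (RtoC 2))))).
    { unfold c2i, Rdiv. rewrite RtoC_mult. ring. }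
    rewrite cpow_opp_l, Cmult_1_r.
    assert (Hyk : y ^ (k + 1) = a ^ (2 * k + 2) * x ^ (k + 1) / 2 ^ (2 * k + 2)).
    { unfold y, Rdiv. rewrite !Rpow_mult_distr, <- pow_mult, pow_inv.
      replace (2 * (k + 1))%nat with (2 * k + 2)%nat by lia.
      replace 4 with (2 ^ 2) by ring. rewrite <- pow_mult. replace (2 * (k + 1))%nat with (2 * k + 2)%nat by lia. reflexivity. }
    (* For [k = 2 h + 1] the two [nat] quotients are [h] and [h + 1], so the minus sign of [Mc]
       turns into the stated exponent. *)
    assert (Hsg : (-1) ^ ((k - 1) / 2) = - sg).
    { unfold sg. destruct hk as [h Hh]. subst k.
      replace ((2 * h + 1 + 1) / 2)%nat with (S h) by (replace (2 * h + 1 + 1)%nat with (S h * 2)%nat by lia; rewrite Nat.div_mul; lia).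
      replace ((2 * h + 1 - 1) / 2)%nat with h by (replace (2 * h + 1 - 1)%nat with (h * 2)%nat by lia; rewrite Nat.div_mul; lia).
      simpl. ring. }
    assert (N1 : (2 * PI) ^ (k + 1) <> 0) by (apply pow_nonzero; lra).
    assert (N2 : 2 ^ (2 * k + 2) <> 0) by (apply pow_nonzero; lra).
    (* [2^(2k+4)] is [4^(k+1)] from [y], times 2 from the Bessel integral and 2 from [k!/2]. *)
    assert (E1 : y ^ (k + 1) / 2 * Mc = (-1) ^ ((k - 1) / 2) * a ^ (2 * k + 2) * INR (fact k)
                            / (2 ^ (2 * k + 4) * (2 * PI) ^ (k + 1)) * (Zt * x ^ (k + 1))).
    { rewrite Hsg, Hyk. unfold Mc. replace (2 * k + 4)%nat with (2 * k + 2 + 2)%nat by lia.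
      rewrite (pow_add 2 (2 * k + 2) 2). field. split; assumption. }
    (* The powers of [y] cancel; [1/8] is [1/2] from the Bessel integral times [1/4] from the
       transformation. *)
    assert (E2 : y ^ (k + 1) / 2 * D = sg / 8 * (2 * PI) ^ (k + 1)).
    { unfold D. unfold Rdiv at 2. rewrite Rpow_mult_distr, pow_inv.
      assert (y ^ (k + 1) <> 0) by (apply pow_nonzero; lra). field. assumption. }
    rewrite <- E2. unfold HL.
    transitivity (Cplus (Cmult (RtoC (y ^ (k + 1) / 2 * Mc)) (cGamma nu))
      (Cmult (Cmult (RtoC (y ^ (k + 1) / 2 * D)) (cGamma nup)) W)).
    { rewrite !RtoC_mult. ring. }
    rewrite E1, RtoC_mult. ring.
Qed.
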